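(* Let $N\ge3$ and let $\mathcal X=\{X_1,\dots,X_m\}$, $m\le N$, be linearly independent smooth vector fields on $\mathbb{R}^N$ such that (i) each $X_i$ is homogeneous of degree one with respect to a family of dilations $\delta_\lambda(x)=(\lambda^{\sigma_1}x_1,\dots,\lambda^{\sigma_N}x_N)$, $\lambda>0$, where $1=\sigma_1\le\dots\le\sigma_N$ are positive integers; and (ii) $\mathcal X$ satisfies the H\''ormander (bracket generating) condition. If $u$ is a classical solution of $$-\Delta_{\mathcal X}u+|D_{\mathcal X}u|^2=0\quad\text{in }\mathbb{R}^N,$$ then $u$ is constant.
   Context: $D_{\mathcal X}u=(X_1u,\dots,X_mu)\in\mathbb{R}^m$ is the horizontal gradient and $\Delta_{\mathcal X}u=\sum_{i=1}^mX_i^2u$. A vector field $X$ is $\delta_\lambda$-homogeneous of degree one if $X(\varphi\circ\delta_\lambda)=\lambda (X\varphi)\circ\delta_\lambda$ for all smooth $\varphi$ and $\lambda>0$. The H\''ormander condition means that the Lie algebra generated by $X_1,\dots,X_m$ spans $\mathbb{R}^N$ at every point. *)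

(* Defs.v *)
From HB Require Import structures.
From mathcomp Require Import all_boot all_order all_algebra.
From mathcomp Require Import all_classical all_reals all_analysis.
Set Implicit Arguments. Unset Strict Implicit. Unset Printing Implicit Defensive.
Import Order.TTheory GRing.Theory Num.Theory.
Import numFieldNormedType.Exports.
Local Open Scope ring_scope.

Section Defs.
Variables (R : realType) (N : nat).

Definition evec (j : 'I_N) : 'rV[R]_N := delta_mx 0 j.

Definition partial (j : 'I_N) (f : 'rV[R]_N -> R) : 'rV[R]_N -> R :=
  fun x => derive f x (evec j).

Definition iter_partial (s : seq 'I_N) (f : 'rV[R]_N -> R) : 'rV[R]_N -> R :=
  foldr partial f s.

Definition smooth_fun (f : 'rV[R]_N -> R) : Prop :=
  forall (s : seq 'I_N) (x : 'rV[R]_N), differentiable (iter_partial s f) x.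

Definition C2_fun (f : 'rV[R]_N -> R) : Prop :=
  (forall (s : seq 'I_N) (x : 'rV[R]_N), (size s <= 1)%N ->
      differentiable (iter_partial s f) x) /\
  (forall (s : seq 'I_N), size s = 2%N -> continuous (iter_partial s f)).

Definition smooth_vf (X : 'rV[R]_N -> 'rV[R]_N) : Prop :=
  forall j : 'I_N, smooth_fun (fun x => X x 0 j).

Definition vf_act (X : 'rV[R]_N -> 'rV[R]_N) (f : 'rV[R]_N -> R) : 'rV[R]_N -> R :=
  fun x => \sum_(j < N) X x 0 j * partial j f x.

Definition lie_bracket (X Y : 'rV[R]_N -> 'rV[R]_N) : 'rV[R]_N -> 'rV[R]_N :=
  fun x => \row_(k < N) (vf_act X (fun y => Y y 0 k) x - vf_act Y (fun y => X y 0 k) x).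

Inductive lie_gen (m : nat) (Xs : 'I_m -> 'rV[R]_N -> 'rV[R]_N) :
    ('rV[R]_N -> 'rV[R]_N) -> Prop :=
  | lie_gen_base (i : 'I_m) : lie_gen Xs (Xs i)
  | lie_gen_br (Y Z : 'rV[R]_N -> 'rV[R]_N) :
      lie_gen Xs Y -> lie_gen Xs Z -> lie_gen Xs (lie_bracket Y Z).

(* Hormander condition: at every point, the values of the iterated brackets
   (which linearly span the generated Lie algebra) span R^N *)
Definition hormander (m : nat) (Xs : 'I_m -> 'rV[R]_N -> 'rV[R]_N) : Prop :=
  forall x : 'rV[R]_N, exists (k : nat) (Z : 'I_k -> 'rV[R]_N -> 'rV[R]_N),
    (forall i, lie_gen Xs (Z i)) /\ row_full (\matrix_(i < k) Z i x).

Definition vf_lin_indep (m : nat) (Xs : 'I_m -> 'rV[R]_N -> 'rV[R]_N) : Prop :=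
  forall c : 'I_m -> R,
    (forall x, \sum_(i < m) c i *: Xs i x = 0) -> forall i, c i = 0.

Definition dil (sigma : 'I_N -> nat) (l : R) (x : 'rV[R]_N) : 'rV[R]_N :=
  \row_(j < N) (l ^+ sigma j * x 0 j).

Definition hom_deg_one (sigma : 'I_N -> nat) (X : 'rV[R]_N -> 'rV[R]_N) : Prop :=
  forall (phi : 'rV[R]_N -> R) (l : R), smooth_fun phi -> 0 < l ->
    forall x, vf_act X (phi \o dil sigma l) x = l * vf_act X phi (dil sigma l x).

Definition hgrad (m : nat) (Xs : 'I_m -> 'rV[R]_N -> 'rV[R]_N) (u : 'rV[R]_N -> R)
  (x : 'rV[R]_N) : 'rV[R]_m := \row_(i < m) vf_act (Xs i) u x.

Definition sublap (m : nat) (Xs : 'I_m -> 'rV[R]_N -> 'rV[R]_N) (u : 'rV[R]_N -> R)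
  (x : 'rV[R]_N) : R := \sum_(i < m) vf_act (Xs i) (vf_act (Xs i) u) x.

End Defs.

Definition hgrad_norm2 (R : realType) (N m : nat)
  (Xs : 'I_m -> 'rV[R]_N -> 'rV[R]_N) (u : 'rV[R]_N -> R) (x : 'rV[R]_N) : R :=
  \sum_(i < m) (hgrad Xs u x 0 i) ^+ 2.

(* Main.v *)
Require Import Defs.
From HB Require Import structures.
From mathcomp Require Import all_boot all_order all_algebra.
From mathcomp Require Import all_classical all_reals all_analysis.
From mathcomp Require Import ring lra zify.
Set Implicit Arguments. Unset Strict Implicit. Unset Printing Implicit Defensive.
Import Order.TTheory GRing.Theory Num.Theory.
Import numFieldNormedType.Exports.
Local Open Scope ring_scope.

(* The function w = exp (- u) is positive and weakly harmonic for the sum of squares of the X_i, so it suffices to prove a Harnack inequality w x <= K w y with a constant K independent of w, x and y: applied to w - inf w + e it gives w = inf w as e tends to 0.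

Homogeneity makes the flows of the X_i polynomial and triangular, so they preserve volume, and it lets the Hormander condition at the origin act everywhere: compositions of flows with times O(r) reach, through a volume preserving triangular parametrization, all points at homogeneous distance r. Comparing a function with its translates along these compositions gives Nash and Poincare inequalities in terms of the horizontal gradient. Caccioppoli estimates for f = log w and Moser iteration then bound the supremum of w^p and of w^(-p) by their means. The two means are compared by a John-Nirenberg argument adapted to dilations: at a scale where the mean of w^p does not grow too fast, the Poincare inequality bounds it by exp of the mean of p f; otherwise it grows geometrically in the scale, which is impossible after truncating f from above. Dilation invariance makes all constants independent of the points. *)

Section Derive1.
Variable R : realType.
Implicit Types (f g : R -> R) (t a b : R).

Lemma derD f g t a b : is_derive t 1 f a -> is_derive t 1 g b ->
  is_derive t 1 (fun s => f s + g s) (a + b).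
Proof. by move=> df dg; exact: is_deriveD. Qed.

Lemma derB f g t a b : is_derive t 1 f a -> is_derive t 1 g b ->
  is_derive t 1 (fun s => f s - g s) (a - b).
Proof. by move=> df dg; exact: is_deriveB. Qed.

Lemma derM f g t a b : is_derive t 1 f a -> is_derive t 1 g b ->
  is_derive t 1 (fun s => f s * g s) (a * g t + f t * b).
Proof.
move=> df dg; apply: is_derive_eq (is_deriveM df dg) _.
by rewrite /GRing.scale /= addrC mulrC.
Qed.

Lemma derC (c : R) t : is_derive t 1 (fun=> c) 0.
Proof. exact: is_derive_cst. Qed.

Lemma derI t : is_derive t 1 (fun s => s) 1.
Proof. exact: is_derive_id. Qed.

Lemma derZ (c : R) f t a : is_derive t 1 f a -> is_derive t 1 (fun s => c * f s) (c * a).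
Proof. by move=> df; apply: is_derive_eq (derM (derC c t) df) _; rewrite mul0r add0r. Qed.

Lemma derX n t : is_derive t 1 (fun s => s ^+ n) (n%:R * t ^+ n.-1).
Proof.
elim: n => [|n IH].
  by rewrite mul0r; under eq_fun do rewrite expr0; exact: derC.
under eq_fun do rewrite exprS.
apply: is_derive_eq (derM (derI t) IH) _.
case: n {IH} => [|n] /=; first by rewrite !mul0r mulr0 addr0 expr0 mulr1.
by rewrite mul1r mulrCA -exprS [in RHS]mulrSr mulrDl mul1r addrC.
Qed.

Lemma der_sum (I : Type) (r : seq I) (P : pred I) (F : I -> R -> R) (dF : I -> R) t :
  (forall i, P i -> is_derive t 1 (F i) (dF i)) ->
  is_derive t 1 (fun s => \sum_(i <- r | P i) F i s) (\sum_(i <- r | P i) dF i).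
Proof.
move=> h; elim: r => [|i r IH].
  by rewrite big_nil; under eq_fun do rewrite big_nil; exact: derC.
rewrite big_cons; under eq_fun do rewrite big_cons.
by case: ifP => Pi //; apply: derD => //; exact: h.
Qed.

Lemma is_derive_same (A B : R -> R) (A' : R -> R) :
  (forall s : R, is_derive s 1 A (A' s)) -> (forall s : R, is_derive s 1 B (A' s)) ->
  A 0 = B 0 -> A =1 B.
Proof.
move=> dA dB AB s.
have dAB : forall x : R, is_derive x 1 (fun s => A s - B s) 0.
  by move=> x; apply: is_derive_eq (derB (dA x) (dB x)) _; rewrite subrr.
have := is_derive_0_is_cst s 0 dAB.
rewrite AB subrr => /eqP; rewrite subr_eq0 => /eqP; exact.
Qed.

End Derive1.

Section Smooth.
Variables (R : realType) (N : nat).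
Local Notation V := 'rV[R]_N.
Implicit Types (f g q : V -> R) (x y : V) (j k : 'I_N).

Lemma diff_partial f x (v : V) : differentiable f x ->
  'd f x v = \sum_j v 0 j * partial j f x.
Proof.
move=> df; rewrite {1}(row_sum_delta v) raddf_sum /=.
by apply: eq_bigr => j _; rewrite linearZ /= /partial /evec deriveE.
Qed.

Lemma is_derive_curve f (c : R -> V) (dc : 'I_N -> R) t :
  differentiable f (c t) ->
  (forall j, is_derive t 1 (fun s => c s 0 j) (dc j)) ->
  is_derive t 1 (fun s => f (c s)) (\sum_j dc j * partial j f (c t)).
Proof.
move=> df dcj.
have cder : derivable c t 1 by apply/derivable_mxP => i j; rewrite ord1.
have cd : differentiable c t by apply/derivable1_diffP.
have fc : differentiable (f \o c) t by exact: differentiable_comp.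
split; first exact/derivable1_diffP.
rewrite deriveE // diff_comp //= -(deriveE _ cd) derive_mx //.
rewrite diff_partial //; apply: eq_bigr => j _; rewrite mxE.
by have [_ ->] := dcj j.
Qed.

Lemma is_derive_line f x (v : V) t : differentiable f (x + t *: v) ->
  is_derive t 1 (fun s => f (x + s *: v)) (\sum_j v 0 j * partial j f (x + t *: v)).
Proof.
move=> df; apply: is_derive_curve => // j.
have -> : (fun s : R => (x + s *: v) 0 j) = (fun s => x 0 j + s * v 0 j).
  by apply/funext => s; rewrite !mxE.
apply: is_derive_eq (derD (derC _ t) (derM (derI t) (derC _ t))) _.
by rewrite mul1r mulr0 addr0 add0r.
Qed.

Fixpoint dk (n : nat) f : Prop :=
  (forall x, differentiable f x) /\
  if n is n'.+1 then forall j, dk n' (partial j f) else True.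

Lemma dkW n f : dk n.+1 f -> dk n f.
Proof.
elim: n f => [|n IH] f [df dp]; first by split.
by split=> // j; apply: IH; apply: dp.
Qed.

Lemma dk_diff n f : dk n f -> forall x, differentiable f x.
Proof. by case: n => [|n] []. Qed.

Lemma iter_partial_rcons s j f :
  iter_partial (rcons s j) f = iter_partial s (partial j f).
Proof. by rewrite /iter_partial foldr_rcons. Qed.

Lemma smooth_dk f : smooth_fun f <-> forall n, dk n f.
Proof.
split=> [sf n|].
  elim: n f sf => [|n IH] f sf; first by split=> // x; exact: (sf [::]).
  split=> [x|j]; first exact: (sf [::]).
  by apply: IH => s x; rewrite -iter_partial_rcons.
move=> df s; elim/last_ind: s f df => [|s j IH] f df x; first exact: (dk_diff (df 0%N)).
rewrite iter_partial_rcons; apply: IH => n; exact: (df n.+1).2.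
Qed.

Lemma partialD f g j : (forall x, differentiable f x) -> (forall x, differentiable g x) ->
  partial j (f \+ g) = partial j f \+ partial j g.
Proof.
move=> df dg; apply/funext => x; rewrite /partial deriveD //; exact: diff_derivable.
Qed.

Lemma partialM f g j : (forall x, differentiable f x) -> (forall x, differentiable g x) ->
  partial j (f \* g) = (partial j f \* g) \+ (f \* partial j g).
Proof.
move=> df dg; apply/funext => x; rewrite /partial deriveM; try exact: diff_derivable.
by rewrite /= addrC /GRing.scale /=; congr (_ + _); rewrite mulrC.
Qed.

Lemma partial_cst (c : R) j : partial j (fun=> c) = fun=> 0.
Proof. by apply/funext => x; rewrite /partial derive_cst. Qed.

Lemma dkD n f g : dk n f -> dk n g -> dk n (f \+ g).
Proof.
elim: n f g => [|n IH] f g [df pf] [dg pg]; split=> //.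
- by move=> x; apply: differentiableD.
- by move=> x; apply: differentiableD.
by move=> j; rewrite partialD //; apply: IH; [exact: pf|exact: pg].
Qed.

Lemma dkM n f g : dk n f -> dk n g -> dk n (f \* g).
Proof.
elim: n f g => [|n IH] f g Df Dg; have [df pf] := Df; have [dg pg] := Dg; split=> //.
- by move=> x; apply: differentiableM.
- by move=> x; apply: differentiableM.
by move=> j; rewrite partialM //; apply: dkD; apply: IH;
  by [exact: pf|exact: pg|exact: dkW].
Qed.

Lemma dk_cst n (c : R) : dk n (fun=> c).
Proof.
elim: n c => [|n IH] c; split => //; try by move=> x; exact: differentiable_cst.
by move=> j; rewrite partial_cst.
Qed.

Lemma smooth_diff f : smooth_fun f -> forall x, differentiable f x.
Proof. by move=> sf x; exact: (sf [::]). Qed.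

Lemma smooth_partial f j : smooth_fun f -> smooth_fun (partial j f).
Proof. by move=> /smooth_dk sf; apply/smooth_dk => n; exact: (sf n.+1).2. Qed.

Lemma smoothD f g : smooth_fun f -> smooth_fun g -> smooth_fun (f \+ g).
Proof. by move=> /smooth_dk sf /smooth_dk sg; apply/smooth_dk => n; apply: dkD. Qed.

Lemma smoothM f g : smooth_fun f -> smooth_fun g -> smooth_fun (f \* g).
Proof. by move=> /smooth_dk sf /smooth_dk sg; apply/smooth_dk => n; apply: dkM. Qed.

Lemma smooth_cst (c : R) : smooth_fun (fun _ : V => c).
Proof. by apply/smooth_dk => n; exact: dk_cst. Qed.

Lemma partial_coord j k : partial j (fun x => x 0 k) = fun=> (j == k)%:R.
Proof.
apply/funext => x; rewrite /partial deriveE; last exact: differentiable_coord.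
have cl : linear (fun x : V => x 0 k : R) by move=> a u v; rewrite !mxE.
pose cL := GRing.isLinear.Build _ _ _ _ _ cl.
pose L : {linear V -> R} := HB.pack (fun x : V => x 0 k : R) cL.
have := @diff_lin _ _ _ L x (@coord_continuous _ _ _ _ _).
by rewrite /L /= => ->; rewrite /evec !mxE eqxx eq_sym.
Qed.

Lemma smooth_coord k : smooth_fun (fun x => x 0 k).
Proof.
apply/smooth_dk => -[|n]; (split=> [x|//]); first exact: differentiable_coord.
  exact: differentiable_coord.
by move=> j; rewrite partial_coord; exact: dk_cst.
Qed.

Lemma smooth_continuous f : smooth_fun f -> continuous f.
Proof. by move=> sf x; apply: differentiable_continuous; exact: smooth_diff. Qed.

Lemma diff0_indep f x y : (forall z, differentiable f z) ->
  (forall k z, x 0 k != y 0 k -> partial k f z = 0) -> f x = f y.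
Proof.
move=> df pf.
have dl : forall s : R, is_derive s 1 (fun s => f (x + s *: (y - x))) 0.
  move=> s; apply: is_derive_eq (is_derive_line (df _)) _.
  rewrite big1 // => k _; have [xy|/pf ->] := eqVneq (x 0 k) (y 0 k); last by rewrite mulr0.
  by rewrite !mxE xy subrr mul0r.
have := is_derive_0_is_cst 0 1 dl.
by rewrite scale0r addr0 scale1r subrKC.
Qed.

End Smooth.

Section Continuity.
Variables (R : realType).

Lemma contP (V W : normedModType R) (f : V -> W) :
  continuous f <-> forall x (e : R), 0 < e ->
    exists2 d : R, 0 < d & forall y, `|y - x| < d -> `|f y - f x| < e.
Proof.
split=> [cf x e e0|h x].
  have /cvgrPdist_lt /(_ e e0) /nbhs_ballP [d /= d0 dP] := cf x.
  exists d => // y yx; rewrite distrC; apply: dP.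
  by rewrite -ball_normE /= distrC.
apply/cvgrPdist_lt => e e0; have [d d0 dP] := h x e e0.
apply/nbhs_ballP; exists d => //= y; rewrite -ball_normE /= => yx.
by rewrite distrC; apply: dP; rewrite distrC.
Qed.

Lemma rv_norm_lt N (x : 'rV[R]_N) (e : R) : 0 < e ->
  (`|x| < e) <-> (forall j, `|x 0 j| < e).
Proof.
move=> e0; rewrite {1}/Num.Def.normr /= mx_normrE; split=> [xe j|h].
  by apply: le_lt_trans xe; exact: (le_bigmax _ (fun i : 'I_1 * 'I_N => `|x i.1 i.2|) (0, j)).
by rewrite bigmax_lt // => -[i j] _ /=; rewrite ord1; exact: h.
Qed.

Lemma rv_norm_le N (x : 'rV[R]_N) (e : R) : 0 <= e ->
  (`|x| <= e) <-> (forall j, `|x 0 j| <= e).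
Proof.
move=> e0; rewrite {1}/Num.Def.normr /= mx_normrE; split=> [xe j|h].
  by apply: le_trans xe; exact: (le_bigmax _ (fun i : 'I_1 * 'I_N => `|x i.1 i.2|) (0, j)).
by rewrite bigmax_le // => -[i j] _ /=; rewrite ord1; exact: h.
Qed.

Lemma coord_le_norm N (x : 'rV[R]_N) j : `|x 0 j| <= `|x|.
Proof. exact: ((rv_norm_le x (normr_ge0 x)).1 (lexx _)). Qed.

Lemma cont_coord N (j : 'I_N) : continuous (fun x : 'rV[R]_N => x 0 j).
Proof. exact: coord_continuous. Qed.

Lemma cont_rv (T : topologicalType) N (c : T -> 'rV[R]_N) :
  (forall j, continuous (fun t => c t 0 j)) -> continuous c.
Proof.
move=> h t; apply/cvgrPdist_lt => e e0.
have : \forall s \near t, forall j, `|c t 0 j - c s 0 j| < e.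
  apply: filter_forall => j; have := h j t => /cvgrPdist_lt; exact.
apply: filterS => s sP; apply/(rv_norm_lt _ e0) => j; rewrite !mxE; exact: sP.
Qed.

Lemma cont_zero_right (f : R -> R) : continuous f -> (forall l, 0 < l -> f l = 0) -> f 0 = 0.
Proof.
move=> /contP cf f0; apply/eqP/negPn/negP => n0.
have e0 : 0 < `|f 0| by rewrite normr_gt0.
have [d d0 dP] := cf 0 _ e0.
have dd : `|d / 2 - 0| < d.
  by rewrite subr0 gtr0_norm ?divr_gt0 // ltr_pdivrMr // ltr_pMr // ltr1n.
by have := dP _ dd; rewrite f0 ?divr_gt0 // sub0r normrN ltxx.
Qed.

Lemma contD (T : topologicalType) (f g : T -> R) :
  continuous f -> continuous g -> continuous (fun x => f x + g x).
Proof. by move=> cf cg x; apply: cvgD; [exact: cf|exact: cg]. Qed.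
Lemma contB (T : topologicalType) (f g : T -> R) :
  continuous f -> continuous g -> continuous (fun x => f x - g x).
Proof. by move=> cf cg x; apply: cvgB; [exact: cf|exact: cg]. Qed.
Lemma contN (T : topologicalType) (f : T -> R) :
  continuous f -> continuous (fun x => - f x).
Proof. by move=> cf x; apply: cvgN; exact: cf. Qed.
Lemma contM (T : topologicalType) (f g : T -> R) :
  continuous f -> continuous g -> continuous (fun x => f x * g x).
Proof. by move=> cf cg x; apply: cvgM; [exact: cf|exact: cg]. Qed.
Lemma contC (T : topologicalType) (c : R) : continuous (fun _ : T => c).
Proof. by move=> x; exact: cvg_cst. Qed.
Lemma contX (T : topologicalType) (f : T -> R) n :
  continuous f -> continuous (fun x => f x ^+ n).
Proof.
move=> cf; elim: n => [|n IH]; first by under eq_fun do rewrite expr0; exact: contC.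
by under eq_fun do rewrite exprS; exact: contM.
Qed.
Lemma cont_norm (T : topologicalType) (f : T -> R) :
  continuous f -> continuous (fun x => `|f x|).
Proof. by move=> cf x; apply: cvg_norm; exact: cf. Qed.
Lemma cont_sum (T : topologicalType) (I : Type) (r : seq I) (P : pred I) (F : I -> T -> R) :
  (forall i, continuous (F i)) -> continuous (fun x => \sum_(i <- r | P i) F i x).
Proof.
move=> cF; elim: r => [|i r IH].
  by under eq_fun do rewrite big_nil; exact: contC.
by under eq_fun do rewrite big_cons; case: (P i) => //; exact: contD.
Qed.
Lemma cont_comp (T U W : topologicalType) (f : U -> W) (g : T -> U) :
  continuous f -> continuous g -> continuous (fun x => f (g x)).
Proof. by move=> cf cg x; apply: continuous_comp; [exact: cg|exact: cf]. Qed.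

End Continuity.

(** * Flows of homogeneous vector fields *)

Section Homogeneous.
Variables (R : realType) (N : nat) (sigma : 'I_N -> nat).
Hypothesis sigma_gt0 : forall i, (0 < sigma i)%N.
Local Notation V := 'rV[R]_N.
Implicit Types (q r : V -> R) (x y : V) (j k : 'I_N) (l : R).

Lemma dilE l x j : dil sigma l x 0 j = l ^+ sigma j * x 0 j.
Proof. by rewrite mxE. Qed.

Lemma dil0 x : dil sigma 0 x = 0.
Proof. by apply/rowP => j; rewrite !mxE expr0n gtn_eqF ?sigma_gt0 // mul0r. Qed.

Lemma dil1 x : dil sigma 1 x = x.
Proof. by apply/rowP => j; rewrite !mxE expr1n mul1r. Qed.

Lemma dilM l l' x : dil sigma l (dil sigma l' x) = dil sigma (l * l') x.
Proof. by apply/rowP => j; rewrite !mxE exprMn mulrA. Qed.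

Lemma cont_dilx l : continuous (dil sigma l : V -> V).
Proof.
apply: cont_rv => j; under eq_fun do rewrite dilE.
by apply: contM; [exact: contC|exact: cont_coord].
Qed.

Lemma cont_dill x : continuous (fun l => dil sigma l x).
Proof.
apply: cont_rv => j; under eq_fun do rewrite dilE.
by apply: contM; [apply: contX => z; exact: cvg_id|exact: contC].
Qed.

Definition homf d q := smooth_fun q /\ forall l x, 0 < l -> q (dil sigma l x) = l ^+ d * q x.

Lemma homf_partial_eq d q k l x : homf d q -> 0 < l ->
  l ^+ sigma k * partial k q (dil sigma l x) = l ^+ d * partial k q x.
Proof.
move=> [sq hq] l0.
have dq := smooth_diff sq.
have e1 : is_derive (0 : R) 1 (fun s => q (dil sigma l x + s *: (l ^+ sigma k *: evec R k)))
    (l ^+ sigma k * partial k q (dil sigma l x)).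
  apply: is_derive_eq (is_derive_line (dq _)) _.
  rewrite (bigD1 k) //= scale0r addr0 big1 ?addr0 => [|j jk].
    by rewrite !mxE !eqxx mulr1.
  by rewrite !mxE eqxx /= (negbTE jk) mulr0 mul0r.
have e2 : is_derive (0 : R) 1 (fun s => l ^+ d * q (x + s *: evec R k))
    (l ^+ d * partial k q x).
  apply: derZ; apply: is_derive_eq (is_derive_line (dq _)) _.
  rewrite (bigD1 k) //= scale0r addr0 big1 ?addr0 => [|j jk].
    by rewrite !mxE !eqxx mul1r.
  by rewrite !mxE eqxx /= (negbTE jk) mul0r.
have [_ <-] := e1; have [_ <-] := e2; congr (derive _ _ _).
apply/funext => s; rewrite -hq //; congr (q _); apply/rowP => j; rewrite !mxE eqxx /=.
by have [->|jk] := eqVneq j k; rewrite /= ?mulr1n ?mulr0n; ring.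
Qed.

Lemma homf_partial d q k : homf d q -> (sigma k <= d)%N ->
  homf (d - sigma k) (partial k q).
Proof.
move=> hq kd; split=> [|l x l0]; first by apply: smooth_partial; case: hq.
apply: (mulfI (lt0r_neq0 (exprn_gt0 (sigma k) l0))).
by rewrite (homf_partial_eq _ _ hq l0) mulrA -exprD subnKC.
Qed.

Lemma homf_partial0 d q k : homf d q -> (d < sigma k)%N -> partial k q = fun=> 0.
Proof.
move=> hq dk; apply/funext => x.
pose f l := l ^+ (sigma k - d) * partial k q (dil sigma l x) - partial k q x.
suff : f 0 = 0.
  by rewrite /f expr0n subn_eq0 leqNgt dk mul0r sub0r => /eqP; rewrite oppr_eq0 => /eqP.
apply: cont_zero_right => [|l l0].
  rewrite /f; apply: contB; last exact: contC.
  apply: contM; first by apply: contX => z; exact: cvg_id.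
  apply: (@cont_comp _ _ _ (partial k q)); last exact: cont_dill.
  by apply: smooth_continuous; apply: smooth_partial; case: hq.
apply: (mulfI (lt0r_neq0 (exprn_gt0 d l0))).
rewrite mulr0 mulrBr mulrA -exprD subnKC; last exact: ltnW.
by rewrite (homf_partial_eq _ _ hq l0) subrr.
Qed.

Lemma homf_coord j : homf (sigma j) (fun x => x 0 j).
Proof. by split=> [|l x _]; [exact: smooth_coord|rewrite dilE]. Qed.

Lemma homfD d q r : homf d q -> homf d r -> homf d (q \+ r).
Proof.
move=> [sq hq] [sr hr]; split=> [|l x l0]; first exact: smoothD.
by rewrite /= hq // hr // mulrDr.
Qed.

Lemma homfM d e q r : homf d q -> homf e r -> homf (d + e) (q \* r).
Proof.
move=> [sq hq] [sr hr]; split=> [|l x l0]; first exact: smoothM.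
by rewrite /= hq // hr // exprD; ring.
Qed.

Lemma homf0 d : homf d (fun=> 0).
Proof. by split=> [|l x _]; [exact: smooth_cst|rewrite mulr0]. Qed.

Lemma homfZ d (c : R) q : homf d q -> homf d (fun x => c * q x).
Proof.
move=> [sq hq]; split=> [|l x l0]; last by rewrite hq // mulrCA.
by apply: (@smoothM _ _ (fun=> c)) => //; exact: smooth_cst.
Qed.

Lemma homf_sum d (I : Type) (s : seq I) (P : pred I) (F : I -> V -> R) :
  (forall i, homf d (F i)) -> homf d (fun x => \sum_(i <- s | P i) F i x).
Proof.
move=> hF; elim: s => [|i s IH].
  by under eq_fun do rewrite big_nil; exact: homf0.
by under eq_fun do rewrite big_cons; case: (P i) => //; exact: homfD.
Qed.

Lemma homf_indep d q x y : homf d q -> (forall k, (sigma k <= d)%N -> x 0 k = y 0 k) -> q x = q y.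
Proof.
move=> hq xy; apply: diff0_indep => [z|k z]; first by apply: smooth_diff; case: hq.
move=> n; rewrite (homf_partial0 hq) // ltnNge; apply: contra n => kd.
by rewrite xy.
Qed.

Variable X : V -> V.
Hypothesis sX : smooth_vf X.

Lemma vf_act_coord j x : vf_act X (fun y => y 0 j) x = X x 0 j.
Proof.
rewrite /vf_act; under eq_bigr do rewrite partial_coord.
rewrite (bigD1 j) //= eqxx mulr1 big1 ?addr0 // => k kj.
by rewrite (negbTE kj) mulr0.
Qed.

Lemma homf_vf_coef (h : hom_deg_one sigma X) j : homf (sigma j).-1 (fun x => X x 0 j).
Proof.
split=> [|l x l0]; first exact: sX.
have := h _ l (smooth_coord j) l0 x.
rewrite vf_act_coord.
have -> : (fun x0 : V => x0 0 j) \o dil sigma l = (fun x0 => l ^+ sigma j * x0 0 j).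
  by apply/funext => z /=; rewrite dilE.
have -> : vf_act X (fun x0 => l ^+ sigma j * x0 0 j) x = l ^+ sigma j * X x 0 j.
  rewrite -vf_act_coord /vf_act mulr_sumr; apply: eq_bigr => k _.
  rewrite mulrCA; congr (_ * _).
  have := @partialM _ _ (fun=> l ^+ sigma j) (fun z => z 0 j) k.
  move=> /(_ (fun z => differentiable_cst _ _)).
  move=> /(_ (smooth_diff (@smooth_coord _ _ j))) => /(congr1 (fun f => f x)) /=.
  by rewrite partial_cst mul0r add0r.
move=> E; apply: (mulfI (lt0r_neq0 l0)); rewrite -E mulrA -exprS prednK //.
Qed.

Lemma homf_X (h : hom_deg_one sigma X) d q : homf d.+1 q -> homf d (vf_act X q).
Proof.
move=> hq; apply: homf_sum => j; have [jd|jd] := leqP (sigma j) d.+1; last first.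
  by rewrite (homf_partial0 hq) //; under eq_fun do rewrite mulr0; exact: homf0.
have -> : d = ((sigma j).-1 + (d.+1 - sigma j))%N by have := sigma_gt0 j; lia.
by apply: homfM; [exact: homf_vf_coef|exact: homf_partial].
Qed.

Lemma homf_X0 q : homf 0 q -> vf_act X q = fun=> 0.
Proof.
move=> hq; apply/funext => x; rewrite /vf_act big1 // => j _.
by rewrite (homf_partial0 hq) // mulr0.
Qed.

Lemma homf_iterX (h : hom_deg_one sigma X) d q (k : nat) :
  homf d q -> (k <= d)%N -> homf (d - k) (iter k (vf_act X) q).
Proof.
move=> hq; elim: k => [|k IH] kd; first by rewrite subn0.
have := IH (ltnW kd).
have -> : (d - k)%N = (d - k.+1).+1 by lia.
exact: homf_X.
Qed.

Lemma vf_act0 : vf_act X (fun=> 0) = fun=> 0.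
Proof. by apply/funext => x; rewrite /vf_act big1 // => j _; rewrite partial_cst mulr0. Qed.

Lemma homf_iterX0 (h : hom_deg_one sigma X) d q (k : nat) :
  homf d q -> (d < k)%N -> iter k (vf_act X) q = fun=> 0.
Proof.
move=> hq; elim: k => // k IH; rewrite ltnS leq_eqVlt => /orP[/eqP <-|/IH /= ->].
  by rewrite iterS; apply: homf_X0; have := homf_iterX h hq (leqnn d); rewrite subnn.
exact: vf_act0.
Qed.

End Homogeneous.

Section Flow.
Variables (R : realType) (N : nat) (sigma : 'I_N -> nat).
Hypothesis sigma_gt0 : forall i, (0 < sigma i)%N.
Local Notation V := 'rV[R]_N.
Variable X : V -> V.
Hypothesis sX : smooth_vf X.
Hypothesis hX : hom_deg_one sigma X.
Implicit Types (q r : V -> R) (x y : V) (j k : 'I_N) (l s t : R).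

(* The Taylor polynomial of order [n] of [s |-> q (exp (s X) x)]; it is exact for homogeneous [q] of degree at most [n]. *)
Definition liesum n q s x : R :=
  \sum_(k < n.+1) s ^+ k / k`!%:R * iter k (vf_act X) q x.

Definition flow s x : V := \row_j liesum (sigma j) (fun y => y 0 j) s x.

Lemma liesum0 n q x : liesum n q 0 x = q x.
Proof.
rewrite /liesum big_ord_recl expr0 divr1 mul1r big1 ?addr0 // => k _.
by rewrite exprS !mul0r.
Qed.

Lemma liesum_der n q s x :
  is_derive s 1 (fun s => liesum n.+1 q s x) (liesum n (vf_act X q) s x).
Proof.
rewrite /liesum.
pose c (k : nat) := (k`!%:R)^-1 * iter k (vf_act X) q x.
have -> : \sum_(k < n.+1) s ^+ k / k`!%:R * iter k (vf_act X) (vf_act X q) x =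
    \sum_(k < n.+2) c k * (k%:R * s ^+ k.-1).
  rewrite [RHS]big_ord_recl mul0r mulr0 add0r; apply: eq_bigr => k _.
  rewrite lift0 /= /c -iterSr factS natrM invfM.
  have k0 : k.+1%:R != 0 :> R by rewrite pnatr_eq0.
  move: k.+1%:R k0 (k`!%:R^-1) (iter _ _ _ _) => a a0 b e.
  by rewrite -[LHS]mul1r -(mulVf a0); ring.
have -> : (fun s0 => \sum_(k < n.+2) s0 ^+ k / k`!%:R * iter k (vf_act X) q x) =
    (fun s0 => \sum_(k < n.+2) c k * s0 ^+ k).
  by apply/funext => s0; apply: eq_bigr => k _; rewrite -mulrA mulrC.
by apply: der_sum => k _; apply: derZ; exact: derX.
Qed.

Lemma flow0 x : flow 0 x = x.
Proof. by apply/rowP => j; rewrite mxE liesum0. Qed.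

Lemma flow_homf d q s x : homf sigma d q -> q (flow s x) = liesum d q s x.
Proof.
elim/ltn_ind: d q s x => d IH q s x hq.
have dq := smooth_diff hq.1.
move: s; apply: (@is_derive_same _ _ _ (fun s => vf_act X q (flow s x))); last first.
- by rewrite flow0 liesum0.
- case: d IH hq => [|d] IH hq s.
    rewrite (homf_X0 sigma_gt0 X hq); rewrite /liesum.
    by under eq_fun do rewrite big_ord1 expr0 divr1 mul1r; exact: derC.
  by rewrite (IH d) //; [exact: liesum_der|exact: homf_X].
move=> s.
have dc j : is_derive s 1 (fun s => flow s x 0 j) (liesum (sigma j).-1 (fun y => X y 0 j) s x).
  have := liesum_der (sigma j).-1 (fun y : V => y 0 j) s x.
  rewrite prednK //; have -> : vf_act X (fun y : V => y 0 j) = (fun y => X y 0 j).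
    by apply/funext => y; rewrite vf_act_coord.
  by under [fun s => flow s x 0 j]eq_fun do rewrite mxE.
apply: is_derive_eq (is_derive_curve (dq _) dc) _.
apply: eq_bigr => j _; have [jd|jd] := leqP (sigma j) d; last first.
  by rewrite (homf_partial0 hq jd) !mulr0.
congr (_ * _); rewrite -(IH (sigma j).-1) //; last exact: homf_vf_coef.
by have := sigma_gt0 j; lia.
Qed.

Lemma flow_der_coord j s x :
  is_derive s 1 (fun s => flow s x 0 j) (X (flow s x) 0 j).
Proof.
under [fun s => flow s x 0 j]eq_fun do rewrite mxE.
have := liesum_der (sigma j).-1 (fun y : V => y 0 j) s x.
rewrite prednK //; have -> : vf_act X (fun y : V => y 0 j) = (fun y => X y 0 j).
  by apply/funext => y; rewrite vf_act_coord.
by rewrite -(flow_homf s x (homf_vf_coef sigma_gt0 sX hX j)).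
Qed.

Lemma flow_der f s x : differentiable f (flow s x) ->
  is_derive s 1 (fun s => f (flow s x)) (vf_act X f (flow s x)).
Proof.
by move=> df; apply: is_derive_curve => // j; exact: flow_der_coord.
Qed.

Lemma flowD s t x : flow (s + t) x = flow s (flow t x).
Proof.
have H d : forall j, (sigma j <= d)%N -> forall s, flow (s + t) x 0 j = flow s (flow t x) 0 j.
  elim: d => [|d IH] j jd; first by have := sigma_gt0 j; lia.
  apply: (@is_derive_same _ _ _ (fun s => X (flow s (flow t x)) 0 j)).
  - move=> s'; have -> : X (flow s' (flow t x)) 0 j = X (flow (s' + t) x) 0 j * 1.
      rewrite mulr1; apply: (homf_indep (homf_vf_coef sigma_gt0 sX hX j)) => k kj.
      by rewrite IH //; have := sigma_gt0 j; lia.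
    apply: (@is_derive1_comp _ (fun s => flow s x 0 j) (fun s => s + t)).
      exact: flow_der_coord.
    by apply: is_derive_eq (derD (derI _) (derC _ _)) _; rewrite addr0.
  - by move=> s'; exact: flow_der_coord.
  - by rewrite add0r flow0.
by apply/rowP => j; exact: (H (sigma j)).
Qed.

Lemma flow_dil l s x : 0 < l -> flow (l * s) (dil sigma l x) = dil sigma l (flow s x).
Proof.
move=> l0; apply/rowP => j; rewrite dilE !mxE /liesum mulr_sumr; apply: eq_bigr => k _.
have kj : (k <= sigma j)%N by rewrite -ltnS.
have [_ ->] := homf_iterX sigma_gt0 sX hX (homf_coord R sigma j) kj => //.
have -> : l ^+ sigma j = l ^+ k * l ^+ (sigma j - k) by rewrite -exprD subnKC.
by rewrite exprMn; ring.
Qed.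

Lemma cont_flow : continuous (fun sx : R * V => flow sx.1 sx.2).
Proof.
apply: cont_rv => j; under eq_fun do rewrite mxE.
apply: cont_sum => k; apply: contM.
  by apply: contM; [apply: contX => z; exact: cvg_fst|exact: contC].
apply: cont_comp; last by move=> z; exact: cvg_snd.
apply: smooth_continuous.
have kj : (k <= sigma j)%N by rewrite -ltnS.
by case: (homf_iterX sigma_gt0 sX hX (homf_coord R sigma j) kj).
Qed.

Lemma flow_tri s x y j : (forall k, (sigma k < sigma j)%N -> x 0 k = y 0 k) ->
  flow s x 0 j - x 0 j = flow s y 0 j - y 0 j.
Proof.
move=> xy; rewrite !mxE /liesum ![in LHS]big_ord_recl ![in RHS]big_ord_recl /=.
rewrite !expr0 !divr1 !mul1r [x 0 j + _]addrC [y 0 j + _]addrC !addrK; apply: eq_bigr => k _.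
congr (_ * _); have kj : (k.+1 <= sigma j)%N by [].
apply: (homf_indep (homf_iterX sigma_gt0 sX hX (homf_coord R sigma j) kj)) => k' hk'.
by apply: xy; lia.
Qed.

End Flow.

(** * Broken trajectories *)

Section ChainLimit.
Variables (R : realType) (N : nat).
Local Notation V := 'rV[R]_N.

Lemma diff_eps (f : V -> R) x : differentiable f x -> forall e : R, 0 < e ->
  exists2 d : R, 0 < d & forall v, `|v| < d -> `|f (x + v) - f x - 'd f x v| <= e * `|v|.
Proof.
move=> /diff_locallyP [_ /eqaddoP H] e e0.
have /nbhs_ballP [d /= d0 dP] := H _ e0.
exists d => // v vd; have := dP v; rewrite -ball_normE /= sub0r normrN => /(_ vd).
rewrite !fctE /= opprD addrA; rewrite (addrC v x); exact.
Qed.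

(* A chain rule in which [s ^+ c] plays the role of time: it reads off the leading order of a commutator of flows without Schwarz's theorem. *)
Lemma chain_lim (q : V -> R) x (c : nat) (h : R -> V) (rho : R -> R) : (0 < c)%N ->
  differentiable q x -> continuous h -> continuous rho ->
  (forall s, 0 < s -> q (x + s ^+ c *: h s) - q x = s ^+ c * rho s) ->
  rho 0 = \sum_k h 0 0 k * partial k q x.
Proof.
move=> c0 dq ch crho E; rewrite -diff_partial //.
apply/eqP; rewrite -subr_eq0; apply/negPn/negP => n0.
pose phi s := rho s - 'd q x (h s).
have cphi : continuous phi.
  rewrite /phi; apply: contB => //; apply: (@cont_comp _ _ _ ('d q x)) => //.
  exact: diff_continuous.
have e0 : 0 < `|phi 0| by rewrite normr_gt0.
set e := `|phi 0| in e0.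
have M0 : 0 < `|h 0| + 1 by rewrite ltr_wpDl.
set M := `|h 0| + 1 in M0.
have [d d0 dP] := diff_eps dq (divr_gt0 (divr_gt0 e0 (ltr0n _ 4)) M0).
have [d1 d10 d1P] := (contP phi).1 cphi 0 _ (divr_gt0 e0 (ltr0n _ 2)).
have [d2 d20 d2P] := (contP h).1 ch 0 _ ltr01.
pose s := Num.min (Num.min 1 (d1 / 2)) (Num.min (d2 / 2) (d / M / 2)).
have s0 : 0 < s by rewrite !lt_min ltr01 !divr_gt0.
have [s1 sd1 sd2 sd] : [/\ s <= 1, s < d1, s < d2 & s * M < d].
  rewrite /s; split.
  - by rewrite !ge_min lexx.
  - by rewrite !gt_min (_ : d1 / 2 < d1) ?orbT //; lra.
  - by rewrite !gt_min (_ : d2 / 2 < d2) ?orbT //; lra.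
  - rewrite -ltr_pdivlMr // !gt_min (_ : d / M / 2 < d / M) ?orbT //.
    by have := divr_gt0 d0 M0; lra.
have hs : `|h s| < M.
  have := d2P s; rewrite subr0 gtr0_norm // => /(_ sd2) hh.
  rewrite /M addrC; apply: le_lt_trans (_ : `|h s - h 0| + `|h 0| < _).
    by rewrite -{1}(subrK (h 0) (h s)) ler_normD.
  by rewrite ltrD2r.
have sc : 0 < s ^+ c by rewrite exprn_gt0.
have scs : s ^+ c <= s.
  case: (c) c0 => // c' _; rewrite exprS -[leRHS]mulr1 ler_wpM2l ?(ltW s0) //.
  by rewrite exprn_ile1 // ltW.
have vd : `|s ^+ c *: h s| < d.
  rewrite normrZ gtr0_norm //; apply: le_lt_trans sd.
  by apply: ler_pM => //; exact: ltW.
have := dP _ vd; rewrite E // linearZ /= -mulrBr normrM normrZ gtr0_norm //.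
rewrite mulrCA ler_pM2l // -/(phi s) => A.
have := d1P s; rewrite subr0 gtr0_norm // => /(_ sd1) B.
have C : e / 4 / M * `|h s| <= e / 4.
  rewrite -mulrA ler_piMr ?divr_ge0 ?(ltW e0) //.
  by rewrite mulrC ler_pdivrMr // mul1r ltW.
have T : e <= `|phi s - phi 0| + `|phi s|.
  by rewrite distrC /e -{1}(subrK (phi s) (phi 0)) ler_normD.
have := le_lt_trans T (ltr_leD B (le_trans A C)).
by clear -e0; move: (e : R) e0 => a a0; lra.
Qed.

End ChainLimit.

Section Words.
Variables (R : realType) (N m : nat) (sigma : 'I_N -> nat).
Hypothesis sigma_gt0 : forall i, (0 < sigma i)%N.
Local Notation V := 'rV[R]_N.
Variable X : 'I_m -> V -> V.
Hypothesis sX : forall i, smooth_vf (X i).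
Hypothesis hX : forall i, hom_deg_one sigma (X i).
Implicit Types (q r z : V -> R) (x y : V) (l s t : R) (w : seq ('I_m * R)).
Local Notation homf := (homf sigma).

Definition run w x : V := foldr (fun ic y => flow sigma (X ic.1) ic.2 y) x w.
Definition wscale w s : seq ('I_m * R) := [seq (ic.1, ic.2 * s) | ic <- w].
Definition winv w : seq ('I_m * R) := rev [seq (ic.1, - ic.2) | ic <- w].

Lemma run_cat w1 w2 x : run (w1 ++ w2) x = run w1 (run w2 x).
Proof. by rewrite /run foldr_cat. Qed.

Lemma run_invl w x : run (winv w) (run w x) = x.
Proof.
elim: w => //= ic w IH; rewrite /winv /= rev_cons -cats1 run_cat /=.
by rewrite -flowD // addNr flow0.
Qed.

Lemma winvK w : winv (winv w) = w.
Proof.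
rewrite /winv map_rev revK -map_comp -[RHS]map_id; apply: eq_map => -[i c] /=.
by rewrite opprK.
Qed.

Lemma run_invr w x : run w (run (winv w) x) = x.
Proof. by rewrite -{1}(winvK w) run_invl. Qed.

Lemma wscale_inv w s : winv (wscale w s) = wscale (winv w) s.
Proof.
rewrite /winv /wscale map_rev -!map_comp; congr rev; apply: eq_map => -[i c] /=.
by rewrite mulNr.
Qed.

Lemma wscale_cat w1 w2 s : wscale (w1 ++ w2) s = wscale w1 s ++ wscale w2 s.
Proof. exact: map_cat. Qed.

Definition wmap w s := run (wscale w s).

Lemma wmap_cat w1 w2 s x : wmap (w1 ++ w2) s x = wmap w1 s (wmap w2 s x).
Proof. by rewrite /wmap wscale_cat run_cat. Qed.

Lemma wmap_invr w s x : wmap w s (wmap (winv w) s x) = x.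
Proof. by rewrite /wmap -wscale_inv run_invr. Qed.

(* [theta] is a polynomial in [s] with homogeneous coefficients (of total degree [d]), whose lowest term has order at least [c], with coefficient [z] at order [c]. *)
Definition hexp (c d : nat) (theta : R -> V -> R) z :=
  exists Q : nat -> V -> R,
    [/\ forall k, (k <= d)%N -> homf (d - k) (Q k),
        forall k, (k < c)%N || (d < k)%N -> Q k = fun=> 0,
        Q c = z & forall s x, theta s x = \sum_(k < d.+1) s ^+ k * Q k x].

Lemma hexp_eq c d th th' z z' : hexp c d th z -> (forall s x, th s x = th' s x) ->
  z = z' -> hexp c d th' z'.
Proof.
move=> h e <-; have <- // : th = th'.
by apply/funext => s; apply/funext => x.
Qed.

Lemma hexp0 c d : hexp c d (fun _ _ => 0) (fun=> 0).
Proof.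
exists (fun _ _ => 0); split => //; first by move=> k _; exact: homf0.
by move=> s x; rewrite big1 // => k _; rewrite mulr0.
Qed.

Lemma hexpD c d th th' z z' : hexp c d th z -> hexp c d th' z' ->
  hexp c d (fun s x => th s x + th' s x) (fun x => z x + z' x).
Proof.
move=> [Q [hQ Q0 Qc E]] [Q' [hQ' Q0' Qc' E']].
exists (fun k x => Q k x + Q' k x); split=> [k kd|k kc||s x].
- by apply: homfD; [exact: hQ|exact: hQ'].
- by apply/funext => x; rewrite Q0 // Q0' // addr0.
- by rewrite Qc Qc'.
- by rewrite E E' -big_split; apply: eq_bigr => k _; rewrite mulrDr.
Qed.

Lemma hexpN c d th z : hexp c d th z -> hexp c d (fun s x => - th s x) (fun x => - z x).
Proof.
move=> [Q [hQ Q0 Qc E]].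
exists (fun k x => -1 * Q k x); split=> [k kd|k kc||s x].
- by apply: homfZ; exact: hQ.
- by apply/funext => x; rewrite Q0 // mulr0.
- by apply/funext => x; rewrite Qc mulN1r.
- by rewrite E -sumrN; apply: eq_bigr => k _; rewrite mulN1r mulrN.
Qed.

Lemma hexp_sum c d (n : nat) (th : 'I_n -> R -> V -> R) (z : 'I_n -> V -> R) :
  (forall k, hexp c d (th k) (z k)) ->
  hexp c d (fun s x => \sum_(k < n) th k s x) (fun x => \sum_(k < n) z k x).
Proof.
elim: n th z => [|n IH] th z h.
  apply: hexp_eq (hexp0 _ _) _ _ => [s x|]; first by rewrite big_ord0.
  by apply/funext => x; rewrite big_ord0.
have := hexpD (h ord0) (IH _ _ (fun k => h (lift ord0 k))).
move=> h'; apply: hexp_eq h' _ _ => [s x|]; first by rewrite big_ord_recl.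
by apply/funext => x; rewrite big_ord_recl.
Qed.

Lemma hexp_weak c c' d th z : (c' < c)%N -> hexp c d th z -> hexp c' d th (fun=> 0).
Proof.
move=> cc [Q [hQ Q0 Qc E]]; exists Q; split => //; last by apply: Q0; rewrite cc.
by move=> k /orP[kc|kd]; apply: Q0; rewrite ?(ltn_trans kc cc) ?kd ?orbT.
Qed.

Lemma hexp_shift c d n th z : hexp c d th z ->
  hexp (n + c) (n + d) (fun s x => s ^+ n * th s x) z.
Proof.
move=> [Q [hQ Q0 Qc E]].
exists (fun k => if (k < n)%N then (fun=> 0) else Q (k - n)%N); split=> [k kd|k kc||s x].
- case: ltnP => kn; first exact: homf0.
  have -> : (n + d - k = d - (k - n))%N by lia.
  by apply: hQ; lia.
- by case: ltnP => // kn; apply: Q0; lia.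
- by rewrite ltnNge leq_addr /= addKn.
- rewrite E mulr_sumr.
  rewrite -addnS [RHS]big_split_ord /= [X in _ = X + _]big1 ?add0r => [|k _]; last by rewrite ltn_ord mulr0.
  by apply: eq_bigr => k _; rewrite ltnNge leq_addr /= addKn exprD mulrA.
Qed.

Definition lead w c (T : (V -> R) -> V -> R) :=
  forall d q, homf d q -> hexp c d (fun s x => q (wmap w s x) - q x) (T q).

Lemma hexp_incr c1 c2 d th z w T : (0 < c2)%N -> hexp c1 d th z -> lead w c2 T ->
  T (fun=> 0) = (fun=> 0) ->
  hexp (c1 + c2) d (fun s x => th s (wmap w s x) - th s x) (T z).
Proof.
move=> c20 [Q [hQ Q0 Qc E]] lw T0.
have H : forall k : 'I_d.+1, hexp (c1 + c2) d
    (fun s x => s ^+ k * (Q k (wmap w s x) - Q k x))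
    (if k == c1 :> nat then T z else fun=> 0).
  move=> k; have [kc|kc] := ltnP k c1.
    rewrite ltn_eqF // Q0 ?kc //; apply: hexp_eq (hexp0 _ _) _ _ => // s x.
    by rewrite subrr mulr0.
  have kd : (k <= d)%N by rewrite -ltnS.
  have := hexp_shift k (lw _ _ (hQ k kd)); rewrite subnKC // => Hk.
  have [kc'|kc'] := eqVneq (k : nat) c1; first by rewrite -Qc -kc'.
  by apply: hexp_weak Hk; rewrite ltn_add2r ltn_neqAle eq_sym kc'.
apply: hexp_eq (hexp_sum H) _ _ => [s x|].
  by rewrite !E -sumrB; apply: eq_bigr => k _; rewrite mulrBr.
apply/funext => x; have [cd|cd] := ltnP c1 d.+1.
  rewrite (bigD1 (Ordinal cd)) //= eqxx big1 ?addr0 // => k.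
  by rewrite -val_eqE /= => /negbTE ->.
rewrite -{2}Qc (Q0 c1) ?cd ?orbT // T0 big1 // => k _.
by rewrite ltn_eqF // (leq_trans (ltn_ord k)).
Qed.

Lemma hexp_comp c d th z w c2 T : (0 < c2)%N -> lead w c2 T -> T (fun=> 0) = (fun=> 0) ->
  hexp c d th z -> hexp c d (fun s x => th s (wmap w s x)) z.
Proof.
move=> c20 lw T0 h.
have h' := hexp_weak (_ : (c < c + c2)%N) (hexp_incr c20 h lw T0).
apply: hexp_eq (hexpD h (h' _)) _ _ => [|s x|]; first by rewrite -addn1 leq_add2l.
  by rewrite addrC subrK.
by apply/funext => x; rewrite addr0.
Qed.

Lemma lead_eq w c T T' : lead w c T -> (forall d q, homf d q -> T q = T' q) -> lead w c T'.
Proof. by move=> l e d q hq; rewrite -(e _ _ hq); exact: l. Qed.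

Lemma lead_letter i (c : R) : lead [:: (i, c)] 1 (fun q x => c * vf_act (X i) q x).
Proof.
move=> d q hq.
exists (fun k x => if k is 0%N then 0 else c ^+ k / k`!%:R * iter k (vf_act (X i)) q x).
split=> [[|k] kd|[|k] //= kd||s x].
- exact: homf0.
- by apply: homfZ; exact: homf_iterX.
- by apply/funext => x; rewrite -iterS (homf_iterX0 sigma_gt0 _ _ hq) ?mulr0.
- by apply/funext => x; rewrite expr1 divr1.
rewrite /wmap /= (flow_homf sigma_gt0 (sX i) (hX i) _ _ hq) /liesum !big_ord_recl /=.
rewrite !expr0 divr1 !mul1r add0r addrC addKr; apply: eq_bigr => k _.
by rewrite exprMn; ring.
Qed.

Lemma lead_word w : exists2 T, lead w 1 T & T (fun=> 0) = fun=> 0.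
Proof.
elim: w => [|[i c] w [T lT T0]].
  exists (fun _ _ => 0) => // d q hq; apply: hexp_eq (hexp0 _ _) _ _ => // s x.
  by rewrite /wmap /= subrr.
exists (fun q x => c * vf_act (X i) q x + T q x) => [d q hq|].
  have hi := hexp_comp (ltn0Sn 0) lT T0 (lead_letter i c hq).
  apply: hexp_eq (hexpD hi (lT _ _ hq)) _ _ => // s x.
  by rewrite -(cat1s _ w) wmap_cat addrA subrK.
by apply/funext => x; rewrite T0 vf_act0 mulr0 addr0.
Qed.

Lemma lead_comm w1 w2 c1 c2 (Y Z : V -> V) : (0 < c1)%N -> (0 < c2)%N ->
  lead w1 c1 (vf_act Y) -> lead w2 c2 (vf_act Z) ->
  lead (w1 ++ w2 ++ winv w1 ++ winv w2) (c1 + c2)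
    (fun q x => vf_act Z (vf_act Y q) x - vf_act Y (vf_act Z q) x).
Proof.
move=> c10 c20 l1 l2 d q hq.
have H1 := hexp_incr c20 (l1 _ _ hq) l2 (vf_act0 _).
have H2 := hexp_incr c10 (l2 _ _ hq) l1 (vf_act0 _).
rewrite (addnC c2) in H2.
have [T lT T0] := lead_word (winv w1 ++ winv w2).
have := hexp_comp (ltn0Sn 0) lT T0 (hexpD H1 (hexpN H2)).
move=> h; apply: hexp_eq h _ _ => // s x.
rewrite !wmap_cat; set y := wmap (winv w1) s _.
have -> : wmap w2 s (wmap w1 s y) = x by rewrite /y !wmap_invr.
ring.
Qed.

Lemma lead_vf w c T (B : V -> V) : (0 < c)%N -> lead w c T ->
  (forall k, T (fun x => x 0 k) = fun x => B x 0 k) -> lead w c (vf_act B).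
Proof.
move=> c0 lw TB; apply: (lead_eq lw) => d q hq; apply/funext => x.
have split_lead e p : homf e p -> exists rp : R -> R, [/\ continuous rp, rp 0 = T p x &
    forall s, p (wmap w s x) - p x = s ^+ c * rp s].
  move=> hp; have [Q [hQ Q0 Qc E]] := lw _ _ hp.
  exists (fun s => \sum_(k < e.+1 | (c <= k)%N) s ^+ (k - c) * Q k x); split.
  - apply: cont_sum => k; apply: contM; last exact: contC.
    by apply: contX => s; exact: cvg_id.
  - rewrite -Qc; have [ce|ce] := ltnP c e.+1; last first.
      rewrite (Q0 c) ?ce ?orbT // big1 // => k ck.
      by have := ltn_ord k; rewrite ltnNge (leq_trans ce ck).
    rewrite (bigD1 (Ordinal ce)) //= subnn expr0 mul1r big1 ?addr0 // => k /andP[ck kc].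
    have kc' : (0 < k - c)%N by rewrite subn_gt0 ltn_neqAle eq_sym -val_eqE /= in kc ck *; rewrite kc.
    by rewrite expr0n gtn_eqF // mul0r.
  - move=> s; rewrite E mulr_sumr (bigID (fun k : 'I_e.+1 => (c <= k)%N)) /=.
    rewrite addrC big1 ?add0r => [|k]; last first.
      by rewrite -ltnNge => kc; rewrite Q0 ?kc // mulr0.
    by apply: eq_bigr => k ck; rewrite mulrA -exprD subnKC.
have [rho [crho rho0 rhoE]] := split_lead _ _ hq.
have /choice [h hP] : forall k : 'I_N, exists rp : R -> R, [/\ continuous rp, rp 0 = B x 0 k &
    forall s, wmap w s x 0 k - x 0 k = s ^+ c * rp s].
  move=> k; have [rp [crp rp0 rpE]] := split_lead _ _ (homf_coord R sigma k).
  by exists rp; rewrite rp0 TB.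
have := @chain_lim R N q x c (fun s => \row_k h k s) rho c0 (smooth_diff hq.1 _).
rewrite rho0 /vf_act => ->.
- by apply: eq_bigr => k _; rewrite mxE; have [_ ->] := hP k.
- apply: cont_rv => k; under eq_fun do rewrite mxE.
  by have [] := hP k.
- by [].
- move=> s s0; rewrite -rhoE; congr (q _ - _); apply/rowP => k.
  by rewrite !mxE; have [_ _ <-] := hP k; rewrite addrC subrK.
Qed.

Lemma lie_gen_lead Z : lie_gen X Z -> exists w c, (0 < c)%N /\ lead w c (vf_act Z).
Proof.
elim=> [i|Y Z' _ [w1 [c1 [c10 l1]]] _ [w2 [c2 [c20 l2]]]].
  exists [:: (i, 1)], 1%N; split=> //; apply: lead_eq (lead_letter i 1) _ => d q _.
  by apply/funext => x; rewrite mul1r.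
exists (w2 ++ w1 ++ winv w2 ++ winv w1), (c2 + c1)%N; split; first by rewrite addn_gt0 c20.
apply: lead_vf (lead_comm c20 c10 l2 l1) _; first by rewrite addn_gt0 c20.
move=> k; apply/funext => x; rewrite mxE.
have e (W : V -> V) : vf_act W (fun y => y 0 k) = fun y => W y 0 k.
  by apply/funext => y; rewrite vf_act_coord.
by rewrite !e.
Qed.

End Words.

Section ContPair.
Variables (T U W : topologicalType).
Lemma cont_pair (f : T -> U) (g : T -> W) :
  continuous f -> continuous g -> continuous (fun z => (f z, g z)).
Proof. by move=> cf cg z; apply: cvg_pair; [exact: cf|exact: cg]. Qed.
Lemma cont_fst : continuous (fun z : T * U => z.1).
Proof. by move=> z; exact: cvg_fst. Qed.
Lemma cont_snd : continuous (fun z : T * U => z.2).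
Proof. by move=> z; exact: cvg_snd. Qed.
Lemma cont_id : continuous (fun z : T => z).
Proof. by move=> z; exact: cvg_id. Qed.
End ContPair.

Section Root.
Variable R : realType.
Implicit Types a b u v : R.

Definition rt d a : R := (Num.max a 0) `^ d%:R^-1.

Lemma rt_ge0 d a : 0 <= rt d a.
Proof. exact: powR_ge0. Qed.

Lemma rtX d a : (0 < d)%N -> rt d a ^+ d = Num.max a 0.
Proof.
move=> d0; rewrite /rt -powR_mulrn ?powR_ge0 // -powRrM mulVf ?powRr1 //.
  by rewrite le_max lexx orbT.
by rewrite pnatr_eq0 -lt0n.
Qed.

Lemma expr_sub_le d u v : (0 < d)%N -> 0 <= v -> v <= u -> (u - v) ^+ d <= u ^+ d - v ^+ d.
Proof.
move=> d0 v0 vu; have u0 := le_trans v0 vu.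
case: d d0 => // d _; elim: d => [|d IH]; first by rewrite !expr1.
rewrite exprS; apply: le_trans (ler_wpM2l _ IH) _; first by rewrite subr_ge0.
have uv : v ^+ d.+1 <= u ^+ d.+1 by rewrite lerXn2r ?nnegrE.
rewrite [u ^+ d.+2]exprS [v ^+ d.+2]exprS.
have : 0 <= v ^+ d.+1 by rewrite exprn_ge0.
move: (u ^+ d.+1) (v ^+ d.+1) uv => U W UW W0; nra.
Qed.

Lemma max0_sub a b : `|Num.max a 0 - Num.max b 0| <= `|a - b|.
Proof.
have := ler_norm (a - b); have := ler_norm (b - a); rewrite (distrC b a) ler_norml.
move: `|a - b| => c h1 h2; case: (leP a 0) => ha; case: (leP b 0) => hb; apply/andP; split; lra.
Qed.

Lemma cont_rt d : (0 < d)%N -> continuous (rt d).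
Proof.
move=> d0; apply/contP => a e e0; exists (e ^+ d); first by rewrite exprn_gt0.
move=> b ab; rewrite ltNge; apply/negP => h.
have : e ^+ d <= `|rt d b - rt d a| ^+ d by rewrite lerXn2r ?nnegrE // ltW.
suff : `|rt d b - rt d a| ^+ d <= `|b - a|.
  by move=> h1 h2; have := lt_le_trans ab (le_trans h2 h1); rewrite ltxx.
have mx := max0_sub b a.
apply: le_trans mx; rewrite -!(rtX _ d0).
have [rab|/ltW rab] := leP (rt d a) (rt d b).
  by rewrite ger0_norm ?subr_ge0 // ger0_norm ?subr_ge0 ?lerXn2r ?nnegrE ?rt_ge0 // expr_sub_le ?rt_ge0.
rewrite distrC [leRHS]distrC.
by rewrite ger0_norm ?subr_ge0 // ger0_norm ?subr_ge0 ?lerXn2r ?nnegrE ?rt_ge0 // expr_sub_le ?rt_ge0.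
Qed.

Lemma rt_le d a b r : (0 < d)%N -> 0 <= r -> `|b| <= r ^+ d -> rt d (a * b) <= (1 + `|a|) * r.
Proof.
move=> d0 r0 br; rewrite leNgt; apply/negP => h.
have a1 : 1 <= 1 + `|a| by rewrite lerDl.
have c0 : 0 <= (1 + `|a|) * r by rewrite mulr_ge0 // (le_trans _ a1).
have : ((1 + `|a|) * r) ^+ d < rt d (a * b) ^+ d by rewrite ltrXn2r ?nnegrE ?rt_ge0 // -lt0n.
rewrite rtX // ltNge => /negP; apply.
apply: (@le_trans _ _ `|a * b|); first by rewrite ge_max ler_norm normr_ge0.
rewrite normrM exprMn ler_pM //; apply: (@le_trans _ _ (1 + `|a|)); first by rewrite lerDr.
by rewrite -{1}[1 + _]expr1 ler_weXn2l.
Qed.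

End Root.

Section Chow.
Variables (R : realType) (N m : nat) (sigma : 'I_N -> nat).
Hypothesis sigma_gt0 : forall i, (0 < sigma i)%N.
Local Notation V := 'rV[R]_N.
Variable X : 'I_m -> V -> V.
Hypothesis sX : forall i, smooth_vf (X i).
Hypothesis hX : forall i, hom_deg_one sigma (X i).
Implicit Types (x y t : V) (s r : R) (w : seq ('I_m * R)).
Local Notation run := (run sigma X).
Local Notation wmap := (wmap sigma X).

Lemma run_tri w x y j : (forall k, (sigma k < sigma j)%N -> x 0 k = y 0 k) ->
  run w x 0 j - x 0 j = run w y 0 j - y 0 j.
Proof.
elim: w j => [|[i c] w IH] j xy; first by rewrite /= !subrr.
rewrite /= -[LHS](subrKA (run w x 0 j)) -[RHS](subrKA (run w y 0 j)) IH //; congr (_ + _).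
apply: flow_tri => // k kj; rewrite -[LHS](subrK (x 0 k)) -[RHS](subrK (y 0 k)) xy //.
by congr (_ + _); rewrite -(xy k kj) IH ?xy // => k' k'k; apply: xy; exact: ltn_trans kj.
Qed.

Section Lead.
Variables (w : seq ('I_m * R)) (c : nat) (Z : V -> V).
Hypothesis lw : lead sigma X w c (vf_act Z).

Lemma lead_low s x j : (sigma j < c)%N -> wmap w s x 0 j = x 0 j.
Proof.
move=> jc; have [Q [hQ Q0 Qc E]] := lw (homf_coord R sigma j).
apply/eqP; rewrite -subr_eq0 E big1 // => k _.
by rewrite Q0 ?mulr0 // (leq_trans _ jc).
Qed.

Lemma lead_layer s x j : sigma j = c -> wmap w s x 0 j = x 0 j + s ^+ c * Z 0 0 j.
Proof.
move=> jc; have [Q [hQ Q0 Qc E]] := lw (homf_coord R sigma j).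
have zE : Z 0 0 j = Z x 0 j.
  rewrite -!vf_act_coord -Qc; have := hQ c; rewrite jc leqnn subnn => /(_ isT) h.
  by apply: (homf_indep h) => k; have := sigma_gt0 k; lia.
apply/eqP; rewrite addrC -subr_eq E big_ord_recr /= big1 ?add0r => [|k _].
  by rewrite jc Qc vf_act_coord zE.
by rewrite Q0 ?mulr0 // -jc ltn_ord.
Qed.

Lemma lead_zero j : sigma j != c -> Z 0 0 j = 0.
Proof.
move=> jc; have [Q [hQ Q0 Qc E]] := lw (homf_coord R sigma j).
rewrite -vf_act_coord -Qc; have [jc'|cj|] := ltngtP (sigma j) c.
- by rewrite Q0 // jc' orbT.
- have [_ h] := hQ c (ltnW cj).
  have := h 2 0 (ltr0Sn _ 1); rewrite (_ : dil sigma 2 0 = 0); last first.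
    by apply/rowP => k; rewrite !mxE mulr0.
  have : 2 ^+ (sigma j - c) > 1 :> R by rewrite exprn_egt1 // ?ltr1n // -lt0n subn_gt0.
  move: (2 ^+ _) (Q c 0) => a b a1 E'; apply/eqP; rewrite -[b == 0]orFb.
  have <- : (a - 1 == 0) = false by apply/negbTE; rewrite subr_eq0 gt_eqF.
  by rewrite -mulf_eq0 mulrBl mul1r -E' subrr.
- by move=> e; rewrite e eqxx in jc.
Qed.

Lemma lead_low_inv s x j : (sigma j < c)%N -> wmap (winv w) s x 0 j = x 0 j.
Proof. by move=> jc; rewrite -{2}(wmap_invr sigma_gt0 sX hX w s x) lead_low. Qed.

Lemma lead_layer_inv s x j : sigma j = c ->
  wmap (winv w) s x 0 j = x 0 j - s ^+ c * Z 0 0 j.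
Proof.
by move=> jc; rewrite -{2}(wmap_invr sigma_gt0 sX hX w s x) lead_layer // addrK.
Qed.

(* One of the two roots vanishes: this is [w] with parameter the [c]-th root of [a] when [a >= 0], and its inverse otherwise. *)
Definition wshift (a : R) := wscale w (rt c a) ++ wscale (winv w) (rt c (- a)).

Hypothesis c0 : (0 < c)%N.

Lemma wshift_low a x j : (sigma j < c)%N -> run (wshift a) x 0 j = x 0 j.
Proof.
move=> jc; rewrite /wshift run_cat -/(wmap w (rt c a) _) lead_low //.
by rewrite -/(wmap (winv w) (rt c (- a)) _) lead_low_inv.
Qed.

Lemma wshift_layer a x j : sigma j = c -> run (wshift a) x 0 j = x 0 j + a * Z 0 0 j.
Proof.
move=> jc; rewrite /wshift run_cat -/(wmap w (rt c a) _) lead_layer //.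
rewrite -/(wmap (winv w) (rt c (- a)) _) lead_layer_inv // !rtX //.
rewrite -addrA -mulNr -mulrDl; congr (_ + _ * _).
have [a0|/ltW a0] := leP a 0; first by rewrite max_l ?oppr_ge0 // opprK addr0.
by rewrite max_r ?oppr_le0 // oppr0 add0r.
Qed.

End Lead.

Definition cont_path (p : V -> seq ('I_m * R)) :=
  continuous (fun tx : V * V => run (p tx.1) tx.2).

Definition lin_path (p : V -> seq ('I_m * R)) := exists n (C : R), 0 <= C /\
  forall t r, 0 <= r -> (forall j, `|t 0 j| <= r ^+ sigma j) ->
    (size (p t) <= n)%N /\ all (fun ic => `|ic.2| <= C * r) (p t).

Lemma cont_path_cat p q : cont_path p -> cont_path q -> cont_path (fun t => p t ++ q t).
Proof.
move=> cp cq; rewrite /cont_path; under eq_fun do rewrite run_cat.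
apply: (@cont_comp _ _ _ (fun tx => run (p tx.1) tx.2)
  (fun tx : V * V => (tx.1, run (q tx.1) tx.2))) => //.
by apply: cont_pair => //; exact: cont_fst.
Qed.

Lemma cont_path_scale w (g : V -> R) : continuous g -> cont_path (fun t => wscale w (g t)).
Proof.
move=> cg; elim: w => [|[i c] w IH]; first by move=> z; exact: cvg_snd.
rewrite /cont_path /=.
apply: (@cont_comp _ _ _ (fun sx : R * V => flow sigma (X i) sx.1 sx.2)
  (fun tx : V * V => (c * g tx.1, run (wscale w (g tx.1)) tx.2))).
  exact: cont_flow.
apply: cont_pair => //; apply: (@contM _ _ (fun=> c) (fun tx : V * V => g tx.1)); first exact: contC.
by apply: cont_comp => //; exact: cont_fst.
Qed.

Lemma cont_path_flatten (I : Type) (s : seq I) (p : I -> V -> seq ('I_m * R)) :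
  (forall i, cont_path (p i)) -> cont_path (fun t => flatten [seq p i t | i <- s]).
Proof.
move=> h; elim: s => [|i s IH] /=; first by move=> z; exact: cvg_snd.
exact: cont_path_cat.
Qed.

Lemma lin_path_cat p q : lin_path p -> lin_path q -> lin_path (fun t => p t ++ q t).
Proof.
move=> [n [C [C0 h]]] [n' [C' [C0' h']]]; exists (n + n')%N, (C + C'); split; first exact: addr_ge0.
move=> t r r0 tr; have [h1 h2] := h t r r0 tr; have [h1' h2'] := h' t r r0 tr.
rewrite size_cat leq_add // all_cat; split=> //; apply/andP; split.
  apply: sub_all h2 => ic hc; apply: le_trans hc _; rewrite mulrDl lerDl mulr_ge0 //.
apply: sub_all h2' => ic hc; apply: le_trans hc _; rewrite mulrDl lerDr mulr_ge0 //.
Qed.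

Lemma lin_path_flatten (I : Type) (s : seq I) (p : I -> V -> seq ('I_m * R)) :
  (forall i, lin_path (p i)) -> lin_path (fun t => flatten [seq p i t | i <- s]).
Proof.
move=> h; elim: s => [|i s IH] /=; last exact: lin_path_cat.
by exists 0%N, 0; split.
Qed.

Lemma lin_path_scale w (g : V -> R) (C : R) : 0 <= C ->
  (forall t r, 0 <= r -> (forall j, `|t 0 j| <= r ^+ sigma j) -> `|g t| <= C * r) ->
  lin_path (fun t => wscale w (g t)).
Proof.
move=> C0 gC; exists (size w), ((\sum_(ic <- w) `|ic.2|) * C); split.
  by rewrite mulr_ge0 // sumr_ge0.
move=> t r r0 tr; rewrite size_map; split=> //; apply/allP => _ /mapP [ic icw ->] /=.
rewrite normrM -mulrA ler_pM //; last exact: gC.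
rewrite (big_rem ic) //= lerDl sumr_ge0 //.
Qed.

(* A quantitative form of Chow's theorem: commutators of the flows move along each layer of brackets at the origin, and homogeneity makes the resulting map [t |-> run (P t) x] triangular for the weights, hence onto. *)
Lemma chow_param : hormander X -> exists P : V -> seq ('I_m * R),
  [/\ continuous (fun tx : V * V => run (P tx.1) tx.2),
      forall t t' x j, (forall k, (sigma k < sigma j)%N -> t 0 k = t' 0 k) ->
        run (P t) x 0 j - t 0 j = run (P t') x 0 j - t' 0 j
    & lin_path P].
Proof.
move=> /(_ 0) [k [Z [lZ /row_fullP [Y YZ]]]].
have /choice [wc wcP] : forall i, exists wc : seq ('I_m * R) * nat,
    (0 < wc.2)%N /\ lead sigma X wc.1 wc.2 (vf_act (Z i)).
  by move=> i; have [w [c h]] := lie_gen_lead sigma_gt0 sX hX (lZ i); exists (w, c).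
pose c i := (wc i).2; pose w i := (wc i).1.
have c0 i : (0 < c i)%N by have [] := wcP i.
have lw i : lead sigma X (w i) (c i) (vf_act (Z i)) by have [] := wcP i.
pose S j (t : R) := flatten [seq wshift (w i) (c i) (Y j i * t) | i <- enum 'I_k & c i == sigma j].
have S_low j (t : R) x l : (sigma l < sigma j)%N -> run (S j t) x 0 l = x 0 l.
  move=> lj; rewrite /S; elim: (enum _) => //= i s IH; case: eqP => //= ic.
  by rewrite run_cat (wshift_low (lw i)) // ic.
have S_layer j (t : R) x l : sigma l = sigma j -> run (S j t) x 0 l = x 0 l + t * (l == j)%:R.
  move=> lj.
  have -> : run (S j t) x 0 l = x 0 l + \sum_(i <- enum 'I_k | c i == sigma j) Y j i * t * Z i 0 0 l.
    rewrite /S; elim: (enum _) => [|i s IH]; first by rewrite big_nil addr0.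
    rewrite big_cons /=; case: eqP => //= ic.
    rewrite run_cat (wshift_layer (lw i)) ?ic // IH -addrA; congr (_ + _); exact: addrC.
  congr (_ + _).
  have <- : \sum_i Y j i * Z i 0 0 l = (l == j)%:R.
    have := congr1 (fun M : 'M[R]_N => M j l) YZ; rewrite !mxE eq_sym => <-.
    by apply: eq_bigr => i _; rewrite mxE.
  rewrite big_enum_cond /= mulr_sumr [RHS](bigID (fun i => c i == sigma j)) /=.
  rewrite [X in _ = _ + X]big1 ?addr0 => [|i ic]; first by apply: eq_bigr => i _; ring.
  by rewrite (lead_zero (lw i)) ?mulr0 // lj eq_sym.
pose P (t : V) := flatten [seq S j (t 0 j) | j <- enum 'I_N].
have S_cont j : cont_path (fun t => S j (t 0 j)).
  apply: cont_path_flatten => i; apply: cont_path_cat; apply: cont_path_scale.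
    apply: (@cont_comp _ _ _ (rt (c i))); first exact: cont_rt.
    by apply: contM; [exact: contC|exact: cont_coord].
  apply: (@cont_comp _ _ _ (rt (c i))); first exact: cont_rt.
  by apply: contN; apply: contM; [exact: contC|exact: cont_coord].
have S_lin j : lin_path (fun t => S j (t 0 j)).
  rewrite /S; elim: (enum 'I_k) => [|i s IH] /=; first by exists 0%N, 0; split.
  case: eqP => //= ic; apply: lin_path_cat => //; apply: lin_path_cat.
    apply: (@lin_path_scale _ _ (1 + `|Y j i|)) => [|t r r0 tr]; first by rewrite addr_ge0.
    by rewrite ger0_norm ?rt_ge0 // rt_le // ic.
  apply: (@lin_path_scale _ _ (1 + `|- Y j i|)) => [|t r r0 tr]; first by rewrite addr_ge0.
  by rewrite ger0_norm ?rt_ge0 // -mulNr rt_le // ic.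
have cP : cont_path P := @cont_path_flatten _ (enum 'I_N) (fun j t => S j (t 0 j)) S_cont.
have lP : lin_path P := @lin_path_flatten _ (enum 'I_N) (fun j t => S j (t 0 j)) S_lin.
exists P; split => //.
move=> t t' x j tt'.
suff H (s : seq 'I_N) l : (forall k, (sigma k < sigma l)%N -> t 0 k = t' 0 k) ->
    run (flatten [seq S j (t 0 j) | j <- s]) x 0 l - run (flatten [seq S j (t' 0 j) | j <- s]) x 0 l
      = (count_mem l s)%:R * (t 0 l - t' 0 l).
  have := H (enum 'I_N) j tt'; rewrite (count_uniq_mem _ (enum_uniq _)) mem_enum mul1r.
  rewrite -/(P t) -/(P t') => E; apply/eqP; rewrite subr_eq -addrA (addrC (- _)) -E addrC subrK //.
elim: s l => [|i s IH] l tl; first by rewrite /= subrr mul0r.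
rewrite /= !run_cat; set y := run (flatten _) x; set y' := run (flatten _) x.
have yl : forall k, (sigma k < sigma l)%N -> y 0 k = y' 0 k.
  move=> k' kl; apply/eqP; rewrite -subr_eq0 IH ?tl ?subrr ?mulr0 // => k'' h.
  by apply: tl; exact: ltn_trans kl.
have [il|li|il] := ltngtP (sigma i) (sigma l).
- rewrite (tl i il); have := run_tri (S i (t' 0 i)) yl => E.
  have -> : run (S i (t' 0 i)) y 0 l - run (S i (t' 0 i)) y' 0 l = y 0 l - y' 0 l.
    by move: E; move: (run _ y 0 l) (run _ y' 0 l) => a b E; lra.
  rewrite IH // (_ : (i == l) = false) //.
  by apply/negbTE/eqP => e; rewrite e ltnn in il.
- rewrite !S_low // IH // (_ : (i == l) = false) //.
  by apply/negbTE/eqP => e; rewrite e ltnn in li.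
- rewrite !S_layer // natrD mulrDl -IH // -/y -/y' [l == i]eq_sym.
  by case: eqVneq => [->|_] /=; ring.
Qed.

End Chow.

Lemma FTC_der (R : realType) (h : R -> R) (a x : R) : continuous h -> a < x ->
  is_derive x 1 (fun x => (\int[@lebesgue_measure R]_(t in [set` `[a, x]]) h t)%R) (h x).
Proof.
move=> ch ax.
have x1 : x < x + 1 by rewrite ltrDl.
have i1 : (@lebesgue_measure R).-integrable `[a, x + 1] (EFin \o h).
  apply: continuous_compact_integrable; first exact: segment_compact.
  exact: continuous_subspaceT.
have [dF dF'] := @continuous_FTC1_closed R h a x (x + 1) x1 i1 ax (ch x).
apply: DeriveDef; first exact: dF.
rewrite -derive1E; exact: dF'.
Qed.

(** * Integration of compactly supported functions *)

Section RealCalculus.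
Variable R : realType.
Implicit Types (f h H : R -> R) (a b c e s x y L M : R).

Lemma der_epsP f s a : is_derive s 1 f a <-> forall e : R, 0 < e ->
  exists2 d : R, 0 < d & forall h : R, `|h| < d -> `|f (s + h) - f s - h * a| <= e * `|h|.
Proof.
have E1 (h : R) : h *: (1 : R) = h by rewrite /GRing.scale /= mulr1.
split=> [[df da] e e0|H].
  have /cvgrPdist_le /(_ e e0) /nbhs_ballP [d /= d0 dP] := df.
  rewrite -/(derive f s 1) da in dP.
  exists d => // h hd; have [->|h0] := eqVneq h 0.
    by rewrite addr0 subrr mul0r subrr normr0 mulr0.
  have := dP h; rewrite -ball_normE /= sub0r normrN => /(_ hd h0).
  rewrite E1 /GRing.scale /= => hh.
  have -> : f (s + h) - f s - h * a = - (h * (a - h^-1 * (f (h + s) - f s))).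
    by rewrite mulrBr mulrA divff // mul1r (addrC h s); ring.
  by rewrite normrN normrM mulrC ler_wpM2r.
have cv : ((h^-1 *: (f (h *: (1 : R) + s) - f s)) @[h --> 0^'] --> a)%classic.
  apply/cvgrPdist_le => e e0; have [d d0 dP] := H e e0.
  apply/nbhs_ballP; exists d => //= h; rewrite -ball_normE /= sub0r normrN => hd h0.
  rewrite E1 /GRing.scale /= -(ler_pM2r (_ : 0 < `|h|)) ?normr_gt0 // -normrM.
  have -> : (a - h^-1 * (f (h + s) - f s)) * h = - (f (s + h) - f s - h * a).
    by rewrite mulrBl mulrAC mulVf // mul1r (addrC h s); ring.
  by rewrite normrN; exact: dP.
split; first by apply/cvg_ex; exists a.
by apply: cvg_lim cv.
Qed.

Lemma der_cont f s a : is_derive s 1 f a -> {for s, continuous f}.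
Proof. by case=> df _; apply: differentiable_continuous; apply/derivable1_diffP. Qed.

Lemma mvt f (df : R -> R) a b : (forall x, is_derive x 1 f (df x)) ->
  exists2 c, (Num.min a b <= c <= Num.max a b) & f b - f a = df c * (b - a).
Proof.
move=> dfP.
have cf : continuous f by move=> x; exact: der_cont (dfP x).
have H (u v : R) : u <= v -> exists2 c, u <= c <= v & f v - f u = df c * (v - u).
  move=> uv; have [c cuv E] := MVT_segment uv (fun x _ => dfP x) (continuous_subspaceT cf).
  by exists c => //; move: cuv; rewrite in_itv.
have [ab|/ltW ab] := leP a b; first exact: H.
have [c cb E] := H _ _ ab; exists c => //.
by rewrite -opprB E -mulrN opprB.
Qed.

Lemma mvt_le f (df : R -> R) a b M : (forall x, is_derive x 1 f (df x)) ->
  (forall x, Num.min a b <= x <= Num.max a b -> `|df x| <= M) -> `|f b - f a| <= M * `|b - a|.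
Proof. by move=> dfP dM; have [c /dM cM ->] := mvt a b dfP; rewrite normrM ler_wpM2r. Qed.

Definition prim H h := forall x, is_derive x 1 H (h x).
Definition supp1 L h := forall x, L < `|x| -> h x = 0.

Lemma prim_ndecr H h : prim H h -> (forall x, 0 <= h x) -> {homo H : x y / x <= y}.
Proof.
move=> pH h0 x y xy; have [c _ E] := mvt x y pH.
by rewrite -subr_ge0 E mulr_ge0 // subr_ge0.
Qed.

Lemma prim_const H h a b : prim H h ->
  (forall x, Num.min a b < x < Num.max a b -> h x = 0) -> continuous h -> H a = H b.
Proof.
move=> pH h0 ch; have cH : continuous H by move=> x; exact: der_cont (pH x).
wlog ab : a b h0 / a < b.
  move=> W; have [ab|ba|->//] := ltgtP a b; first exact: W.
  by symmetry; apply: W => // x; rewrite minC maxC; exact: h0.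
have [c] := MVT ab (fun x _ => pH x) (continuous_subspaceT cH).
rewrite in_itv /= => cab E; move: E.
by rewrite h0 ?mul0r ?min_l ?max_r ?ltW // => /eqP; rewrite subr_eq0 => /eqP.
Qed.

Lemma prim_exists h L : continuous h -> supp1 L h -> exists H, prim H h.
Proof.
move=> ch sh.
pose K : R := `|L|; pose a : R := - K - 2.
pose F x := (\int[@lebesgue_measure R]_(t in [set` `[a, x]]) h t)%R.
have dF x : a < x -> is_derive x 1 F (h x) by exact: FTC_der.
have LK : L <= K by exact: ler_norm.
have K0 : 0 <= K by exact: normr_ge0.
have F0 x : x < - K -> F x = 0.
  move=> xK; rewrite /F.
  rewrite (@eq_Rintegral _ _ _ _ _ (cst 0)) ?Rintegral_cst ?mul0r // => t.
  rewrite inE /= in_itv /= => /andP[_ tx].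
  apply: sh; apply: le_lt_trans LK _; rewrite ltr0_norm; lra.
pose H x := if x < - K - 1 then 0 else F x.
exists H => x; have [xK|xK] := ltP x (- K - 2^-1).
  have hx : h x = 0 by apply: sh; apply: le_lt_trans LK _; rewrite ltr0_norm; lra.
  rewrite hx; apply: (@near_eq_is_derive _ R R (fun=> 0) H x 1 0).
  apply/nbhs_ballP; exists (- K - 2^-1 - x) => /=; first by rewrite subr_gt0.
  move=> y; rewrite -ball_normE /= ltr_norml => /andP[y1 y2].
  by rewrite /H; case: ifP => // _; rewrite F0 //; lra.
apply: (@near_eq_is_derive _ R R F H x 1 (h x)); last by apply: dF; rewrite /a; lra.
apply/nbhs_ballP; exists (2^-1 : R) => /=; first by rewrite invr_gt0.
move=> y; rewrite -ball_normE /= ltr_norml => /andP[y1 y2].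
by rewrite /H; case: ifP => // yK; lra.
Qed.

Definition is_int1 h c := exists H L, [/\ prim H h, 0 <= L, supp1 L h & c = H L - H (- L)].
Definition int1 h : R := xget 0 [set c | is_int1 h c]%classic.

Lemma is_int1_uniq h c c' : continuous h -> is_int1 h c -> is_int1 h c' -> c = c'.
Proof.
move=> ch [H [L [pH L0 sL ->]]] [H' [L' [pH' L0' sL' ->]]].
have E x : H x - H' x = H 0 - H' 0.
  apply: (is_derive_0_is_cst (f := fun x => H x - H' x)) => y.
  by apply: is_derive_eq (derB (pH y) (pH' y)) _; rewrite subrr.
wlog LL : H H' L L' pH pH' L0 L0' sL sL' E / L <= L'.
  move=> W; have [LL|/ltW LL] := leP L L'; first exact: (W H H' L L').
  by symmetry; apply: (W H' H L' L) => // x; rewrite -opprB E opprB.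
have -> : H L = H L'.
  apply: (prim_const pH) => // x; rewrite min_l ?max_r // => /andP[x1 x2].
  by apply: sL; rewrite gtr0_norm // (le_lt_trans L0).
have -> : H (- L) = H (- L').
  apply: (prim_const pH) => // x; rewrite min_r ?max_l ?lerN2 // => /andP[x1 x2].
  by apply: sL; rewrite ltr0_norm; lra.
have := E L'; have := E (- L'); lra.
Qed.

Lemma int1E h H L : continuous h -> prim H h -> 0 <= L -> supp1 L h -> int1 h = H L - H (- L).
Proof.
move=> ch pH L0 sL; have h1 : is_int1 h (H L - H (- L)) by exists H, L.
by rewrite /int1; case: xgetP => [c _ hc|/(_ _ h1) []]; exact: is_int1_uniq ch hc h1.
Qed.

Definition cc1 L h := [/\ continuous h, 0 <= L & supp1 L h].

Lemma int1_prim h L : cc1 L h -> exists2 H, prim H h & int1 h = H L - H (- L).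
Proof.
move=> [ch L0 sL]; have [H pH] := prim_exists ch sL; exists H => //; exact: int1E.
Qed.

Lemma int1D h h' L : cc1 L h -> cc1 L h' -> int1 (fun x => h x + h' x) = int1 h + int1 h'.
Proof.
move=> c1 c2; have [H pH ->] := int1_prim c1; have [H' pH' ->] := int1_prim c2.
have [ch L0 sh] := c1; have [ch' _ sh'] := c2.
rewrite (int1E (H := fun x => H x + H' x) (L := L)) //; first by lra.
- exact: contD.
- by move=> x; exact: derD.
- by move=> x Lx; rewrite sh // sh' // addr0.
Qed.

Lemma int1Z h L c : cc1 L h -> int1 (fun x => c * h x) = c * int1 h.
Proof.
move=> c1; have [H pH ->] := int1_prim c1; have [ch L0 sh] := c1.
rewrite (int1E (H := fun x => c * H x) (L := L)) //; first by rewrite mulrBr.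
- by apply: contM => //; exact: contC.
- by move=> x; exact: derZ.
- by move=> x Lx; rewrite sh // mulr0.
Qed.

Lemma int1_ge0 h L : cc1 L h -> (forall x, 0 <= h x) -> 0 <= int1 h.
Proof.
move=> c1 h0; have [H pH ->] := int1_prim c1; have [ch L0 sh] := c1.
by rewrite subr_ge0; apply: (prim_ndecr pH) => //; lra.
Qed.

Lemma int1_bound h L M : cc1 L h -> (forall x, `|h x| <= M) -> `|int1 h| <= M * (2 * L).
Proof.
move=> c1 h0; have [H pH ->] := int1_prim c1; have [ch L0 sh] := c1.
apply: le_trans (mvt_le pH (fun x _ => h0 x)) _.
by rewrite (_ : `|L - - L| = 2 * L) // opprK ger0_norm ?addr_ge0 //; ring.
Qed.

Lemma int1_gt0 h L x : cc1 L h -> (forall x, 0 <= h x) -> 0 < h x -> 0 < int1 h.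
Proof.
move=> c1 h0 hx; have [H pH ->] := int1_prim c1; have [ch L0 sh] := c1.
have xL : `|x| <= L by rewrite leNgt; apply/negP => /sh e; rewrite e ltxx in hx.
have nd := prim_ndecr pH h0.
rewrite lt_neqAle subr_ge0 nd ?andbT; last by lra.
apply/eqP => E.
have Hc y : - L <= y <= L -> H y = H L.
  move=> /andP[y1 y2]; apply/eqP; rewrite eq_le nd //=.
  have -> : H L = H (- L) by lra.
  exact: nd.
have [d d0 dP] := (der_epsP _ _ _).1 (pH x) _ (divr_gt0 hx (ltr0n _ 2)).
move: xL; rewrite ler_norml => /andP[x1 x2].
have Hx := Hc x; rewrite x1 x2 in Hx; have {}Hx := Hx isT.
have L' : 0 < L.
  rewrite lt_neqAle L0 andbT; apply/eqP => L00.
  have := contP h; move=> [/(_ ch x _ hx) [r r0 rP] _].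
  have := rP (x + r / 2); rewrite addrAC subrr add0r gtr0_norm ?divr_gt0 // => H1.
  have : h (x + r / 2) = 0.
    by apply: sh; rewrite -L00 normr_gt0; have : 0 < r / 2 := divr_gt0 r0 (ltr0n _ 2); lra.
  move=> e; have := H1 ltac:(lra); rewrite e sub0r normrN gtr0_norm // ltxx //.
have key s : `|s| < d -> - L <= x + s <= L -> s = 0.
  move=> sd sL; have := dP s sd; rewrite Hc // Hx subrr sub0r normrN normrM (gtr0_norm hx) mulrC.
  have [->//|s0] := eqVneq s 0.
  by rewrite ler_pM2r ?normr_gt0 // => hh; lra.
have [x0|x0] := leP x 0.
  have s0 : 0 < Num.min (d / 2) L by rewrite lt_min L' divr_gt0.
  have := key (Num.min (d / 2) L); rewrite gtr0_norm // => K.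
  have : Num.min (d / 2) L < d by rewrite gt_min (_ : d / 2 < d) //; lra.
  have : Num.min (d / 2) L <= L by rewrite ge_min lexx orbT.
  move: (Num.min _ _) s0 K => r r0 K r1 r2; have := K r2 ltac:(apply/andP; split; lra); lra.
have s0 : 0 < Num.min (d / 2) L by rewrite lt_min L' divr_gt0.
have := key (- Num.min (d / 2) L); rewrite normrN gtr0_norm // => K.
have : Num.min (d / 2) L < d by rewrite gt_min (_ : d / 2 < d) //; lra.
have : Num.min (d / 2) L <= L by rewrite ge_min lexx orbT.
move: (Num.min _ _) s0 K => r r0 K r1 r2; have := K r2 ltac:(apply/andP; split; lra); lra.
Qed.

Lemma int1_shift h L c : cc1 L h -> int1 (fun x => h (x + c)) = int1 h.
Proof.
move=> c1; have [H pH _] := int1_prim c1; have [ch L0 sh] := c1.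
have L1 : 0 <= L + `|c| by rewrite addr_ge0.
rewrite (int1E (H := fun x => H (x + c)) (L := L + `|c|)) //.
- rewrite (int1E (H := H) (L := L)) //.
  have cl := ler_norm c; have cl' := ler_norm (- c); rewrite normrN in cl'.
  have -> : H (L + `|c| + c) = H L.
    symmetry; apply: (prim_const pH) => // x; rewrite min_l ?max_r; try lra.
    by move=> /andP[x1 x2]; apply: sh; rewrite gtr0_norm // (le_lt_trans L0).
  have -> : H (- (L + `|c|) + c) = H (- L) => //.
  apply: (prim_const pH) => // x; rewrite min_l ?max_r; try lra.
  by move=> /andP[x1 x2]; apply: sh; rewrite ltr0_norm; lra.
- by apply: cont_comp => //; apply: contD; [exact: cont_id|exact: contC].
- move=> x; rewrite -[h (x + c)]mulr1; apply: (is_derive1_comp (g := fun x => x + c)) => //.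
  by apply: is_derive_eq (derD (derI _) (derC _ _)) _; rewrite addr0.
- move=> x; move: (ler_normD (x + c) (- c)); rewrite addrK normrN => h1 h2.
  by apply: sh; lra.
Qed.

Lemma int1_scale h L l : 0 < l -> cc1 L h -> int1 (fun x => h (l * x)) = l^-1 * int1 h.
Proof.
move=> l0 c1; have [H pH _] := int1_prim c1; have [ch L0 sh] := c1.
rewrite (int1E ch pH L0 sh) [LHS](int1E (H := fun x => l^-1 * H (l * x)) (L := L / l)).
- by rewrite -mulrBr mulrN (mulrC l) divfK ?gt_eqF.
- by apply: cont_comp => //; apply: contM; [exact: contC|exact: cont_id].
- move=> x; have -> : h (l * x) = l^-1 * (h (l * x) * l) by rewrite mulrCA mulVf ?mulr1 ?gt_eqF.
  apply: derZ; apply: (is_derive1_comp (g := fun x => l * x)) => //.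
  by apply: is_derive_eq (derZ l (derI _)) _; rewrite mulr1.
- by rewrite divr_ge0 // ltW.
- move=> x; rewrite ltr_pdivrMr // => Lx; apply: sh.
  by rewrite normrM gtr0_norm // mulrC.
Qed.

End RealCalculus.

Section HeineCantor.
Variable R : realType.

Lemma heine_cantor_on (W : normedModType R) (K : set W) (f : W -> R) :
  compact K -> continuous f -> forall e : R, 0 < e ->
  exists2 d : R, 0 < d & forall z z', K z -> `|z - z'| < d -> `|f z - f z'| < e.
Proof.
move=> cK cf e e0.
have := (compact_near_coveringP K).1 cK R (0^'+)%classic
  (fun d z => forall z', `|z - z'| < d -> `|f z - f z'| < e).
case=> [z Kz|d /= d0 dP].
  have [r r0 rP] := (contP f).1 cf z (e / 2) (divr_gt0 e0 (ltr0n _ 2)).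
  have r2 : 0 < r / 2 by rewrite divr_gt0.
  exists (ball z (r / 2), [set d | d < r / 2]%classic).
    split; first exact: nbhsx_ballx.
    exists (r / 2) => //= d; rewrite /ball_ /= sub0r normrN => h1 h2.
    by apply: le_lt_trans h1; exact: ler_norm.
  move=> [y d] /= []; rewrite -ball_normE /= => zy dr z' yz'.
  rewrite -(subrKA (f z)) (splitr e); apply: le_lt_trans (ler_normD _ _) _.
  apply: ltrD; last rewrite distrC; apply: rP.
    by rewrite distrC; apply: lt_trans zy _; lra.
  rewrite distrC -(subrKA y); apply: le_lt_trans (ler_normD _ _) _.
  by rewrite (splitr r); apply: ltrD => //; exact: lt_trans yz' _.
have dd : `|d / 2| < d by rewrite gtr0_norm; lra.
have d2 : 0 < d / 2 by lra.
exists (d / 2) => // z z' Kz zz'; have H := dP (d / 2).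
by rewrite /ball_ /= sub0r normrN in H; exact: (H dd d2).
Qed.

Lemma heine_cantor (W : normedModType R) (K : set W) (f : W -> R) :
  compact K -> continuous f -> (forall z, ~ K z -> f z = 0) ->
  forall e : R, 0 < e -> exists2 d : R, 0 < d & forall z z', `|z - z'| < d -> `|f z - f z'| < e.
Proof.
move=> cK cf f0 e e0; have [d d0 H] := heine_cantor_on cK cf e0.
exists d => // z z' zz'; have [Kz|nKz] := pselect (K z); first exact: H.
have [Kz'|nKz'] := pselect (K z'); first by rewrite distrC; apply: H => //; rewrite distrC.
by rewrite f0 // f0 // subrr normr0.
Qed.

Lemma compact_bound (W : normedModType R) (K : set W) (f : W -> R) :
  compact K -> continuous f -> exists2 M : R, 0 <= M & forall z, K z -> `|f z| <= M.
Proof.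
move=> cK cf.
have := compact_bounded (continuous_compact (continuous_subspaceT cf) cK).
move=> [M [_ hM]]; exists (`|M| + 1); first by rewrite addr_ge0.
move=> z Kz; apply: (hM (`|M| + 1)); last by exists z.
by rewrite ltr_pwDr // ler_norm.
Qed.

Lemma compact_box N (L : R) : compact [set x : 'rV[R]_N | `|x| <= L]%classic.
Proof.
apply: bounded_closed_compact.
  by exists L; split; [exact: num_real|move=> M LM x /= xL; exact: le_trans xL (ltW LM)].
rewrite (_ : [set x | _]%classic = (fun x => `|x|) @^-1` [set r | r <= L])%classic //.
by apply: closed_comp; [move=> x _; exact: norm_continuous|exact: closed_le].
Qed.

Lemma cont_max0 (T : topologicalType) (f : T -> R) :
  continuous f -> continuous (fun x => Num.max (f x) 0).
Proof.
move=> cf; apply: (@cont_comp _ _ _ (fun y : R => Num.max y 0)) => //.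
by apply/contP => x e e0; exists e => // y; apply: le_lt_trans (max0_sub _ _).
Qed.

End HeineCantor.

Section Integral.
Variables (R : realType) (N : nat).
Local Notation V := 'rV[R]_N.
Implicit Types (f g : V -> R) (x y : V) (j k : 'I_N) (L e : R) (S : pred 'I_N) (s : seq 'I_N).

Definition upd x j (t : R) : V := \row_k (if k == j then t else x 0 k).

Lemma updE x j t k : upd x j t 0 k = if k == j then t else x 0 k.
Proof. by rewrite mxE. Qed.

Lemma upd_dist x y j t : `|upd x j t - upd y j t| <= `|x - y|.
Proof.
apply/rv_norm_le => // k; rewrite !mxE; case: eqP => _; first by rewrite subrr normr0.
by have := coord_le_norm (x - y) k; rewrite !mxE.
Qed.

Lemma upd_dist_t x j t t' : `|upd x j t - upd x j t'| <= `|t - t'|.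
Proof.
by apply/rv_norm_le => // k; rewrite !mxE; case: eqP => // _; rewrite subrr normr0.
Qed.

Definition J j f x : R := int1 (fun t => f (upd x j t)).
Definition Jl s f := foldr J f s.
Definition I f : R := Jl (enum 'I_N) f 0.

Lemma IE f : I f = Jl (enum 'I_N) f 0.
Proof. by []. Qed.

(* [S] is the set of coordinates still to be integrated; only these need bounded support. *)
Definition jcls (P : normedModType R) S L (h : P -> V -> R) :=
  [/\ 0 <= L, forall e, 0 < e -> exists2 d : R, 0 < d & forall p p' x x',
        `|p - p'| < d -> `|x - x'| < d -> `|h p x - h p' x'| < e
    & forall p k x, S k -> L < `|x 0 k| -> h p x = 0].
Definition cls S L f := jcls S L (fun _ : R => f).
Definition Cc f := exists L, cls predT L f.

Lemma jcls_fix (P : normedModType R) S L (h : P -> V -> R) p : jcls S L h -> cls S L (h p).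
Proof.
move=> [L0 u s]; split=> // [e e0|_ k x]; last exact: s.
have [d d0 dP] := u e e0; exists d => // _ _ x x' _ xx'.
by apply: dP => //; rewrite subrr normr0.
Qed.

Lemma cls_le S L L' f : L <= L' -> cls S L f -> cls S L' f.
Proof.
move=> LL [L0 u s]; split=> // [|p k x Sk Lx]; first exact: le_trans LL.
by apply: (s p k) => //; exact: le_lt_trans Lx.
Qed.

Lemma jcls_cc1 (P : normedModType R) S L (h : P -> V -> R) p x j : jcls S L h -> S j ->
  cc1 L (fun t => h p (upd x j t)).
Proof.
move=> [L0 u s] Sj; split=> // [|t Lt]; last by apply: (s p j); rewrite ?updE ?eqxx.
apply/contP => t e e0; have [d d0 dP] := u e e0; exists d => // t' tt'.
apply: dP; first by rewrite subrr normr0.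
by apply: le_lt_trans (upd_dist_t _ _ _ _) _.
Qed.

Lemma cls_cc1 S L f x j : cls S L f -> S j -> cc1 L (fun t => f (upd x j t)).
Proof. by move=> cf Sj; exact: (jcls_cc1 0 x cf Sj). Qed.

Lemma int1_dist (h h' : R -> R) L e : cc1 L h -> cc1 L h' ->
  (forall t, `|h t - h' t| <= e) -> `|int1 h - int1 h'| <= e * (2 * L).
Proof.
move=> c1 c2 hh; have [ch L0 sh] := c1; have [ch' _ sh'] := c2.
have c3 : cc1 L (fun t => -1 * h' t).
  by split=> // [|t /sh' ->]; [apply: contM => //; exact: contC|rewrite mulr0].
rewrite -mulN1r -(int1Z _ c2) -(int1D c1 c3); apply: int1_bound.
  split=> // [|t Lt]; last by rewrite sh // sh' // mulr0 addr0.
  by apply: contD => //; apply: contM => //; exact: contC.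
by move=> t; rewrite mulN1r.
Qed.

Lemma int1_0 : int1 (fun _ : R => 0 : R) = 0.
Proof.
rewrite (int1E (H := fun=> 0) (L := 0)) ?subrr // => [|x]; first exact: contC.
exact: derC.
Qed.

Lemma jcls_J (P : normedModType R) S L (h : P -> V -> R) j : jcls S L h -> S j ->
  jcls [pred k | S k && (k != j)] L (fun p => J j (h p)).
Proof.
move=> c Sj; have [L0 u s] := c; split=> // [e e0|p k x /= /andP[Sk kj] Lx].
  have L1 : 0 < 2 * L + 1 by lra.
  have [d d0 dP] := u (e / (2 * L + 1)) (divr_gt0 e0 L1).
  exists d => // p p' x x' pp' xx'.
  have hh t : `|h p (upd x j t) - h p' (upd x' j t)| <= e / (2 * L + 1).
    by apply: ltW; apply: dP => //; exact: le_lt_trans (upd_dist _ _ _ _) xx'.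
  apply: le_lt_trans (int1_dist (jcls_cc1 p x c Sj) (jcls_cc1 p' x' c Sj) hh) _.
  rewrite mulrAC ltr_pdivrMr // ltr_pM2l //; lra.
rewrite /J (_ : (fun t => _) = fun=> 0) ?int1_0 //; apply/funext => t.
by apply: (s p k) => //; rewrite updE (negbTE kj).
Qed.

Lemma jcls_Jl (P : normedModType R) S L (h : P -> V -> R) s : jcls S L h -> uniq s -> all S s ->
  jcls [pred k | S k && (k \notin s)] L (fun p => Jl s (h p)).
Proof.
move=> c; elim: s => [|j s IH] /= => [_ _|/andP[js us] /andP[Sj Ss]].
  have [L0 u s] := c; split=> // p k x /=; rewrite andbT; exact: s.
have c' := IH us Ss.
have Sj' : [pred k | S k && (k \notin s)] j by rewrite /= Sj.
have [L0 u s'] := jcls_J c' Sj'; split=> // p k x /=.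
rewrite in_cons negb_or => /and3P[Sk kj ks] Lx; apply: (s' p k) => //=.
by rewrite Sk ks kj.
Qed.

Lemma cls_Jl S L f s : cls S L f -> uniq s -> all S s ->
  cls [pred k | S k && (k \notin s)] L (Jl s f).
Proof. by move=> c us Ss; exact: (jcls_Jl c us Ss). Qed.

Lemma Jl_cc1 S L f j s x : cls S L f -> uniq (j :: s) -> all S (j :: s) ->
  cc1 L (fun t => Jl s f (upd x j t)).
Proof.
move=> c /= /andP[js us] /andP[Sj Ss].
by apply: (cls_cc1 _ (cls_Jl c us Ss)); rewrite /= Sj.
Qed.

Lemma JlD S L f g s x : cls S L f -> cls S L g -> uniq s -> all S s ->
  Jl s (fun x => f x + g x) x = Jl s f x + Jl s g x.
Proof.
move=> cf cg; elim: s x => [|j s IH] x //= => us Ss.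
have [/andP[js us'] /andP[Sj Ss']] := conj us Ss.
rewrite {1}/J; under eq_fun do rewrite IH //.
by rewrite (int1D (Jl_cc1 _ cf us Ss) (Jl_cc1 _ cg us Ss)).
Qed.

Lemma JlZ S L f s (c : R) x : cls S L f -> uniq s -> all S s ->
  Jl s (fun x => c * f x) x = c * Jl s f x.
Proof.
move=> cf; elim: s x => [|j s IH] x //= => us Ss.
have [/andP[js us'] /andP[Sj Ss']] := conj us Ss.
by rewrite {1}/J; under eq_fun do rewrite IH //; rewrite (int1Z _ (Jl_cc1 _ cf us Ss)).
Qed.

Lemma Jl_ge0 S L f s x : cls S L f -> uniq s -> all S s -> (forall x, 0 <= f x) -> 0 <= Jl s f x.
Proof.
move=> cf us Ss f0; elim: s us Ss x => [|j s IH] //= us Ss x.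
have [/andP[js us'] /andP[Sj Ss']] := conj us Ss.
by apply: (int1_ge0 (Jl_cc1 _ cf us Ss)) => t; exact: IH.
Qed.

Lemma upd_id x j : upd x j (x 0 j) = x.
Proof. by apply/rowP => k; rewrite updE; case: eqP => [->|]. Qed.

Lemma Jl_gt0 S L f s x : cls S L f -> uniq s -> all S s -> (forall x, 0 <= f x) -> 0 < f x ->
  0 < Jl s f x.
Proof.
move=> cf us Ss f0 fx; elim: s us Ss => [|j s IH] //= us Ss.
have [/andP[js us'] /andP[Sj Ss']] := conj us Ss.
apply: (int1_gt0 (x := x 0 j) (Jl_cc1 _ cf us Ss)) => [t|]; first exact: (Jl_ge0 _ cf).
by rewrite upd_id; exact: IH.
Qed.

Lemma Jl_indep s f x y : (forall k, k \notin s -> x 0 k = y 0 k) -> Jl s f x = Jl s f y.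
Proof.
elim: s x y => [|j s IH] x y xy /=.
  by congr f; apply/rowP => k; exact: xy.
rewrite /J; congr int1; apply/funext => t; apply: IH => k ks.
by rewrite !updE; case: eqP => // /eqP kj; apply: xy; rewrite in_cons negb_or kj.
Qed.

Lemma all_predT s : all predT s. Proof. exact: all_predT. Qed.

Lemma Cc2 f g : Cc f -> Cc g -> exists L, cls predT L f /\ cls predT L g.
Proof.
move=> [L cf] [L' cg]; exists (Num.max L L'); split.
  by apply: cls_le cf; rewrite le_max lexx.
by apply: cls_le cg; rewrite le_max lexx orbT.
Qed.

Lemma ID f g : Cc f -> Cc g -> I (fun x => f x + g x) = I f + I g.
Proof.
move=> cf cg; have [L [c1 c2]] := Cc2 cf cg.
by rewrite /I (JlD _ c1 c2) ?enum_uniq ?all_predT.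
Qed.

Lemma IZ (c : R) f : Cc f -> I (fun x => c * f x) = c * I f.
Proof. by move=> [L cf]; rewrite /I (JlZ _ _ cf) ?enum_uniq ?all_predT. Qed.

Lemma I_ge0 f : Cc f -> (forall x, 0 <= f x) -> 0 <= I f.
Proof. by move=> [L cf] f0; rewrite /I (Jl_ge0 _ cf) ?enum_uniq ?all_predT. Qed.

Lemma I_at f x : I f = Jl (enum 'I_N) f x.
Proof. by apply: Jl_indep => k; rewrite mem_enum. Qed.

Lemma I_gt0 f x : Cc f -> (forall x, 0 <= f x) -> 0 < f x -> 0 < I f.
Proof. by move=> [L cf] f0 fx; rewrite (I_at f x) (Jl_gt0 cf) ?enum_uniq ?all_predT. Qed.

Lemma Cc_cont f L : continuous f -> (forall x, L < `|x| -> f x = 0) -> Cc f.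
Proof.
move=> cf f0; exists `|L|; split=> // [e e0|_ k x _ Lx].
  have h z : ~ [set x : V | `|x| <= L]%classic z -> f z = 0.
    by move=> /negP; rewrite -ltNge; exact: f0.
  have [d d0 dP] := heine_cantor (@compact_box R N L) cf h e0.
  by exists d => // _ _ x x' _; exact: dP.
apply: f0; apply: le_lt_trans (ler_norm L) _; apply: lt_le_trans Lx _; exact: coord_le_norm.
Qed.

Lemma Cc_continuous f : Cc f -> continuous f.
Proof.
move=> [L [L0 u s]]; apply/contP => x e e0; have [d d0 dP] := u e e0.
by exists d => // y xy; apply: (dP 0 0) => //; rewrite subrr normr0.
Qed.

Lemma Cc_supp f : Cc f -> exists2 L, 0 <= L & forall x, L < `|x| -> f x = 0.
Proof.
move=> [L [L0 u s]]; exists L => // x; rewrite ltNge => /negP xL.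
apply: contrapT => fx; apply: xL; apply/rv_norm_le => // k.
by rewrite leNgt; apply/negP => /(s 0 k x isT).
Qed.

Definition triangular (F : V -> V) := forall x y j,
  (forall k, (k < j)%N -> x 0 k = y 0 k) -> F x 0 j - x 0 j = F y 0 j - y 0 j.

Lemma Jl_tri S L f F s x : cls S L f -> triangular F -> uniq s -> all S s ->
  (forall j k, j \in s -> (j <= k)%N -> k \in s) -> sorted (fun j k => (j < k)%N) s ->
  Jl s (fun x => f (F x)) x = Jl s f (F x).
Proof.
move=> cf tF; elim: s x => [|j s IH] x //= us Ss up so.
have [/andP[js us'] /andP[Sj Ss']] := conj us Ss.
have up' : forall i k, i \in s -> (i <= k)%N -> k \in s.
  move=> i k si ik; have := up i k; rewrite in_cons si orbT => /(_ isT ik).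
  rewrite in_cons => /orP[/eqP kj|//].
  have tr : transitive (fun a b : 'I_N => (a < b)%N) by move=> a b c'; exact: ltn_trans.
  have := order_path_min tr so.
  by move=> /allP /(_ _ si); rewrite -kj ltnNge ik.
rewrite {1}/J.
have E t : Jl s (fun x0 => f (F x0)) (upd x j t) = Jl s f (upd (F x) j (t + (F x 0 j - x 0 j))).
  rewrite IH //; last by case: (s) so => //= a l /andP[].
  apply: Jl_indep => k ks; rewrite !updE.
  have [->|kj] := eqVneq k j.
    have := tF x (upd x j t) j _ => ->; last by move=> k' k'j; rewrite updE; case: eqP k'j => // ->; rewrite ltnn.
    by rewrite updE eqxx addrC subrK.
  have kltj : (k < j)%N.
    rewrite ltnNge; apply/negP => jk; move: (up j k); rewrite in_cons eqxx => /(_ isT jk).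
    by rewrite in_cons (negbTE kj) (negbTE ks).
  have := tF x (upd x j t) k _ => H.
  have {H} := H _; rewrite updE (negbTE kj) => H.
  have {H} : F x 0 k - x 0 k = F (upd x j t) 0 k - x 0 k.
    apply: H => k' k'k; rewrite updE; case: eqP => // k'j.
    by rewrite k'j ltnNge (ltnW kltj) in k'k.
  by move=> /addIr.
under eq_fun do rewrite E.
by rewrite (int1_shift (h := fun t => Jl s f (upd (F x) j t)) _ (Jl_cc1 _ cf us Ss)).
Qed.

Lemma enum_sorted : sorted (fun j k : 'I_N => (j < k)%N) (enum 'I_N).
Proof.
have := iota_ltn_sorted 0 N; rewrite -val_enum_ord sorted_map; exact.
Qed.

Lemma I_tri f F : Cc f -> triangular F -> I (fun x => f (F x)) = I f.
Proof.
move=> [L cf] tF; rewrite /I (Jl_tri _ cf tF) ?enum_uniq ?all_predT ?enum_sorted //.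
  by rewrite -I_at.
by move=> j k; rewrite !mem_enum.
Qed.

Variable sigma : 'I_N -> nat.

Lemma Jl_dil S L f s (l : R) x : 0 < l -> cls S L f -> uniq s -> all S s ->
  Jl s (fun x => f (dil sigma l x)) x =
  (\prod_(j <- s) l ^+ sigma j)^-1 * Jl s f (dil sigma l x).
Proof.
move=> l0 cf; elim: s x => [|j s IH] x /= us Ss; first by rewrite big_nil invr1 mul1r.
have [/andP[js us'] /andP[Sj Ss']] := conj us Ss.
rewrite {1}/J.
have E t : Jl s (fun x => f (dil sigma l x)) (upd x j t) =
    (\prod_(j <- s) l ^+ sigma j)^-1 * Jl s f (upd (dil sigma l x) j (l ^+ sigma j * t)).
  rewrite IH //; congr (_ * Jl _ _ _); apply/rowP => k; rewrite !mxE.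
  by case: eqP => [->|].
under eq_fun do rewrite E.
have c1 := Jl_cc1 (dil sigma l x) cf us Ss.
have l1 : 0 < l ^+ sigma j by rewrite exprn_gt0.
have [c L0 s1] := c1.
rewrite (int1Z (L := L / l ^+ sigma j)); last first.
  split; first by apply: (cont_comp c); apply: contM; [exact: contC|exact: cont_id].
    by rewrite divr_ge0 // ltW.
  move=> t; rewrite ltr_pdivrMr // => Lt; apply: s1.
  by rewrite normrM gtr0_norm // mulrC.
rewrite (int1_scale (h := fun t => Jl s f (upd (dil sigma l x) j t)) l1 c1).
by rewrite big_cons invfM mulrA; congr (_ * _); exact: mulrC.
Qed.

Definition jac (l : R) : R := \prod_(j <- enum 'I_N) l ^+ sigma j.

Lemma I_dil f (l : R) : 0 < l -> Cc f -> I (fun x => f (dil sigma l x)) = (jac l)^-1 * I f.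
Proof.
move=> l0 [L cf]; rewrite /I (Jl_dil _ l0 cf) ?enum_uniq ?all_predT //.
by rewrite -I_at.
Qed.

End Integral.

Section Functional.
Variables (R : realType) (N : nat).
Local Notation V := 'rV[R]_N.
Local Notation I := (@I R N).
Implicit Types (f g : V -> R) (x y : V) (j k : 'I_N) (L e c : R).

Lemma Cc_cst0 : Cc (fun _ : V => 0 : R).
Proof. by apply: (Cc_cont (L := 0)) => //; exact: contC. Qed.

Lemma CcM f g : Cc f -> continuous g -> Cc (fun x => f x * g x).
Proof.
move=> cf cg; have [L L0 sf] := Cc_supp cf; apply: (Cc_cont (L := L)) => [|x /sf ->].
  by apply: contM => //; exact: Cc_continuous.
by rewrite mul0r.
Qed.

Lemma CcMl f g : continuous f -> Cc g -> Cc (fun x => f x * g x).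
Proof. by move=> cf cg; under eq_fun do rewrite mulrC; exact: CcM. Qed.

Lemma CcZ c f : Cc f -> Cc (fun x => c * f x).
Proof. by move=> cf; apply: CcMl => //; exact: contC. Qed.

Lemma CcD f g : Cc f -> Cc g -> Cc (fun x => f x + g x).
Proof.
move=> cf cg; have [L L0 sf] := Cc_supp cf; have [L' L0' sg] := Cc_supp cg.
apply: (Cc_cont (L := Num.max L L')) => [|x].
  by apply: contD; exact: Cc_continuous.
by rewrite gt_max => /andP[/sf -> /sg ->]; rewrite addr0.
Qed.

Lemma CcN f : Cc f -> Cc (fun x => - f x).
Proof. by move=> cf; under eq_fun do rewrite -mulN1r; exact: CcZ. Qed.

Lemma CcB f g : Cc f -> Cc g -> Cc (fun x => f x - g x).
Proof. by move=> cf cg; apply: CcD => //; exact: CcN. Qed.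

Lemma Cc_abs f : Cc f -> Cc (fun x => `|f x|).
Proof.
move=> cf; have [L L0 sf] := Cc_supp cf; apply: (Cc_cont (L := L)) => [|x /sf ->].
  by apply: cont_norm; exact: Cc_continuous.
by rewrite normr0.
Qed.

Lemma CcX f n : Cc f -> Cc (fun x => f x ^+ n.+1).
Proof.
move=> cf; under eq_fun do rewrite exprS; apply: CcM => //.
by apply: contX; exact: Cc_continuous.
Qed.

Lemma Cc_sum (A : Type) (s : seq A) (F : A -> V -> R) :
  (forall a, Cc (F a)) -> Cc (fun x => \sum_(a <- s) F a x).
Proof.
move=> cF; elim: s => [|a s IH]; first by under eq_fun do rewrite big_nil; exact: Cc_cst0.
by under eq_fun do rewrite big_cons; exact: CcD.
Qed.

Lemma IN f : Cc f -> I (fun x => - f x) = - I f.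
Proof. by move=> cf; rewrite -mulN1r -IZ //; congr I; apply/funext => x; rewrite mulN1r. Qed.

Lemma IB f g : Cc f -> Cc g -> I (fun x => f x - g x) = I f - I g.
Proof. by move=> cf cg; rewrite ID //; [rewrite IN|exact: CcN]. Qed.

Lemma I0 : I (fun=> 0) = 0.
Proof.
have -> : (fun _ : V => 0 : R) = (fun x => 0 * 0) by apply/funext => x; rewrite mul0r.
by rewrite IZ ?mul0r //; exact: Cc_cst0.
Qed.

Lemma I_le f g : Cc f -> Cc g -> (forall x, f x <= g x) -> I f <= I g.
Proof.
move=> cf cg fg; rewrite -subr_ge0 -IB //; apply: I_ge0; first exact: CcB.
by move=> x; rewrite subr_ge0.
Qed.

Lemma I_sum (A : Type) (s : seq A) (F : A -> V -> R) : (forall a, Cc (F a)) ->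
  I (fun x => \sum_(a <- s) F a x) = \sum_(a <- s) I (F a).
Proof.
move=> cF; elim: s => [|a s IH].
  by rewrite big_nil -[RHS]I0; congr I; apply/funext => x; rewrite big_nil.
rewrite big_cons -IH -ID //; last exact: Cc_sum.
by congr I; apply/funext => x; rewrite big_cons.
Qed.

Lemma I_absle f g c : Cc f -> Cc g -> (forall x, `|f x| <= c * g x) -> `|I f| <= c * I g.
Proof.
move=> cf cg fg; rewrite ler_norml -mulNr -!IZ //.
apply/andP; split; apply: I_le => //; try exact: CcZ;
  by move=> x; have := fg x; rewrite ler_norml ?mulNr => /andP[].
Qed.

Definition tent L x : R := Num.max (1 - Num.max (`|x| - L - 1) 0) 0.

Lemma tent_ge0 L x : 0 <= tent L x. Proof. by rewrite le_max lexx orbT. Qed.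

Lemma tent_le1 L x : tent L x <= 1.
Proof. by rewrite ge_max ler01 andbT gerBl le_max lexx orbT. Qed.

Lemma tent_eq1 L x : `|x| <= L + 1 -> tent L x = 1.
Proof.
move=> xL; rewrite /tent (max_r (_ : `|x| - L - 1 <= 0)) ?subr0 ?max_l //.
by move: (`|x|) xL => a aL; lra.
Qed.

Lemma tent_ge1 L x : `|x| <= L -> 1 <= tent L x.
Proof. by move=> xL; rewrite tent_eq1 // (le_trans xL) // lerDl. Qed.

Lemma tent_supp L x : L + 2 <= `|x| -> tent L x = 0.
Proof.
move=> xL; have xL' : 1 <= `|x| - L - 1 by move: (`|x|) xL => a aL; lra.
by rewrite /tent (max_l (le_trans ler01 xL')) max_r // subr_le0.
Qed.

Lemma Cc_tent L : Cc (tent L).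
Proof.
apply: (Cc_cont (L := L + 2)) => [|x /ltW]; last exact: tent_supp.
apply: cont_max0; apply: contB; first exact: contC.
apply: cont_max0; apply: contB; last exact: contC.
apply: contB; last exact: contC.
by move=> x; exact: norm_continuous.
Qed.

Lemma I_J (S : pred 'I_N) L (g : V -> V -> R) j (t0 : V) : jcls S L g -> S j ->
  (forall x t, L < `|x| -> g x t = 0) ->
  I (fun x => J j (g x) t0) = J j (fun t => I (fun x => g x t)) t0.
Proof.
move=> cg Sj gx; have [L0 u s] := cg.
have cc x : cc1 L (fun r => g x (upd t0 j r)) by exact: (jcls_cc1 x t0 cg Sj).
have /choice [H HP] : forall x, exists H : R -> R, prim H (fun r => g x (upd t0 j r)) /\ H (- L) = 0.
  move=> x; have [H pH _] := int1_prim (cc x).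
  exists (fun r => H r - H (- L)); split; last by rewrite subrr.
  by move=> r; apply: is_derive_eq (derB (pH r) (derC _ _)) _; rewrite subr0.
have Hp x : prim (H x) (fun r => g x (upd t0 j r)) by have [] := HP x.
have HL x : H x (- L) = 0 by have [] := HP x.
have Hsupp r x : L < `|x| -> H x r = 0.
  move=> Lx; rewrite -(HL x); apply: (prim_const (Hp x)); last by case: (cc x).
  by move=> r' _; exact: gx.
have cH r : Cc (fun x => H x r).
  apply: (Cc_cont (L := L)) => [|x /Hsupp //]; apply/contP => x e e0.
  have r0 : 0 < `|r + L| + 1 by rewrite ltr_wpDl.
  have [d d0 dP] := u (e / (`|r + L| + 1)) (divr_gt0 e0 r0).
  exists d => // y yx.
  have M r' : `|g y (upd t0 j r') - g x (upd t0 j r')| <= e / (`|r + L| + 1).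
    by apply: ltW; apply: dP => //; rewrite subrr normr0.
  have := mvt_le (a := - L) (b := r) (fun r' => derB (Hp y r') (Hp x r')) (fun r' _ => M r').
  rewrite !HL subr0 subr0 opprK => h; apply: le_lt_trans h _.
  by rewrite mulrAC ltr_pdivrMr // ltr_pM2l // ltrDl.
have cgt t : Cc (fun x => g x t).
  apply: (Cc_cont (L := L)) => [|x /gx //]; apply/contP => x e e0.
  by have [d d0 dP] := u e e0; exists d => // y yx; apply: dP; rewrite // subrr normr0.
pose T := I (tent L); have T0 : 0 <= T by apply: I_ge0 => [|x]; [exact: Cc_tent|exact: tent_ge0].
have T1 : 0 < T + 1 by lra.
have tnt e x (b : R) : 0 <= e -> `|b| <= e -> (L < `|x| -> b = 0) -> `|b| <= e * tent L x.
  move=> e0 be bx; have [xL|Lx] := leP `|x| L.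
    by apply: le_trans be _; rewrite ler_peMr // tent_ge1.
  by rewrite bx // normr0 mulr_ge0 // tent_ge0.
pose Phi r := I (fun x => H x r).
have pPhi : prim Phi (fun r => I (fun x => g x (upd t0 j r))).
  move=> r; apply/der_epsP => e e0.
  have [d d0 dP] := u (e / (T + 1)) (divr_gt0 e0 T1); exists d => // h hd.
  rewrite /Phi -IB // -IZ // -IB; [|exact: CcB|exact: CcZ].
  have bd : forall x, `|H x (r + h) - H x r - h * g x (upd t0 j r)| <= (e / (T + 1) * `|h|) * tent L x.
    move=> x; apply: tnt => [||Lx]; last by rewrite !Hsupp // gx // mulr0 !subrr.
      by rewrite mulr_ge0 // divr_ge0 // ltW.
    have [r' hr' ->] := mvt r (r + h) (Hp x).
    rewrite addrAC subrr add0r mulrC -mulrBr normrM mulrC ler_wpM2r //.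
    apply: ltW; apply: dP; first by rewrite subrr normr0.
    apply: le_lt_trans (upd_dist_t _ _ _ _) _; apply: le_lt_trans hd.
    move: hr'; rewrite ler_norml; case: (leP r (r + h)) => rh /andP[h1 h2].
      have h0 : 0 <= h by lra.
      rewrite ger0_norm //; apply/andP; split; lra.
    have h0 : h <= 0 by lra.
    rewrite ler0_norm //; apply/andP; split; lra.
  apply: le_trans (I_absle _ (Cc_tent L) bd) _; first by apply: CcB; [exact: CcB|exact: CcZ].
  rewrite -/T mulrAC ler_wpM2r // mulrAC ler_pdivrMr // ler_pM2l //; lra.
rewrite /J (int1E (H := Phi) (L := L)) //; first last.
- move=> r Lr; rewrite -[RHS]I0; congr I; apply/funext => x.
  by case: (cc x) => _ _; apply.
- apply/contP => r e e0; have [d d0 dP] := u (e / (T + 1)) (divr_gt0 e0 T1).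
  exists d => // r' rr'; rewrite -IB //.
  have bd : forall x, `|g x (upd t0 j r') - g x (upd t0 j r)| <= (e / (T + 1)) * tent L x.
    move=> x; apply: tnt => [||Lx]; last by rewrite !gx // subrr.
      by rewrite divr_ge0 // ltW.
    apply: ltW; apply: dP; first by rewrite subrr normr0.
    by apply: le_lt_trans (upd_dist_t _ _ _ _) rr'.
  apply: le_lt_trans (I_absle _ (Cc_tent L) bd) _; first exact: CcB.
  by rewrite -/T mulrAC ltr_pdivrMr // ltr_pM2l //; lra.
rewrite /Phi -IB //; congr I; apply/funext => x.
by case: (cc x) => c1 _ c3; rewrite (int1E c1 (Hp x) L0 c3).
Qed.

Lemma I_Jl (S : pred 'I_N) L (g : V -> V -> R) s (t0 : V) : jcls S L g -> uniq s -> all S s ->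
  (forall x t, L < `|x| -> g x t = 0) ->
  I (fun x => Jl s (g x) t0) = Jl s (fun t => I (fun x => g x t)) t0.
Proof.
move=> cg; elim: s t0 => [|j s IH] t0 //= us Ss gx.
have [/andP[js us'] /andP[Sj Ss']] := conj us Ss.
rewrite (I_J t0 (jcls_Jl cg us' Ss')) /= ?Sj ?js //.
  by congr int1; apply/funext => r; rewrite IH.
move=> x t Lx; have -> : g x = fun t => 0 * g x t.
  by apply/funext => t'; rewrite gx // mul0r.
by rewrite (JlZ _ _ (jcls_fix x cg)) // mul0r.
Qed.

Lemma Fubini_Cc (g : V -> V -> R) L : continuous (fun z : V * V => g z.1 z.2) ->
  (forall x t, L < `|x| -> g x t = 0) -> (forall x t, L < `|t| -> g x t = 0) ->
  [/\ Cc (fun x => I (g x)), Cc (fun t => I (fun x => g x t)) &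
    I (fun x => I (g x)) = I (fun t => I (fun x => g x t))].
Proof.
wlog L0 : L / 0 <= L.
  move=> W c1 c2 c3; apply: (W `|L|) => // x t Lx; [apply: c2|apply: c3];
  exact: le_lt_trans (ler_norm L) Lx.
move=> cg gx gt.
have cg' : continuous (fun z : V * V => g z.2 z.1).
  apply: (@cont_comp _ _ _ (fun z : V * V => g z.1 z.2) (fun z : V * V => (z.2, z.1))) => //.
  by apply: cont_pair; [exact: cont_snd|exact: cont_fst].
have jc (h : V -> V -> R) : continuous (fun z : V * V => h z.1 z.2) ->
    (forall x t, L < `|x| -> h x t = 0) -> (forall x t, L < `|t| -> h x t = 0) -> jcls predT L h.
  move=> ch hx ht; split=> // [e e0|x k t _ Lt]; last first.
    by apply: ht; apply: lt_le_trans Lt _; exact: coord_le_norm.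
  pose B := [set x : V | `|x| <= L]%classic.
  have h0 z : ~ (B `*` B)%classic z -> h z.1 z.2 = 0.
    move=> nz; apply: contrapT => hz; apply: nz; split; rewrite /B /= leNgt; apply/negP => Lz.
      by apply: hz; exact: hx.
    by apply: hz; exact: ht.
  have [d d0 dP] := heine_cantor (compact_setX (@compact_box R N L) (@compact_box R N L)) ch h0 e0.
  exists d => // p p' x x' pp xx; apply: (dP (p, x) (p', x')).
  by rewrite prod_normE /= gt_max pp xx.
have j1 := jc g cg gx gt.
have j2 := jc (fun t x => g x t) cg' (fun x t => gt t x) (fun x t => gx t x).
have Cx (h : V -> V -> R) : jcls predT L h -> (forall x t, L < `|x| -> h x t = 0) -> Cc (fun x => I (h x)).
  move=> jh hx; have := jcls_Jl jh (enum_uniq 'I_N) (all_predT _) => -[_ u _].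
  apply: (Cc_cont (L := L)) => [|x Lx].
    apply/contP => x e e0; have [d d0 dP] := u e e0; exists d => // y yx.
    by apply: dP; rewrite // subrr normr0.
  by rewrite -[RHS]I0; congr I; apply/funext => t; exact: hx.
split; [exact: Cx|by apply: (Cx (fun t x => g x t)) => // x t Lx; exact: gt|].
by rewrite {1}IE [in RHS]IE; exact: (I_Jl 0 j1 (enum_uniq _) (all_predT _) gx).
Qed.

End Functional.

Definition frun (R : realType) (N m : nat) (F : 'I_m -> R -> 'rV[R]_N -> 'rV[R]_N)
  (w : seq ('I_m * R)) (x : 'rV[R]_N) : 'rV[R]_N := foldr (fun ic y => F ic.1 ic.2 y) x w.

(* What the analysis needs of the vector fields: their flows, and a family of broken trajectories [traj t] that reaches every point through triangular coordinates [t]. *)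
Record flowsys (R : realType) (N m : nat) (sigma : 'I_N -> nat) := FlowSys {
  fl : 'I_m -> R -> 'rV[R]_N -> 'rV[R]_N;
  fl0 : forall i x, fl i 0 x = x;
  flD : forall i s t x, fl i (s + t) x = fl i s (fl i t x);
  fl_cont : forall i, continuous (fun sx : R * 'rV[R]_N => fl i sx.1 sx.2);
  fl_tri : forall i s, triangular (fl i s);
  fl_dil : forall i (l : R) s x, 0 < l ->
    fl i (l * s) (dil sigma l x) = dil sigma l (fl i s x);
  fl_coord : forall i j, exists g : 'rV[R]_N -> R, continuous g /\
    forall x, is_derive (0 : R) 1 (fun s => fl i s x 0 j) (g x);
  traj : 'rV[R]_N -> seq ('I_m * R);
  traj_cont : continuous (fun tx : 'rV[R]_N * 'rV[R]_N => frun fl (traj tx.1) tx.2);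
  traj_tri : forall x, triangular (fun t => frun fl (traj t) x);
  traj_lin : exists n (C : R), 0 <= C /\
    forall (t : 'rV[R]_N) (r : R), 0 <= r -> (forall j, `|t 0 j| <= r ^+ sigma j) ->
      (size (traj t) <= n)%N /\ all (fun ic => `|ic.2| <= C * r) (traj t)
}.

Section Horizontal.
Variables (R : realType) (N m : nat) (sigma : 'I_N -> nat) (S : flowsys R m sigma).
Local Notation V := 'rV[R]_N.
Local Notation I := (@I R N).
Local Notation F := (fl S).
Implicit Types (f g u s : V -> R) (x y : V) (i : 'I_m) (L e c r : R) (w : seq ('I_m * R)).

Lemma flN i c x : F i (- c) (F i c x) = x.
Proof. by rewrite -flD addNr fl0. Qed.

Lemma cont_fl i c : continuous (F i c).
Proof.
apply: (@cont_comp _ _ _ (fun sx : R * V => F i sx.1 sx.2) (fun x : V => (c, x))).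
  exact: fl_cont.
by apply: (@cont_pair _ _ _ (fun _ : V => c) id); [exact: cst_continuous|exact: cont_id].
Qed.

Lemma cont_fls i x : continuous (fun c => F i c x).
Proof.
apply: (@cont_comp _ _ _ (fun sx : R * V => F i sx.1 sx.2) (fun c : R => (c, x))).
  exact: fl_cont.
by apply: (@cont_pair _ _ _ id (fun _ : R => x)); [exact: cont_id|exact: cst_continuous].
Qed.

Definition hd i f g := [/\ continuous f, continuous g &
  forall x, is_derive (0 : R) 1 (fun c => f (F i c x)) (g x)].

Lemma hd_der i f g x c : hd i f g -> is_derive c 1 (fun c => f (F i c x)) (g (F i c x)).
Proof.
move=> [cf cg dg]; have := dg (F i c x).
have E : (fun c' => f (F i c' x)) = (fun c' => f (F i (c' - c) (F i c x))).
  by apply/funext => c'; rewrite -flD subrK.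
rewrite E => D; rewrite -[g _]mulr1.
apply: (@is_derive1_comp _ (fun a => f (F i a (F i c x))) (fun c' => c' - c)).
  by rewrite subrr.
by apply: is_derive_eq (derB (derI _) (derC _ _)) _; rewrite subr0.
Qed.

Lemma hdM i f f' g g' : hd i f f' -> hd i g g' ->
  hd i (fun x => f x * g x) (fun x => f' x * g x + f x * g' x).
Proof.
move=> [cf cf' df] [cg cg' dg]; split; [exact: contM|by apply: contD; exact: contM|].
by move=> x; apply: is_derive_eq (derM (df x) (dg x)) _; rewrite !fl0.
Qed.

Lemma hdD i f f' g g' : hd i f f' -> hd i g g' ->
  hd i (fun x => f x + g x) (fun x => f' x + g' x).
Proof.
move=> [cf cf' df] [cg cg' dg]; split; [exact: contD|exact: contD|].
by move=> x; exact: derD.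
Qed.

Lemma hdC i c : hd i (fun=> c) (fun=> 0).
Proof. by split; [exact: contC|exact: contC|move=> x; exact: derC]. Qed.

Lemma hdZ i c f f' : hd i f f' -> hd i (fun x => c * f x) (fun x => c * f' x).
Proof.
move=> [cf cf' df]; split; [by apply: contM => //; exact: contC|by apply: contM => //; exact: contC|].
by move=> x; exact: derZ.
Qed.

Lemma hd_sum i (A : Type) (l : seq A) (f f' : A -> V -> R) : (forall a, hd i (f a) (f' a)) ->
  hd i (fun x => \sum_(a <- l) f a x) (fun x => \sum_(a <- l) f' a x).
Proof.
move=> h; split; [by apply: cont_sum => a; case: (h a)|by apply: cont_sum => a; case: (h a)|].
by move=> x; apply: der_sum => a _; case: (h a).
Qed.

Lemma hd_comp i (b b' : R -> R) f f' : continuous b' -> (forall y : R, is_derive y 1 b (b' y)) ->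
  hd i f f' -> hd i (fun x => b (f x)) (fun x => b' (f x) * f' x).
Proof.
move=> cb' db [cf cf' df]; split.
- by apply: cont_comp => // y; exact: der_cont (db y).
- by apply: contM => //; exact: cont_comp.
- move=> x; apply: (@is_derive1_comp _ b (fun c => f (F i c x))) => //.
  by rewrite fl0.
Qed.

Lemma hd_dil i (l : R) f f' : 0 < l -> hd i f f' ->
  hd i (fun x => f (dil sigma l x)) (fun x => l * f' (dil sigma l x)).
Proof.
move=> l0 h; have [cf cf' df] := h; split.
- exact: (cont_comp cf (@cont_dilx R N sigma l)).
- by apply: contM; [exact: contC|exact: (cont_comp cf' (@cont_dilx R N sigma l))].
move=> x; have -> : (fun c => f (dil sigma l (F i c x))) = (fun c => f (F i (l * c) (dil sigma l x))).
  by apply/funext => c; rewrite fl_dil.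
rewrite mulrC; apply: (@is_derive1_comp _ (fun a => f (F i a (dil sigma l x))) (fun c => l * c)).
  by rewrite mulr0.
by apply: is_derive_eq (derZ l (derI _)) _; rewrite mulr1.
Qed.

Lemma reach1 L r : exists2 M, 0 <= M & forall i c x, `|c| <= r -> `|x| <= L -> `|F i c x| <= M.
Proof.
have H i : exists2 M : R, 0 <= M & forall c x, `|c| <= r -> `|x| <= L -> `|F i c x| <= M.
  have cf : continuous (fun z : R * V => `|F i z.1 z.2|).
    move=> z; apply: (@continuous_comp _ _ _ (fun z : R * V => F i z.1 z.2) (fun y => `|y|)).
      exact: fl_cont.
    exact: norm_continuous.
  have cK : compact ([set c : R | `|c| <= r] `*` [set x : V | `|x| <= L])%classic.
    apply: compact_setX; last exact: compact_box.
    rewrite (_ : [set c | _]%classic = [set` `[- r, r]%R]%classic); first exact: segment_compact.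
    by apply/seteqP; split=> c /=; rewrite in_itv /= ler_norml.
  have [M M0 MP] := compact_bound cK cf; exists M => // c x cr xL.
  by have := MP (c, x) (conj cr xL); rewrite /= ger0_norm.
have /choice [M MP] : forall i, exists M : R, 0 <= M /\ forall c x, `|c| <= r -> `|x| <= L -> `|F i c x| <= M.
  by move=> i; have [M M0 MP] := H i; exists M.
exists (\sum_i M i); first by apply: sumr_ge0 => i _; case: (MP i).
move=> i c x cr xL; apply: le_trans ((MP i).2 c x cr xL) _.
by rewrite (bigD1 i) //= lerDl sumr_ge0 // => k _; case: (MP k).
Qed.

Lemma reach L r n : exists2 M, 0 <= M & forall w x, (size w <= n)%N ->
  all (fun ic => `|ic.2| <= r) w -> `|x| <= L -> `|frun F w x| <= M.
Proof.
elim: n => [|n [M M0 MP]].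
  exists `|L| => // -[|ic w] x //= _ _ xL; exact: le_trans (ler_norm L).
have [M' M0' MP'] := reach1 M r; exists (M + M'); first by rewrite addr_ge0.
move=> [|[i c] w] x /= sw => [_ xL|/andP[cr wr] xL].
  by have := MP [::] x isT isT xL => /= h; rewrite (le_trans h) // lerDl.
by rewrite (le_trans (MP' i c _ cr (MP w x sw wr xL))) // lerDr.
Qed.

Lemma hd_quotient i f g L e : hd i f g -> 0 < e -> exists2 d : R, 0 < d &
  forall h x, `|h| < d -> `|x| <= L -> `|f (F i h x) - f x - h * g x| <= e * `|h|.
Proof.
move=> h e0; have [cf cg _] := h.
have cF : continuous (fun z : R * V => g (F i z.1 z.2)) by exact: (cont_comp cg (@fl_cont _ _ _ _ S i)).
have cK : compact ([set (0 : R)] `*` [set x : V | `|x| <= L])%classic.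
  by apply: compact_setX; [exact: compact_set1|exact: compact_box].
have [d d0 dP] := heine_cantor_on cK cF e0; exists d => // a x ad xL.
have [b hb E] := mvt 0 a (fun c => hd_der x c h).
rewrite fl0 subr0 in E; rewrite E mulrC -mulrBr normrM mulrC ler_wpM2r //.
suff B : `|((0 : R), x) - (b, x)| < d.
  by have := dP (0, x) (b, x) (conj erefl xL) B; rewrite /= fl0 distrC => /ltW.
rewrite prod_normE /= subrr normr0 sub0r normrN gt_max d0 andbT.
apply: le_lt_trans ad; move: hb; case: (leP 0 a) => a0 /andP[h1 h2].
  by rewrite !ger0_norm.
by rewrite !ler0_norm ?lerN2 // ltW.
Qed.

Lemma Cc_hd i u du : hd i u du -> Cc u -> Cc du.
Proof.
move=> h cu; have [_ cdu _] := h; have [L L0 sL] := Cc_supp cu.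
apply: (Cc_cont (L := L)) => // x Lx.
apply/eqP; rewrite -normr_le0 leNgt; apply/negP => dx.
have [d d0 dP] := hd_quotient `|x| h (divr_gt0 dx (ltr0n _ 2)).
have cn : continuous (fun c => `|F i c x|).
  move=> c; apply: (@continuous_comp _ _ _ (fun c => F i c x) (fun y => `|y|)).
    exact: cont_fls.
  exact: norm_continuous.
have Lx' : 0 < `|x| - L by rewrite subr_gt0.
have [d' d0' dP'] := (contP _).1 cn 0 _ Lx'.
pose c := Num.min (d / 2) (d' / 2).
have c0 : 0 < c by rewrite lt_min !divr_gt0.
have cd : c < d by rewrite gt_min (_ : d / 2 < d) //; lra.
have cd' : c < d' by rewrite gt_min (_ : d' / 2 < d') ?orbT //; lra.
have := dP' c; rewrite subr0 gtr0_norm // fl0 => /(_ cd') H.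
have H1 : L < `|F i c x|.
  by move: H; rewrite ltr_norml => /andP[]; move: `|F i c x| `|x| => a b; lra.
have := dP c x; rewrite gtr0_norm // => /(_ cd (lexx _)).
rewrite (sL _ H1) (sL _ Lx) subrr sub0r normrN normrM gtr0_norm // mulrC ler_pM2r //.
by move: `|du x| dx => a; lra.
Qed.

Lemma Cc_fl i c u : Cc u -> Cc (fun x => u (F i c x)).
Proof.
move=> cu; have [L L0 sL] := Cc_supp cu; have [M M0 MP] := reach1 L `|c|.
apply: (Cc_cont (L := M)) => [|x Mx].
  by apply: cont_comp; [exact: Cc_continuous|exact: cont_fl].
apply: sL; rewrite ltNge; apply/negP => xL.
have := MP i (- c) (F i c x); rewrite normrN flN => /(_ (lexx _) xL).
by rewrite leNgt Mx.
Qed.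

Lemma Cc_frun w u : Cc u -> Cc (fun x => u (frun F w x)).
Proof. by elim: w u => [|[i c] w IH] u cu //=; apply: (IH (fun x => u (F i c x))); exact: Cc_fl. Qed.

Lemma I_fl i c u : Cc u -> I (fun x => u (F i c x)) = I u.
Proof. by move=> cu; apply: I_tri => //; exact: fl_tri. Qed.

Lemma I_frun w u : Cc u -> I (fun x => u (frun F w x)) = I u.
Proof.
elim: w u => [|[i c] w IH] u cu //=.
by rewrite (IH (fun x => u (F i c x))) ?I_fl //; exact: Cc_fl.
Qed.

Lemma le_epsM (a b M : R) : (forall e, 0 < e -> e < 1 -> a <= b + e * M) -> a <= b.
Proof.
move=> h; rewrite leNgt; apply/negP => ba.
pose e := Num.min (1 / 2) ((a - b) / (2 * (`|M| + 1))).
have M1 : 0 < 2 * (`|M| + 1) by rewrite mulr_gt0 // ltr_wpDl.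
have e0 : 0 < e by rewrite lt_min !divr_gt0 // subr_gt0.
have e1 : e < 1 by rewrite gt_min (_ : 1 / 2 < 1) //; lra.
have := h e e0 e1; apply/negP; rewrite -ltNge -ltrBrDl.
apply: (@le_lt_trans _ _ (e * (`|M| + 1))).
  by rewrite ler_wpM2l ?(ltW e0) // (le_trans (ler_norm _)) // lerDl.
apply: (@le_lt_trans _ _ ((a - b) / (2 * (`|M| + 1)) * (`|M| + 1))).
  by rewrite ler_wpM2r // ?addr_ge0 // ge_min lexx orbT.
have nz : `|M| + 1 != 0 by rewrite gt_eqF // ltr_wpDl.
rewrite invfM mulrA -mulrA mulVf // mulr1 ltr_pdivrMr //; lra.
Qed.

(* The flows preserve the integral, so derivatives along the fields have zero mean. *)
Lemma I_hd0 i u du : hd i u du -> Cc u -> I du = 0.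
Proof.
move=> h cu; have cdu := Cc_hd h cu; have [L L0 sL] := Cc_supp cu.
have [M M0 MP] := reach1 L 1.
have cN : Cc (tent M : V -> R) := @Cc_tent R N M.
apply/eqP; rewrite -normr_le0; apply: (le_epsM (M := I (tent M))) => e e0 e1.
rewrite add0r; have [d d0 dP] := hd_quotient (M + 2) h e0.
pose c := Num.min (d / 2) 1.
have c0 : 0 < c by rewrite lt_min divr_gt0 ?ltr01.
have c1 : c <= 1 by rewrite ge_min lexx orbT.
have cd : c < d by rewrite gt_min (_ : d / 2 < d) //; lra.
have E : I (fun x => u (F i c x) - u x - c * du x) = - (c * I du).
  rewrite IB; [|by apply: CcB => //; exact: Cc_fl|exact: CcZ].
  by rewrite IB ?I_fl ?subrr ?sub0r ?IZ //; exact: Cc_fl.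
suff K : forall x, `|u (F i c x) - u x - c * du x| <= (e * c) * tent M x.
  have := I_absle (CcB (CcB (Cc_fl i c cu) cu) (CcZ c cdu)) cN K.
  by rewrite E normrN normrM gtr0_norm // (mulrC e) -mulrA ler_pM2l.
move=> x.
have [xM|Mx] := leP `|x| M.
  apply: le_trans (_ : e * c <= _).
    by have := dP c x; rewrite gtr0_norm // => /(_ cd); apply; rewrite (le_trans xM) // lerDl.
  by rewrite ler_peMr ?tent_ge1 // mulr_ge0 // ltW.
have u0 : u x = 0.
  apply: sL; rewrite ltNge; apply/negP => xL.
  have := MP i 0 x; rewrite normr0 fl0 => /(_ ler01 xL); by rewrite leNgt Mx.
have uc0 : u (F i c x) = 0.
  apply: sL; rewrite ltNge; apply/negP => xL.
  have := MP i (- c) (F i c x); rewrite normrN flN gtr0_norm // => /(_ c1 xL).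
  by rewrite leNgt Mx.
have [LM|LM] := leP `|x| L; first by have := MP i 0 x; rewrite normr0 fl0 => /(_ ler01 LM); rewrite leNgt Mx.
have du0 : du x = 0.
  apply/eqP; rewrite -normr_le0; apply: (le_epsM (M := 1)) => e' e0' _; rewrite mulr1 add0r.
  have [d' d0' dP'] := hd_quotient `|x| h e0'.
  pose c' := Num.min (d' / 2) 1.
  have c0' : 0 < c' by rewrite lt_min divr_gt0 ?ltr01.
  have c1' : c' <= 1 by rewrite ge_min lexx orbT.
  have cd' : c' < d' by rewrite gt_min (_ : d' / 2 < d') //; lra.
  have uc0' : u (F i c' x) = 0.
    apply: sL; rewrite ltNge; apply/negP => xL.
    have := MP i (- c') (F i c' x); rewrite normrN flN gtr0_norm // => /(_ c1' xL).
    by rewrite leNgt Mx.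
  have := dP' c' x; rewrite gtr0_norm // => /(_ cd' (lexx _)).
  by rewrite uc0' u0 subrr sub0r normrN normrM gtr0_norm // mulrC ler_pM2r.
by rewrite u0 uc0 du0 mulr0 !subrr normr0 mulr_ge0 ?tent_ge0 // mulr_ge0 // ltW.
Qed.

Lemma sqr_sum_le (n : nat) (a : nat -> R) :
  (\sum_(k < n) a k) ^+ 2 <= n%:R * \sum_(k < n) a k ^+ 2.
Proof.
elim: n => [|n IH]; first by rewrite !big_ord0 expr0n mul0r.
rewrite !big_ord_recr /=; set A := \sum_(k < n) a k in IH *; set B := \sum_(k < n) _ in IH *.
have B0 : 0 <= B by apply: sumr_ge0 => k _; exact: sqr_ge0.
have [n0|n0] := posnP n.
  have -> : A = 0 by rewrite /A; move: (n0) => ->; rewrite big_ord0.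
  have -> : B = 0 by rewrite /B; move: (n0) => ->; rewrite big_ord0.
  by rewrite n0 !add0r mul1r.
have n1 : 0 < n%:R :> R by rewrite ltr0n.
rewrite [n.+1%:R]mulrSr; move: (a n) (n%:R : R) n1 IH => b c c0 IH.
have H : 2 * A * b <= A ^+ 2 / c + c * b ^+ 2.
  rewrite -subr_ge0.
  have -> : A ^+ 2 / c + c * b ^+ 2 - 2 * A * b = (A - c * b) ^+ 2 / c.
    by field; rewrite gt_eqF.
  by rewrite divr_ge0 ?sqr_ge0 // ltW.
have H2 : A ^+ 2 / c <= B by rewrite ler_pdivrMr // mulrC.
have -> : (A + b) ^+ 2 = A ^+ 2 + 2 * A * b + b ^+ 2 by ring.
have -> : (c + 1) * (B + b ^+ 2) = c * B + B + c * b ^+ 2 + b ^+ 2 by ring.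
lra.
Qed.

(* Telescope over equal time steps: by invariance all increments have the same mean square, and for small steps it is the step squared times that of the derivative. *)
Lemma flow_L2 i s ds (phi psi : V -> R) c : hd i s ds -> Cc phi -> Cc psi ->
  (forall x, 0 <= phi x) -> (forall a x, `|a| <= `|c| -> phi (F i a x) <= psi x) ->
  I (fun x => phi x * (s (F i c x) - s x) ^+ 2) <= c ^+ 2 * I (fun x => psi x * ds x ^+ 2).
Proof.
move=> h cphi cpsi phi0 pp; have [cs cds _] := h.
have psi0 x : 0 <= psi x by have := pp 0 x; rewrite normr0 fl0 => /(_ (normr_ge0 _)); exact: le_trans.
have [L L0 sL] := Cc_supp cpsi.
have cd2 : Cc (fun x => psi x * ds x ^+ 2) by apply: CcM => //; exact: contX.
have cda : Cc (fun x => psi x * `|ds x|) by apply: CcM => //; exact: cont_norm.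
pose A := I (fun x => psi x * `|ds x|); pose B := I psi.
apply: (le_epsM (M := c ^+ 2 * (2 * A + B))) => e e0 e1.
have [d d0 dP] := hd_quotient L h e0.
have [n nP] : exists n : nat, `|c| / d < n.+1%:R.
  by exists (Num.bound (`|c| / d)); rewrite (lt_trans (archi_boundP _)) ?ltr_nat // divr_ge0 // ltW.
pose a := c / n.+1%:R.
have n0 : 0 < n.+1%:R :> R by rewrite ltr0n.
have ad : `|a| < d.
  by rewrite /a normrM normfV (gtr0_norm n0) ltr_pdivrMr // mulrC -ltr_pdivrMr.
pose D x := s (F i a x) - s x.
have cD : continuous D by apply: contB => //; apply: cont_comp => //; exact: cont_fl.
have tele x : s (F i c x) - s x = \sum_(k < n.+1) D (F i (k%:R * a) x).
  have -> : c = n.+1%:R * a by rewrite /a mulrC divfK // gt_eqF.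
  elim: n.+1 => [|k IH]; first by rewrite big_ord0 mul0r fl0 subrr.
  rewrite big_ord_recr /= -IH /D.
  have -> : k.+1%:R * a = a + k%:R * a by rewrite mulrSr mulrDl mul1r addrC.
  by rewrite flD; ring.
have cDk k : Cc (fun x => phi x * D (F i (k%:R * a) x) ^+ 2).
  by apply: CcM => //; apply: contX; apply: cont_comp => //; exact: cont_fl.
have cpD : Cc (fun x => psi x * D x ^+ 2) by apply: CcM => //; exact: contX.
have bk (k : 'I_n.+1) : I (fun x => phi x * D (F i (k%:R * a) x) ^+ 2) <= I (fun x => psi x * D x ^+ 2).
  have cc : Cc (fun x => phi (F i (- (k%:R * a)) x) * D x ^+ 2).
    by apply: CcM; [exact: Cc_fl|exact: contX].
  have := I_fl i (k%:R * a) cc; under eq_fun do rewrite flN; move=> ->.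
  apply: I_le => // x; apply: ler_wpM2r; first exact: sqr_ge0.
  apply: pp; rewrite normrN /a normrM normrM normfV mulrA mulrAC (gtr0_norm n0).
  by rewrite ler_piMl // ger0_norm ?ler0n // ler_pdivrMr // mul1r ler_nat ltnW.
have cphs : Cc (fun x => phi x * (s (F i c x) - s x) ^+ 2).
  by apply: CcM => //; apply: contX; apply: contB => //; apply: cont_comp => //; exact: cont_fl.
apply: (@le_trans _ _ (n.+1%:R ^+ 2 * I (fun x => psi x * D x ^+ 2))).
  apply: (@le_trans _ _ (I (fun x => n.+1%:R * \sum_(k < n.+1) phi x * D (F i (k%:R * a) x) ^+ 2))).
    apply: I_le => //; first by apply: CcZ; exact: Cc_sum.
    by move=> x; rewrite -mulr_sumr [leRHS]mulrCA ler_wpM2l // tele; exact: (sqr_sum_le _ (fun k => D (F i (k%:R * a) x))).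
  rewrite IZ; last exact: Cc_sum.
  rewrite I_sum // expr2 -mulrA ler_wpM2l ?(ltW n0) //.
  apply: le_trans (ler_sum _ (fun k _ => bk k)) _.
  by rewrite sumr_const card_ord -[X in X <= _]mulr_natl.
have Dle x : psi x * D x ^+ 2 <= a ^+ 2 * (psi x * ds x ^+ 2 + (2 * e) * (psi x * `|ds x|) + e ^+ 2 * psi x).
  have -> : a ^+ 2 * (psi x * ds x ^+ 2 + (2 * e) * (psi x * `|ds x|) + e ^+ 2 * psi x) =
      psi x * (`|a| * (`|ds x| + e)) ^+ 2.
    have nn (b : R) : b ^+ 2 = `|b| ^+ 2 by rewrite real_normK ?num_real.
    by rewrite (nn a) (nn (ds x)); ring.
  have [xL|Lx] := leP `|x| L; last by rewrite sL // !mul0r.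
  rewrite ler_wpM2l // -[D x ^+ 2]real_normK ?num_real // lerXn2r ?nnegrE //.
    by rewrite mulr_ge0 // addr_ge0 // ltW.
  have := dP a x ad xL; rewrite -/(D x) => H.
  rewrite -(subrK (a * ds x) (D x)); apply: le_trans (ler_normD _ _) _.
  have -> : `|a| * (`|ds x| + e) = e * `|a| + `|a| * `|ds x| by ring.
  by rewrite normrM lerD2r.
have c3 : Cc (fun x => psi x * ds x ^+ 2 + (2 * e) * (psi x * `|ds x|) + e ^+ 2 * psi x).
  by apply: CcD; [apply: CcD => //; exact: CcZ|exact: CcZ].
apply: (@le_trans _ _ (n.+1%:R ^+ 2 * (a ^+ 2 * (I (fun x => psi x * ds x ^+ 2) + (2 * e) * A + e ^+ 2 * B)))).
  rewrite ler_wpM2l ?exprn_ge0 ?(ltW n0) //.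
  apply: le_trans (I_le cpD (CcZ _ c3) Dle) _.
  rewrite IZ // ID ?IZ //; [|by apply: CcD => //; exact: CcZ|exact: CcZ].
  by rewrite ID ?IZ //; exact: CcZ.
have -> : n.+1%:R ^+ 2 * (a ^+ 2 * (I (fun x => psi x * ds x ^+ 2) + 2 * e * A + e ^+ 2 * B)) =
    c ^+ 2 * I (fun x => psi x * ds x ^+ 2) + e * (c ^+ 2 * (2 * A + e * B)).
  rewrite mulrA -exprMn /a (mulrC n.+1%:R) divfK ?gt_eqF //; ring.
rewrite lerD2l ler_wpM2l ?(ltW e0) // ler_wpM2l ?sqr_ge0 // lerD2l ler_piMl ?(ltW e1) //.
exact: I_ge0.
Qed.

End Horizontal.

(** * Nash and Poincare inequalities *)

Section Tent.
Variables (R : realType) (N : nat).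
Local Notation V := 'rV[R]_N.
Implicit Types (x y : V) (L M : R).

Lemma tent_le L M x y : (`|x| <= L + 2 -> `|y| <= M) -> tent L x <= tent M y.
Proof.
move=> h; have [xL|Lx] := leP `|x| (L + 2); last by rewrite (tent_supp (ltW Lx)) tent_ge0.
by rewrite (le_trans (tent_le1 _ _)) // tent_ge1 // h.
Qed.

Lemma tri_proper (G : V -> V -> V) : continuous (fun tx : V * V => G tx.1 tx.2) ->
  (forall x, triangular (fun t => G t x)) -> forall L, exists2 M, 0 <= M &
  forall t x, `|x| <= L -> `|G t x| <= L -> `|t| <= M.
Proof.
move=> cG tG L.
have H n : exists2 M : R, 0 <= M & forall t x, `|x| <= L -> `|G t x| <= L ->
    forall j : 'I_N, (j < n)%N -> `|t 0 j| <= M.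
  elim: n => [|n [M M0 MP]]; first by exists 0.
  have cK := compact_setX (@compact_box R N M) (@compact_box R N L).
  have cN : continuous (fun z : V * V => `|G z.1 z.2|).
    move=> z; apply: (@continuous_comp _ _ _ (fun z : V * V => G z.1 z.2) (fun y => `|y|)).
      exact: cG.
    exact: norm_continuous.
  have [B B0 BP] := compact_bound cK cN.
  exists (M + (`|L| + B)) => [|t x xL GL j]; first by rewrite !addr_ge0.
  rewrite ltnS leq_eqVlt => /orP[/eqP jn|jn]; last first.
    by apply: le_trans (MP t x xL GL j jn) _; rewrite lerDl addr_ge0.
  pose t' : V := \row_k (if (k < n)%N then t 0 k else 0).
  have t'M : `|t'| <= M.
    by apply/rv_norm_le => // k; rewrite mxE; case: ifP => kn; [exact: (MP t x)|rewrite normr0].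
  have := tG x t t' j => /(_ _)/wrap[k|]; first by rewrite jn => kn; rewrite mxE kn.
  rewrite [t' 0 j]mxE jn ltnn subr0 => E.
  have -> : t 0 j = G t x 0 j - G t' x 0 j by rewrite -E; ring.
  apply: (@le_trans _ _ (`|L| + B)); last by rewrite lerDr.
  apply: le_trans (ler_normB _ _) _; apply: lerD.
    exact: le_trans (coord_le_norm _ _) (le_trans GL (ler_norm _)).
  by apply: le_trans (coord_le_norm _ _) _; have := BP (t', x) (conj t'M xL); rewrite /= ger0_norm.
have [M M0 MP] := H N; exists M => // t x xL GL.
by apply/rv_norm_le => // j; exact: (MP t x).
Qed.

End Tent.

Section Nash.
Variables (R : realType) (N m : nat) (sigma : 'I_N -> nat) (S : flowsys R m sigma).
Hypothesis sigma_gt0 : forall j, (0 < sigma j)%N.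
Local Notation V := 'rV[R]_N.
Local Notation I := (@I R N).
Local Notation F := (fl S).
Local Notation hd := (hd S).
Implicit Types (f g u s phi psi : V -> R) (x y : V) (i : 'I_m) (L M e c r : R) (w : seq ('I_m * R)).

Definition gsq (ds : 'I_m -> V -> R) x := \sum_i ds i x ^+ 2.

Lemma gsq_ge0 ds x : 0 <= gsq ds x.
Proof. by apply: sumr_ge0 => i _; exact: sqr_ge0. Qed.

Lemma cont_gsq s ds : (forall i, hd i s (ds i)) -> continuous (gsq ds).
Proof. by move=> h; apply: cont_sum => i; apply: contX; case: (h i). Qed.

Lemma Cc_gsq u du : (forall i, hd i u (du i)) -> Cc u -> Cc (gsq du).
Proof. by move=> h cu; apply: Cc_sum => i; apply: (@CcX _ _ _ 1); exact: Cc_hd (h i) cu. Qed.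

Lemma le_gsq ds i x : ds i x ^+ 2 <= gsq ds x.
Proof. by rewrite /gsq (bigD1 i) //= lerDl sumr_ge0 // => k _; exact: sqr_ge0. Qed.

Lemma Cc_tgsq s ds M : (forall i, hd i s (ds i)) -> Cc (fun x => tent M x * gsq ds x).
Proof. by move=> h; apply: CcM; [exact: Cc_tent|exact: cont_gsq h]. Qed.

Lemma cont_hd i f g : hd i f g -> continuous f. Proof. by case. Qed.
Lemma cont_hd' i f g : hd i f g -> continuous g. Proof. by case. Qed.

Lemma cont_frun w : continuous (frun F w).
Proof.
elim: w => [|[i c] w IH] /=; first exact: cont_id.
exact: (cont_comp (@cont_fl _ _ _ _ S i c) IH).
Qed.

Lemma word_L2 n r L : exists2 M, 0 <= M & forall w phi s ds (rho : R), (size w <= n)%N ->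
  all (fun ic => `|ic.2| <= rho) w -> rho <= r -> Cc phi -> (forall x, 0 <= phi x) ->
  (forall x, phi x <= tent L x) -> (forall i, hd i s (ds i)) ->
  I (fun x => phi x * (s (frun F w x) - s x) ^+ 2) <=
    4 ^+ n * rho ^+ 2 * I (fun x => tent M x * gsq ds x).
Proof.
have [M1 M10 M1P] := reach S (L + 2) r n; have [M2 M20 M2P] := reach1 S (M1 + 2) r.
exists M2 => // w phi s ds rho sw aw rr cphi phi0 phiL h.
set A := I (fun x => tent M2 x * gsq ds x).
have cA := Cc_tgsq M2 h.
have A0 : 0 <= A by apply: I_ge0 => // x; rewrite mulr_ge0 ?tent_ge0 ?gsq_ge0.
suff H : I (fun x => phi x * (s (frun F w x) - s x) ^+ 2) <= 4 ^+ size w * rho ^+ 2 * A.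
  apply: le_trans H _; rewrite -!(mulrA (4 ^+ _)) ler_wpM2r ?(mulr_ge0 (sqr_ge0 rho) A0) //.
  by rewrite ler_weXn2l // ler1n.
elim: w sw aw => [|[i c] w IH] /= sw aw.
  have -> : (fun x => phi x * (s x - s x) ^+ 2) = fun=> 0.
    by apply/funext => x; rewrite subrr expr0n mulr0.
  by rewrite I0 expr0 mul1r; exact: mulr_ge0 (sqr_ge0 rho) A0.
have [/= cr wr] := andP aw.
have {}IH := IH (ltnW sw) wr.
have cs : continuous s := cont_hd (h i).
have c1 : Cc (fun y => tent M1 y * (s (F i c y) - s y) ^+ 2).
  apply: CcM; first exact: Cc_tent.
  by apply: contX; apply: contB => //; apply: cont_comp => //; exact: cont_fl.
have c2 : Cc (fun x => phi x * (s (frun F w x) - s x) ^+ 2).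
  by apply: CcM => //; apply: contX; apply: contB => //; apply: cont_comp => //; exact: cont_frun.
have c3 := Cc_frun S w c1.
have c4 : Cc (fun x => phi x * (s (F i c (frun F w x)) - s x) ^+ 2).
  apply: CcM => //; apply: contX; apply: contB => //.
  apply: cont_comp => //; exact: (@cont_frun ((i, c) :: w)).
have H1 : I (fun x => tent M1 x * (s (F i c x) - s x) ^+ 2) <= rho ^+ 2 * A.
  have tF a x : `|a| <= `|c| -> tent M1 (F i a x) <= tent M2 x.
    move=> ac; apply: tent_le => Fx.
    rewrite -(flN S i a x); apply: M2P => //.
    by rewrite normrN (le_trans ac) // (le_trans cr).
  have := flow_L2 (h i) (@Cc_tent R N M1) (@Cc_tent R N M2) (@tent_ge0 R N M1) tF.
  move/le_trans; apply.
  apply: ler_pM; rewrite ?sqr_ge0 //.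
  - by apply: I_ge0 => [|x]; [apply: CcM; [exact: Cc_tent|apply: contX; exact: cont_hd' (h i)]|rewrite mulr_ge0 ?tent_ge0 ?sqr_ge0].
  - by rewrite -real_normK ?num_real // lerXn2r ?nnegrE // (le_trans _ cr).
  - apply: I_le => // [|x]; last by rewrite ler_wpM2l ?tent_ge0 ?le_gsq.
    by apply: CcM; [exact: Cc_tent|apply: contX; exact: cont_hd' (h i)].
apply: (@le_trans _ _ (2 * (rho ^+ 2 * A) + 2 * (4 ^+ size w * rho ^+ 2 * A))).
  rewrite -(I_frun S w c1) in H1.
  apply: le_trans (lerD (ler_wpM2l (ler0n _ 2) H1) (ler_wpM2l (ler0n _ 2) IH)).
  rewrite -!IZ // -ID; [|exact: CcZ|exact: CcZ].
  apply: I_le => // [|x]; first by apply: CcD; exact: CcZ.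
  set p := s (F i c _); set q := s (frun F w x).
  have P1 : phi x <= tent M1 (frun F w x).
    by apply: le_trans (phiL x) _; apply: tent_le => xL; apply: M1P; rewrite ?(ltnW sw) ?(sub_all _ wr) // => ic /le_trans; exact.
  apply: (@le_trans _ _ (2 * (phi x * (p - q) ^+ 2) + 2 * (phi x * (q - s x) ^+ 2))); last first.
    by rewrite lerD2r ler_wpM2l // ler_wpM2r // sqr_ge0.
  have -> : 2 * (phi x * (p - q) ^+ 2) + 2 * (phi x * (q - s x) ^+ 2) =
    phi x * (p - s x) ^+ 2 + phi x * (p - q - (q - s x)) ^+ 2 by ring.
  by rewrite lerDl mulr_ge0 // sqr_ge0.
have e1 : 1 <= 4 ^+ size w :> R by rewrite exprn_ege1 // ler1n.
rewrite [4 ^+ (size w).+1]exprS; move: (4 ^+ size w) e1 => a a1; rewrite -subr_ge0.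
have -> : 4 * a * rho ^+ 2 * A - (2 * (rho ^+ 2 * A) + 2 * (a * rho ^+ 2 * A)) =
  2 * (a - 1) * (rho ^+ 2 * A) by ring.
by apply: mulr_ge0 (mulr_ge0 (sqr_ge0 rho) A0); rewrite mulr_ge0 // subr_ge0.
Qed.

Lemma word_L2_Cc n u du w (rho : R) : (forall i, hd i u (du i)) -> Cc u -> (size w <= n)%N ->
  all (fun ic => `|ic.2| <= rho) w ->
  I (fun x => (u (frun F w x) - u x) ^+ 2) <= 4 ^+ n * rho ^+ 2 * I (gsq du).
Proof.
move=> h cu sw aw; have cv := CcB (Cc_frun S w cu) cu; have [L L0 sL] := Cc_supp cv.
have [M M0 MP] := word_L2 n rho L.
have cg : Cc (gsq du) := Cc_gsq h cu.
have -> : (fun x => (u (frun F w x) - u x) ^+ 2) = (fun x => tent L x * (u (frun F w x) - u x) ^+ 2).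
  apply/funext => x; have [xL|Lx] := leP `|x| L; last by rewrite sL // expr0n mulr0.
  by rewrite tent_eq1 ?mul1r // (le_trans xL) // lerDl.
apply: le_trans (MP w (tent L) u du rho sw aw (lexx _) (Cc_tent _ _) (@tent_ge0 _ _ L) _ h) _ => //.
have q0 : 0 <= 4 ^+ n * rho ^+ 2 := mulr_ge0 (exprn_ge0 n (ler0n _ 4)) (sqr_ge0 rho).
rewrite ler_wpM2l //; apply: I_le => // [|x]; first exact: Cc_tgsq h.
by rewrite ler_piMl ?gsq_ge0 ?tent_le1.
Qed.

Lemma jacV r : 0 < r -> jac sigma r^-1 = (jac sigma r)^-1.
Proof. by move=> r0; rewrite /jac -prodfV; apply: eq_bigr => j _; rewrite exprVn. Qed.

Lemma jac_gt0 r : 0 < r -> 0 < jac sigma r.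
Proof. by move=> r0; apply: prodr_gt0 => j _; rewrite exprn_gt0. Qed.

Lemma Cc_dil f r : 0 < r -> Cc f -> Cc (fun x => f (dil sigma r x)).
Proof.
move=> r0 cf; have [L L0 sL] := Cc_supp cf.
apply: (Cc_cont (L := \sum_j (r ^+ sigma j)^-1 * L)) => [|x].
  by apply: cont_comp; [exact: Cc_continuous|exact: cont_dilx].
rewrite ltNge => /negP H; apply: sL; rewrite ltNge; apply/negP => xL; apply: H.
have p0 j : 0 <= (r ^+ sigma j)^-1 * L by rewrite mulr_ge0 // invr_ge0 exprn_ge0 // ltW.
apply/rv_norm_le => [|j]; first by apply: sumr_ge0.
rewrite (bigD1 j) //=; apply: (@le_trans _ _ ((r ^+ sigma j)^-1 * L)); last first.
  by rewrite lerDl sumr_ge0.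
have := le_trans (coord_le_norm _ j) xL.
by rewrite dilE normrM gtr0_norm ?exprn_gt0 // ler_pdivlMl ?exprn_gt0.
Qed.

Lemma I_tent_gt0 L : 0 <= L -> 0 < I (tent L).
Proof.
move=> L0; apply: (I_gt0 (x := 0)); [exact: Cc_tent|exact: tent_ge0|].
by rewrite tent_eq1 // normr0 addr_ge0.
Qed.

Local Notation G t x := (frun F (traj S t) x).

Lemma Cc_path x f : Cc f -> Cc (fun t => f (G t x)).
Proof.
move=> cf; have [L L0 sL] := Cc_supp cf.
have [M M0 MP] := tri_proper (@traj_cont _ _ _ _ S) (traj_tri S) (Num.max L `|x|).
apply: (Cc_cont (L := M)) => [|t Mt].
  apply: (cont_comp (f := f) (Cc_continuous cf)).
  apply: (@cont_comp _ _ _ (fun z : V * V => G z.1 z.2) (fun t : V => (t, x))).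
    exact: traj_cont.
  exact: (@cont_pair _ _ _ id (fun _ => x)) (@cont_id _) (@cst_continuous _ _ x).
apply: sL; rewrite ltNge; apply/negP => H; have := MP t x.
by rewrite !le_max lexx H orbT => /(_ isT isT); rewrite leNgt Mt.
Qed.

(* Average [u (u - u o G_t) + u (u o G_t)] over a bump in [t] dilated by [r]: the first term is controlled by [word_L2_Cc], the second by the L1 norm because [t |-> G_t x] preserves the integral. *)
Lemma nash : exists2 C, 0 <= C & forall u du r, (forall i, hd i u (du i)) -> Cc u -> 0 < r ->
  I (fun x => u x ^+ 2) <=
    C * ((jac sigma r)^-1 * I (fun x => `|u x|) ^+ 2 + r ^+ 2 * I (gsq du)).
Proof.
have [n [C [C0 PP]]] := traj_lin S.
pose c0 := I (tent 0); have c00 : 0 < c0 := I_tent_gt0 (lexx 0).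
exists (2 / c0 + 4 ^+ n * (2 * C) ^+ 2) => [|u du r h cu r0].
  by rewrite addr_ge0 ?divr_ge0 ?(ltW c00) // mulr_ge0 ?exprn_ge0 ?mulr_ge0.
have cg : Cc (gsq du) := Cc_gsq h cu.
set D := I (gsq du); have D0 : 0 <= D by apply: I_ge0 => // x; exact: gsq_ge0.
pose rho (t : V) := tent 0 (dil sigma r^-1 t) : R.
have rV0 : 0 < r^-1 by rewrite invr_gt0.
have crho : Cc rho by apply: Cc_dil => //; exact: Cc_tent.
have Irho : I rho = jac sigma r * c0.
  by rewrite /rho I_dil //; [rewrite jacV // invrK|exact: Cc_tent].
have j0 := jac_gt0 r0.
have cau := Cc_abs cu; have cont_u := Cc_continuous cu.
pose K := 4 ^+ n * (C * (2 * r)) ^+ 2 * D.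
pose g x t := `|u x| * (rho t * `|u (G t x)|).
have cG : continuous (fun z : V * V => G z.2 z.1).
  apply: (@cont_comp _ _ _ (fun z : V * V => G z.1 z.2) (fun z : V * V => (z.2, z.1))).
    exact: traj_cont.
  by apply: cont_pair; [exact: cont_snd|exact: cont_fst].
have cg2 : continuous (fun z : V * V => g z.1 z.2).
  apply: contM; first by apply: cont_norm; apply: cont_comp => //; exact: cont_fst.
  apply: contM; first by apply: cont_comp; [exact: Cc_continuous|exact: cont_snd].
  by apply: cont_norm; apply: cont_comp cG.
have [L1 L10 s1] := Cc_supp cu; have [L2 L20 s2] := Cc_supp crho.
have gx x t : Num.max L1 L2 < `|x| -> g x t = 0.
  by rewrite gt_max /g => /andP[/s1 -> _]; rewrite normr0 mul0r.
have gt x t : Num.max L1 L2 < `|t| -> g x t = 0.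
  by rewrite gt_max /g => /andP[_ /s2 ->]; rewrite mul0r mulr0.
have [F1 F2 F3] := Fubini_Cc cg2 gx gt.
have u2 : Cc (fun x => u x ^+ 2) by exact: (@CcX _ _ _ 1).
have key t : rho t * I (fun x => u x ^+ 2) <= K * rho t + 2 * I (fun x => g x t).
  have [tL|Lt] := leP `|dil sigma r^-1 t| 2; last first.
    have r00 : rho t = 0 by apply: tent_supp; rewrite add0r ltW.
    have -> : (fun x => g x t) = fun=> 0 by apply/funext => x; rewrite /g r00 mul0r mulr0.
    by rewrite r00 I0 mul0r !mulr0 addr0.
  have rr : 0 <= 2 * r by rewrite mulr_ge0 // ltW.
  have tj j : `|t 0 j| <= (2 * r) ^+ sigma j.
    have := le_trans (coord_le_norm _ j) tL.
    rewrite dilE normrM exprVn gtr0_norm ?invr_gt0 ?exprn_gt0 // ler_pdivrMl ?exprn_gt0 // => H.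
    rewrite (le_trans H) // exprMn mulrC ler_wpM2r ?exprn_ge0 ?(ltW r0) //.
    by rewrite -[X in X <= _]expr1 ler_weXn2l // ?sigma_gt0 // ler1n.
  have [sp ap] := PP t (2 * r) rr tj.
  have W := word_L2_Cc h cu sp ap; rewrite -/D -/K in W.
  have cw := Cc_frun S (traj S t) cu.
  have c1 : Cc (fun x => (u (G t x) - u x) ^+ 2) by apply: (@CcX _ _ _ 1); exact: CcB.
  have c2 : Cc (fun x => `|u x| * `|u (G t x)|).
    by apply: CcM; [exact: Cc_abs|apply: cont_norm; exact: Cc_continuous].
  have B : I (fun x => u x ^+ 2) <= K + 2 * I (fun x => `|u x| * `|u (G t x)|).
    apply: le_trans (lerD W (lexx _)); rewrite -IZ // -ID //; last exact: CcZ.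
    apply: I_le => // [|x]; first by apply: CcD => //; exact: CcZ.
    move: (u (G t x)) (u x) => a b; rewrite -normrM.
    have := ler_norm (b * a); have -> : (a - b) ^+ 2 = a ^+ 2 - 2 * (b * a) + b ^+ 2 by ring.
    by have := sqr_ge0 a; move: `|b * a| (b * a) (a ^+ 2) (b ^+ 2) => p q a2 b2; lra.
  have -> : (fun x => g x t) = (fun x => rho t * (`|u x| * `|u (G t x)|)).
    by apply/funext => x; rewrite /g mulrCA.
  have := ler_wpM2l (tent_ge0 0 (dil sigma r^-1 t)) B; rewrite -/(rho t) mulrDr (mulrC _ K).
  by rewrite (mulrCA (rho t) 2) -(IZ (rho t) c2).
have IG : I (fun t => I (fun x => g x t)) <= I (fun x => `|u x|) ^+ 2.
  rewrite -F3 expr2 -IZ //; apply: I_le => // [|x]; first exact: CcZ.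
  have ct := Cc_path x cau.
  have ct2 : Cc (fun t => rho t * `|u (G t x)|).
    by apply: CcMl => //; exact: Cc_continuous.
  rewrite /g IZ // mulrC ler_wpM2r //.
  apply: (@le_trans _ _ (I (fun t => `|u (G t x)|))).
    by apply: I_le => // t; rewrite ler_piMl // tent_le1.
  by rewrite (I_tri (f := fun y => `|u y|)) //; exact: traj_tri.
have fin : jac sigma r * c0 * I (fun x => u x ^+ 2) <= jac sigma r * c0 * K + 2 * I (fun x => `|u x|) ^+ 2.
  apply: (@le_trans _ _ (I (fun t => K * rho t + 2 * I (fun x => g x t)))).
    rewrite -Irho mulrC -IZ //; apply: I_le => [||t]; [exact: CcZ|by apply: CcD; exact: CcZ|].
    by rewrite mulrC.
  rewrite ID ?IZ //; [|exact: CcZ|exact: CcZ].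
  by rewrite Irho mulrC lerD2l ler_wpM2l.
have J0 : 0 < jac sigma r * c0 by rewrite mulr_gt0.
have fin2 : I (fun x => u x ^+ 2) <= K + 2 * I (fun x => `|u x|) ^+ 2 / (jac sigma r * c0).
  rewrite -(ler_pM2l J0) mulrDr.
  have -> : jac sigma r * c0 * (2 * I (fun x => `|u x|) ^+ 2 / (jac sigma r * c0)) = 2 * I (fun x => `|u x|) ^+ 2.
    by field; rewrite !gt_eqF.
  by [].
apply: le_trans fin2 _; rewrite -subr_ge0.
set A := I (fun x => `|u x|); set J := jac sigma r in j0 J0 *; rewrite /K.
have -> : (2 / c0 + 4 ^+ n * (2 * C) ^+ 2) * (J^-1 * A ^+ 2 + r ^+ 2 * D) -
    (4 ^+ n * (C * (2 * r)) ^+ 2 * D + 2 * A ^+ 2 / (J * c0)) =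
    (2 / c0) * (r ^+ 2 * D) + (4 ^+ n * (2 * C) ^+ 2) * (J^-1 * A ^+ 2).
  by field; rewrite !gt_eqF.
by rewrite addr_ge0 ?mulr_ge0 ?exprn_ge0 ?invr_ge0 ?(ltW c00) ?(ltW r0) ?(ltW j0) ?mulr_ge0 // I_ge0.
Qed.

Lemma poincare L : exists C M, 0 <= C /\ forall s ds phi1 phi2, continuous s ->
  (forall i, hd i s (ds i)) ->
  Cc phi1 -> Cc phi2 -> (forall x, 0 <= phi1 x <= tent L x) -> (forall x, 0 <= phi2 x <= tent L x) ->
  I phi2 * I (fun x => phi1 x * s x ^+ 2) - 2 * (I (fun x => phi1 x * s x) * I (fun x => phi2 x * s x))
    + I phi1 * I (fun x => phi2 x * s x ^+ 2) <= C * I (fun x => tent M x * gsq ds x).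
Proof.
have [n [C [C0 PP]]] := traj_lin S.
have [T T0 TP] := tri_proper (@traj_cont _ _ _ _ S) (traj_tri S) (L + 2).
have [M M0 MP] := word_L2 n (C * (T + 1)) L.
exists (4 ^+ n * (C * (T + 1)) ^+ 2 * I (tent T)), M; split.
  by rewrite !mulr_ge0 ?exprn_ge0 ?mulr_ge0 ?addr_ge0 //; exact: ltW (I_tent_gt0 T0).
move=> s ds phi1 phi2 cs h c1 c2 p1 p2.
set D := I (fun x => tent M x * gsq ds x).
have D0 : 0 <= D.
  by apply: I_ge0 => [|x]; [apply: CcM; [exact: Cc_tent|apply: cont_sum => i; apply: contX; exact: cont_hd' (h i)]|rewrite mulr_ge0 ?tent_ge0 ?gsq_ge0].
have c1s := CcM c1 cs; have c2s := CcM c2 cs.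
have c1s2 : Cc (fun x => phi1 x * s x ^+ 2) by apply: CcM => //; exact: contX.
have c2s2 : Cc (fun x => phi2 x * s x ^+ 2) by apply: CcM => //; exact: contX.
have p10 x : 0 <= phi1 x by case/andP: (p1 x).
have p1t x : phi1 x <= tent L x by case/andP: (p1 x).
have p20 x : 0 <= phi2 x by case/andP: (p2 x).
have p2t x : phi2 x <= tent L x by case/andP: (p2 x).
have p10' x : L + 2 < `|x| -> phi1 x = 0.
  by move=> /ltW Lx; apply/eqP; rewrite eq_le p10 andbT -(tent_supp Lx).
have p20' x : L + 2 < `|x| -> phi2 x = 0.
  by move=> /ltW Lx; apply/eqP; rewrite eq_le p20 andbT -(tent_supp Lx).
pose g x t := phi1 x * (phi2 (G t x) * (s (G t x) - s x) ^+ 2).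
have cin x : Cc (fun y => phi2 y * (s y - s x) ^+ 2).
  by apply: CcM => //; apply: contX; apply: contB => //; exact: contC.
have inner x : I (g x) = phi1 x * (I (fun y => phi2 y * s y ^+ 2) - 2 * s x * I (fun y => phi2 y * s y) + s x ^+ 2 * I phi2).
  rewrite /g IZ; last exact: (Cc_path x (cin x)).
  congr (_ * _).
  rewrite (I_tri (f := fun y => phi2 y * (s y - s x) ^+ 2)) //; last exact: traj_tri.
  rewrite -!IZ // -IB //; last exact: CcZ.
  rewrite -ID; [|by apply: CcB => //; exact: CcZ|exact: CcZ].
  by congr I; apply/funext => y; ring.
have -> : I phi2 * I (fun x => phi1 x * s x ^+ 2) -
    2 * (I (fun x => phi1 x * s x) * I (fun x => phi2 x * s x)) +
    I phi1 * I (fun x => phi2 x * s x ^+ 2) = I (fun x => I (g x)).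
  under [in RHS]eq_fun do rewrite inner.
  set a := I (fun y => phi2 y * s y ^+ 2); set b := I (fun y => phi2 y * s y); set c := I phi2.
  have -> : (fun x => phi1 x * (a - 2 * s x * b + s x ^+ 2 * c)) =
      (fun x => a * phi1 x - 2 * b * (phi1 x * s x) + c * (phi1 x * s x ^+ 2)).
    by apply/funext => x; ring.
  rewrite ID; [|by apply: CcB; exact: CcZ|exact: CcZ].
  rewrite IB; [|exact: CcZ|exact: CcZ].
  by rewrite !IZ //; ring.
have cG : continuous (fun z : V * V => G z.2 z.1).
  apply: (@cont_comp _ _ _ (fun z : V * V => G z.1 z.2) (fun z : V * V => (z.2, z.1))).
    exact: traj_cont.
  by apply: cont_pair; [exact: cont_snd|exact: cont_fst].
have cgg : continuous (fun z : V * V => g z.1 z.2).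
  apply: contM; first by apply: cont_comp; [exact: Cc_continuous|exact: cont_fst].
  apply: contM; first by apply: cont_comp cG; exact: Cc_continuous.
  apply: contX; apply: contB; first exact: cont_comp cG.
  by apply: cont_comp => //; exact: cont_fst.
have g0 x t : T < `|t| -> g x t = 0.
  move=> Tt; rewrite /g; have [xL|/p10' ->] := leP `|x| (L + 2); last by rewrite mul0r.
  have [GL|/p20' ->] := leP `|G t x| (L + 2); last by rewrite mul0r mulr0.
  by have := TP t x xL GL; rewrite leNgt Tt.
have g1 x t : Num.max T (L + 2) < `|x| -> g x t = 0.
  by rewrite gt_max /g => /andP[_ /p10' ->]; rewrite mul0r.
have g2 x t : Num.max T (L + 2) < `|t| -> g x t = 0.
  by rewrite gt_max => /andP[/g0 ->].
have [F1 F2 ->] := Fubini_Cc cgg g1 g2.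
set K := 4 ^+ n * (C * (T + 1)) ^+ 2.
rewrite mulrAC -IZ; last exact: Cc_tent.
have K0 : 0 <= K by rewrite /K mulr_ge0 ?exprn_ge0 ?mulr_ge0 ?addr_ge0.
apply: I_le => // [|t]; first by apply: CcZ; exact: Cc_tent.
have [tT|Tt] := leP `|t| T; last first.
  have -> : (fun x => g x t) = fun=> 0 by apply/funext => x; rewrite g0.
  by rewrite I0; exact: mulr_ge0 (mulr_ge0 K0 D0) (tent_ge0 _ _).
rewrite tent_eq1 ?mulr1; last by rewrite (le_trans tT) // lerDl.
have tj j : `|t 0 j| <= (T + 1) ^+ sigma j.
  apply: (le_trans (coord_le_norm t j)); apply: (le_trans tT).
  apply: (@le_trans _ _ (T + 1)); first by rewrite lerDl.
  by rewrite -[X in X <= _]expr1 ler_weXn2l // ?sigma_gt0 // lerDr.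
have [sp ap] := PP t (T + 1) (addr_ge0 T0 ler01) tj.
have cv : Cc (fun x => phi1 x * (s (G t x) - s x) ^+ 2).
  by apply: CcM => //; apply: contX; apply: contB => //; apply: cont_comp => //; exact: cont_frun.
apply: le_trans (MP (traj S t) phi1 s ds _ sp ap (lexx _) c1 p10 p1t h).
apply: I_le => // [|x].
  have -> : (fun x => g x t) = (fun x => phi1 x * (s (G t x) - s x) ^+ 2 * phi2 (G t x)).
    by apply/funext => x; rewrite /g; ring.
  by apply: CcM => //; apply: cont_comp; [exact: Cc_continuous|exact: cont_frun].
rewrite /g mulrCA ler_piMl ?(mulr_ge0 (p10 x) (sqr_ge0 _)) //.
exact: le_trans (p2t _) (tent_le1 _ _).
Qed.

End Nash.

(** * Moser iteration *)

Section Sequences.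
Variable R : realType.

Lemma pow_small (t : R) (k : nat) : 0 <= t -> t <= 1 -> k%:R * (1 - t) * t ^+ k <= 1.
Proof.
move=> t0 t1; suff : k%:R * (1 - t) * t ^+ k <= 1 - t ^+ k.
  by move/le_trans; apply; rewrite gerBl exprn_ge0.
elim: k => [|k IH]; first by rewrite !mul0r expr0 subrr.
have p1 : t ^+ k.+1 <= 1 by exact: exprn_ile1.
have p0 : 0 <= t ^+ k.+1 by exact: exprn_ge0.
have H := ler_wpM2l t0 IH; have H2 := ler_wpM2l (_ : 0 <= 1 - t) p1; rewrite subr_ge0 mulr1 in H2.
have {}H2 := H2 t1; rewrite mulrSr.
have -> : (k%:R + 1) * (1 - t) * t ^+ k.+1 = t * (k%:R * (1 - t) * t ^+ k) + (1 - t) * t ^+ k.+1.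
  by rewrite exprS; ring.
apply: le_trans (lerD H H2) _; rewrite mulrBr mulr1 -exprS.
by move: (t ^+ k.+1) => a; lra.
Qed.

Lemma pow_lt (t e : R) : 0 <= t -> t < 1 -> 0 < e -> exists n, forall k, (n <= k)%N -> t ^+ k < e.
Proof.
move=> t0 t1 e0; have t1' : 0 < 1 - t by rewrite subr_gt0.
have [n nP] : exists n : nat, ((1 - t) * e)^-1 < n%:R.
  by exists (Num.bound ((1 - t) * e)^-1); rewrite archi_boundP // invr_ge0 ltW ?mulr_gt0.
exists n => k nk; rewrite ltNge; apply/negP => H.
have k0 : ((1 - t) * e)^-1 < k%:R by rewrite (lt_le_trans nP) // ler_nat.
have := pow_small k t0 (ltW t1); apply/negP; rewrite -ltNge.
apply: (@lt_le_trans _ _ (k%:R * (1 - t) * e)); last by rewrite ler_wpM2l // mulr_ge0 // ltW.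
by rewrite -mulrA -ltr_pdivrMr ?mulr_gt0 // mul1r.
Qed.

Lemma le_geo (a b B : R) : 0 <= B -> (forall n : nat, a <= b + 2^-1 ^+ n * B) -> a <= b.
Proof.
move=> B0 H; apply: (le_epsM (M := B)) => e e0 _.
have [] := @pow_lt 2^-1 e _ _ e0; rewrite ?invr_ge0 //; first by lra.
move=> n /(_ n (leqnn _)) /ltW nP; apply: le_trans (H n) _.
by rewrite lerD2l ler_wpM2r.
Qed.

Lemma quad_iter (a : nat -> R) (C l : R) : 1 <= C -> 1 <= l -> (forall n, 0 <= a n) ->
  (forall n, a n.+1 <= C * l ^+ n * a n ^+ 2) -> forall n, a n <= (C * l * a 0%N) ^+ (2 ^ n).
Proof.
move=> C1 l1 a0 H n.
have C0 : 0 <= C := le_trans ler01 C1; have l0 : 0 <= l := le_trans ler01 l1.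
have lb k : 1 <= C * l ^+ k by rewrite -[1]mulr1 ler_pM // exprn_ege1.
suff K : C * l ^+ n.+1 * a n <= (C * l * a 0%N) ^+ (2 ^ n).
  by apply: le_trans K; rewrite ler_peMl.
elim: n => [|n IH]; first by rewrite expr1.
apply: (@le_trans _ _ (C * l ^+ n.+2 * (C * l ^+ n * a n ^+ 2))).
  by rewrite ler_wpM2l // mulr_ge0 // exprn_ge0.
have -> : C * l ^+ n.+2 * (C * l ^+ n * a n ^+ 2) = (C * l ^+ n.+1 * a n) ^+ 2.
  by rewrite !exprS; ring.
rewrite expnS mulnC exprM lerXn2r // nnegrE; first by rewrite !mulr_ge0 // exprn_ge0.
by rewrite exprn_ge0 // !mulr_ge0.
Qed.

End Sequences.

Section Caccioppoli.
Variables (R : realType) (N m : nat) (sigma : 'I_N -> nat) (S : flowsys R m sigma).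
Local Notation V := 'rV[R]_N.
Local Notation I := (@I R N).
Local Notation hd := (hd S).
Implicit Types (f u phi psi w : V -> R) (g dphi dpsi dw : 'I_m -> V -> R) (x y : V) (i : 'I_m).

(* [f] weakly satisfies [L f = - |X f|^2], so that [exp f] is [L]-harmonic. *)
Definition sol f g := [/\ continuous f, forall i, hd i f (g i) &
  forall psi dpsi, Cc psi -> (forall i, hd i psi (dpsi i)) ->
    I (fun x => psi x * gsq g x) = I (fun x => \sum_i dpsi i x * g i x)].

Lemma caccioppoli f g (b b' : R -> R) k phi dphi : sol f g ->
  continuous b -> continuous b' -> (forall y : R, is_derive y 1 b (b' y)) -> (forall y : R, 0 < b y) -> 0 < k ->
  (forall y : R, k * b y <= b y - b' y) \/ (forall y : R, k * b y <= b' y - b y) ->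
  Cc phi -> (forall i, hd i phi (dphi i)) ->
  I (fun x => phi x ^+ 2 * (b (f x) * gsq g x)) <= 4 / k ^+ 2 * I (fun x => b (f x) * gsq dphi x).
Proof.
move=> [cf hf weak] cb cb' db b0 k0 kb cp hp.
have cbf : continuous (fun x => b (f x)) by exact: cont_comp.
have cbf' : continuous (fun x => b' (f x)) by exact: cont_comp.
have cg : continuous (gsq g) := cont_gsq hf.
have cdp : Cc (gsq dphi) := Cc_gsq hp cp.
have cp2 : Cc (fun x => phi x ^+ 2) by exact: (@CcX _ _ _ 1).
have cA : Cc (fun x => phi x ^+ 2 * (b (f x) * gsq g x)) by apply: CcM => //; exact: contM.
have cA' : Cc (fun x => phi x ^+ 2 * (b' (f x) * gsq g x)) by apply: CcM => //; exact: contM.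
have cB : Cc (fun x => b (f x) * gsq dphi x) by exact: CcMl.
have cX : Cc (fun x => phi x * (b (f x) * (2 * \sum_i dphi i x * g i x))).
  apply: CcM => //; apply: contM => //; apply: contM; first exact: contC.
  by apply: cont_sum => i; apply: contM; [exact: cont_hd' (hp i)|exact: cont_hd' (hf i)].
have cpsi : Cc (fun x => phi x * phi x * b (f x)) by apply: CcM => //; apply: CcM => //; exact: Cc_continuous.
have := weak _ _ cpsi (fun i => hdM (hdM (hp i) (hp i)) (hd_comp cb' db (hf i))).
have -> : (fun x => phi x * phi x * b (f x) * gsq g x) = (fun x => phi x ^+ 2 * (b (f x) * gsq g x)).
  by apply/funext => x; ring.
have -> : (fun x => \sum_i ((dphi i x * phi x + phi x * dphi i x) * b (f x) +
   phi x * phi x * (b' (f x) * g i x)) * g i x) =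
   (fun x => phi x * (b (f x) * (2 * \sum_i dphi i x * g i x)) + phi x ^+ 2 * (b' (f x) * gsq g x)).
  apply/funext => x; rewrite /gsq !mulr_sumr -big_split /=; apply: eq_bigr => i _; ring.
rewrite ID //; set A := I (fun x => phi x ^+ 2 * (b (f x) * _)); set A' := I (fun x => phi x ^+ 2 * (b' _ * _)).
set X := I (fun x => phi x * _) => E; set B := I (fun x => b (f x) * _).
have HX : `|X| <= k / 2 * A + 2 / k * B.
  rewrite -!IZ // -ID; [|exact: CcZ|exact: CcZ].
  rewrite -[I (fun x => k / 2 * _ + _)]mul1r; apply: I_absle => // [|x]; first by apply: CcD; exact: CcZ.
  rewrite mul1r.
  have -> : phi x * (b (f x) * (2 * \sum_i dphi i x * g i x)) =
    b (f x) * \sum_i 2 * phi x * dphi i x * g i x.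
    by rewrite !mulr_sumr; apply: eq_bigr => i _; ring.
  have -> : k / 2 * (phi x ^+ 2 * (b (f x) * gsq g x)) + 2 / k * (b (f x) * gsq dphi x) =
    b (f x) * \sum_i (k / 2 * (phi x ^+ 2 * g i x ^+ 2) + 2 / k * dphi i x ^+ 2).
    by rewrite /gsq big_split /= -!mulr_sumr; ring.
  rewrite normrM (gtr0_norm (b0 _)) ler_wpM2l ?(ltW (b0 _)) //.
  apply: le_trans (ler_norm_sum _ _ _) _; apply: ler_sum => i _.
  rewrite ler_norml -subr_ge0 opprK -[X in _ && X]subr_ge0.
  have nk : k != 0 by rewrite gt_eqF.
  have -> : 2 * phi x * dphi i x * g i x + (k / 2 * (phi x ^+ 2 * g i x ^+ 2) + 2 / k * dphi i x ^+ 2) =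
    k / 2 * (phi x * g i x + 2 / k * dphi i x) ^+ 2 by field.
  have -> : (k / 2 * (phi x ^+ 2 * g i x ^+ 2) + 2 / k * dphi i x ^+ 2) - 2 * phi x * dphi i x * g i x =
    k / 2 * (phi x * g i x - 2 / k * dphi i x) ^+ 2 by field.
  have k2 : 0 <= k / 2 by rewrite divr_ge0 // ltW.
  by rewrite !(mulr_ge0 k2) ?sqr_ge0.
have KA : k * A <= `|X|.
  have EX : X = A - A' by rewrite E addrK.
  case: kb => kb.
    apply: le_trans (ler_norm _); rewrite EX -IZ // -IB //; apply: I_le => // [||x]; [exact: CcZ|exact: CcB|].
    have := ler_wpM2r (mulr_ge0 (sqr_ge0 (phi x)) (gsq_ge0 g x)) (kb (f x)).
    by congr (_ <= _); ring.
  rewrite -normrN; apply: le_trans (ler_norm _); rewrite EX opprB -IZ // -IB //.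
  apply: I_le => // [||x]; [exact: CcZ|exact: CcB|].
  have := ler_wpM2r (mulr_ge0 (sqr_ge0 (phi x)) (gsq_ge0 g x)) (kb (f x)).
  by congr (_ <= _); ring.
have H : k / 2 * A <= 2 / k * B.
  have E2 : k * A = k / 2 * A + k / 2 * A by field.
  by have := le_trans KA HX; rewrite E2 lerD2l.
have k2 : 0 < k / 2 by rewrite divr_gt0.
rewrite -(ler_pM2l k2); apply: le_trans H _.
by rewrite le_eqVlt; apply/orP; left; apply/eqP; field; rewrite gt_eqF.
Qed.

Definition qd x : R := \sum_j x 0 j ^+ 2.

Lemma qd_ge0 x : 0 <= qd x.
Proof. by apply: sumr_ge0 => j _; exact: sqr_ge0. Qed.

Lemma norm_qd x : `|x| <= 1 + qd x.
Proof.
apply/rv_norm_le => [|j]; first by rewrite addr_ge0 ?qd_ge0.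
apply: (@le_trans _ _ (1 + x 0 j ^+ 2)); last first.
  by rewrite lerD2l /qd (bigD1 j) //= lerDl sumr_ge0 // => k _; exact: sqr_ge0.
have := sqr_ge0 (`|x 0 j| - 1); rewrite -[x 0 j ^+ 2]real_normK ?num_real //.
move: (normr_ge0 (x 0 j)); move: `|x 0 j| => a a0; have -> : (a - 1) ^+ 2 = a ^+ 2 - 2 * a + 1 by ring.
by lra.
Qed.

Lemma qd_norm x (L : R) : `|x| <= L -> qd x <= N%:R * L ^+ 2.
Proof.
move=> xL; rewrite mulr_natl -[X in _ *+ X]card_ord -sumr_const; apply: ler_sum => j _.
rewrite -real_normK ?num_real // lerXn2r ?nnegrE //; first exact: le_trans xL.
exact: le_trans (coord_le_norm _ _) xL.
Qed.

Lemma cont_qd : continuous qd.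
Proof. by apply: cont_sum => j; apply: contX; exact: cont_coord. Qed.

Lemma hd_qd : exists dq : 'I_m -> V -> R, forall i, hd i qd (dq i).
Proof.
have /choice [gg ggP] : forall ij : 'I_m * 'I_N, exists g : V -> R, hd ij.1 (fun x => x 0 ij.2) g.
  move=> [i j] /=; have [g [cg dg]] := fl_coord S i j; exists g; split=> //; exact: cont_coord.
exists (fun i x => \sum_j (gg (i, j) x * x 0 j + x 0 j * gg (i, j) x)) => i.
rewrite /qd; apply: hd_sum => j; have := hdM (ggP (i, j)) (ggP (i, j)).
by rewrite (_ : (fun x => x 0 j * x 0 j) = fun x => x 0 j ^+ 2) //; apply/funext => x; rewrite expr2.
Qed.

Definition pos2 (z : R) : R := Num.max z 0 ^+ 2.

Lemma pos2_der (z : R) : is_derive z 1 pos2 (2 * Num.max z 0).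
Proof.
apply/der_epsP => e e0; exists e => // h he.
apply: (@le_trans _ _ (`|h| * `|h|)); last by rewrite ler_wpM2r // ltW.
rewrite -normrM /pos2.
have [z0|z0] := leP z 0; have [zh|zh] := leP (z + h) 0.
- by rewrite expr0n /= mulr0 mulr0 !subr0 normr0.
- rewrite expr0n /= mulr0 mulr0 !subr0 !ger0_norm ?sqr_ge0 -?expr2 ?sqr_ge0 //.
  by rewrite lerXn2r ?nnegrE ?(ltW zh) //; lra.
- rewrite expr0n /= sub0r -opprD normrN.
  have -> : z ^+ 2 + h * (2 * z) = (z + h) ^+ 2 - h * h by ring.
  rewrite distrC -expr2 !ger0_norm ?sqr_ge0 ?gerBl ?sqr_ge0 // subr_ge0.
  by rewrite -(sqrrN h) -(sqrrN (z + h)) lerXn2r ?nnegrE; lra.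
- have -> : (z + h) ^+ 2 - z ^+ 2 - h * (2 * z) = h * h by ring.
  by [].
Qed.

Lemma max0_cont : continuous (fun z : R => Num.max z 0).
Proof. by apply: cont_max0; exact: cont_id. Qed.

Definition cutoff (a b : R) x := pos2 ((b - qd x) / (b - a)).
Definition dcutoff (dq : 'I_m -> V -> R) (a b : R) i x :=
  2 * Num.max ((b - qd x) / (b - a)) 0 * (- (b - a)^-1 * dq i x).

Section Cutoff.
Variables (dq : 'I_m -> V -> R) (a b : R).
Hypotheses (hq : forall i, hd i qd (dq i)) (ab : a < b).
Let ba : 0 < b - a. Proof. by rewrite subr_gt0. Qed.

Lemma hd_cutoff i : hd i (cutoff a b) (dcutoff dq a b i).
Proof.
have c2 : continuous (fun z : R => 2 * Num.max z 0).
  by apply: contM; [exact: contC|exact: max0_cont].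
apply: (hd_comp (b := pos2) c2 pos2_der (f := fun x => (b - qd x) / (b - a))).
have := hdZ (b - a)^-1 (hdD (hdC S i b) (hdZ (-1) (hq i))).
rewrite (_ : (fun x => (b - a)^-1 * (b + -1 * qd x)) = (fun x => (b - qd x) / (b - a))).
  rewrite (_ : (fun x => (b - a)^-1 * (0 + -1 * dq i x)) = (fun x => - (b - a)^-1 * dq i x)) //.
  by apply/funext => x; ring.
by apply/funext => x; ring.
Qed.

Lemma cutoff_ge0 x : 0 <= cutoff a b x. Proof. exact: sqr_ge0. Qed.

Lemma cutoff_ge1 x : qd x <= a -> 1 <= cutoff a b x.
Proof.
move=> xa; have H : 1 <= (b - qd x) / (b - a) by rewrite ler_pdivlMr // mul1r lerD2l lerN2.
by rewrite /cutoff /pos2 max_l ?exprn_ege1 // (le_trans _ H).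
Qed.

Lemma cutoff_arg x : b <= qd x -> Num.max ((b - qd x) / (b - a)) 0 = 0.
Proof. by move=> bx; rewrite max_r // mulr_le0_ge0 ?invr_ge0 ?(ltW ba) // subr_le0. Qed.

Lemma cutoff_eq0 x : b <= qd x -> cutoff a b x = 0.
Proof. by move=> bx; rewrite /cutoff /pos2 cutoff_arg // expr0n. Qed.

Lemma Cc_cutoff : Cc (cutoff a b).
Proof.
apply: (Cc_cont (L := 1 + b)) => [|x bx].
  apply: (cont_comp (f := pos2)); first by move=> z; exact: der_cont (pos2_der z).
  by apply: contM; [apply: contB; [exact: contC|exact: cont_qd]|exact: contC].
by apply: cutoff_eq0; have := lt_le_trans bx (norm_qd x); rewrite ltrD2l => /ltW.
Qed.

Hypothesis b0 : 0 <= b.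

Lemma cutoff_argle x : Num.max ((b - qd x) / (b - a)) 0 <= b / (b - a).
Proof.
by rewrite ge_max mulr_ge0 ?invr_ge0 ?(ltW ba) // andbT ler_pM2r ?invr_gt0 // gerBl qd_ge0.
Qed.

Lemma cutoff_le x : cutoff a b x <= (b / (b - a)) ^+ 2.
Proof.
by rewrite lerXn2r ?nnegrE ?cutoff_argle ?mulr_ge0 ?invr_ge0 ?(ltW ba) // le_max lexx orbT.
Qed.

Lemma gsq_dcutoff x : gsq (dcutoff dq a b) x <= 4 * b ^+ 2 / (b - a) ^+ 4 * gsq dq x.
Proof.
rewrite /gsq mulr_sumr; apply: ler_sum => i _; rewrite /dcutoff.
set z := Num.max _ _.
have z0 : 0 <= z by rewrite le_max lexx orbT.
have zz : z ^+ 2 <= (b / (b - a)) ^+ 2 := cutoff_le x.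
have -> : (2 * z * (- (b - a)^-1 * dq i x)) ^+ 2 = z ^+ 2 * (4 / (b - a) ^+ 2 * dq i x ^+ 2).
  by field; rewrite gt_eqF.
have -> : 4 * b ^+ 2 / (b - a) ^+ 4 * dq i x ^+ 2 = (b / (b - a)) ^+ 2 * (4 / (b - a) ^+ 2 * dq i x ^+ 2).
  by field; rewrite gt_eqF.
by rewrite ler_wpM2r // mulr_ge0 ?sqr_ge0 // divr_ge0 ?sqr_ge0.
Qed.

Lemma gsq_dcutoff0 x : b <= qd x -> gsq (dcutoff dq a b) x = 0.
Proof. by move=> bx; rewrite /gsq big1 // => i _; rewrite /dcutoff cutoff_arg // mulr0 mul0r expr0n. Qed.

Definition chi x : R := Num.max (1 - Num.max ((qd x - a) / (b - a)) 0) 0.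

Lemma chi_ge0 x : 0 <= chi x. Proof. by rewrite le_max lexx orbT. Qed.

Lemma chi_le1 x : chi x <= 1.
Proof. by rewrite ge_max ler01 andbT gerBl le_max lexx orbT. Qed.

Lemma chi_eq1 x : qd x <= a -> chi x = 1.
Proof.
move=> xa; rewrite /chi (max_r (_ : (qd x - a) / (b - a) <= 0)) ?subr0 ?max_l //.
by rewrite mulr_le0_ge0 ?invr_ge0 ?(ltW ba) // subr_le0.
Qed.

Lemma chi_eq0 x : b <= qd x -> chi x = 0.
Proof.
move=> bx; have H : 1 <= (qd x - a) / (b - a) by rewrite ler_pdivlMr // mul1r lerD2r.
by rewrite /chi (max_l (le_trans ler01 H)) max_r // subr_le0.
Qed.

Lemma Cc_chi : Cc chi.
Proof.
apply: (Cc_cont (L := 1 + b)) => [|x bx].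
  apply: cont_max0; apply: contB; first exact: contC.
  by apply: cont_max0; apply: contM; [apply: contB; [exact: cont_qd|exact: contC]|exact: contC].
by apply: chi_eq0; have := lt_le_trans bx (norm_qd x); rewrite ltrD2l => /ltW.
Qed.

End Cutoff.

Hypothesis sigma_gt0 : forall j, (0 < sigma j)%N.

Lemma jacE (r : R) : jac sigma r = r ^+ (\sum_(j <- enum 'I_N) sigma j).
Proof. by rewrite /jac expr_sum. Qed.

Definition cacc w dw := forall phi dphi, Cc phi -> (forall i, hd i phi (dphi i)) ->
  I (fun x => phi x ^+ 2 * gsq dw x) <= 16 * I (fun x => w x ^+ 2 * gsq dphi x).

(* The Nash inequality with [r] proportional to [d ^+ 2] leaves a small multiple of the same integral with gap [d / 4]; iterating over the gaps absorbs it. *)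
Lemma reverse_holder : exists c K, 0 <= c /\ forall w dw b d (X : V -> R), continuous w ->
  (forall x, 0 <= w x) -> (forall i, hd i w (dw i)) -> cacc w dw ->
  1 <= b -> b <= 2 -> 0 < d -> d <= 1 -> Cc X -> (forall x, 0 <= X x) -> (forall x, qd x <= b -> 1 <= X x) ->
  I (fun x => chi (b - d) (b - d / 2) x * w x ^+ 2) <=
    c * (d^-1) ^+ K * I (fun x => X x * w x) ^+ 2.
Proof.
have [dq hq] := hd_qd; have [C0 C00 nashP] := nash S sigma_gt0.
have cdq : continuous (gsq dq) := cont_gsq hq.
have [C1 C10 C1P] := compact_bound (@compact_box R N 3) cdq.
set Q := (\sum_(j <- enum 'I_N) sigma j)%N.
pose K := (2 * Q + 4)%N.
have [C2 C20 C2E] : exists2 C2 : R, 0 <= C2 & C2 = 34 * 4 ^+ 2 * 4 ^+ 4 * C1.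
  eexists; last reflexivity; apply: mulr_ge0 C10.
  exact: mulr_ge0 (mulr_ge0 (ler0n _ 34) (exprn_ge0 2 (ler0n _ 4))) (exprn_ge0 4 (ler0n _ 4)).
pose ep : R := (2 * 4 ^+ K)^-1.
have ep0 : 0 < ep by rewrite invr_gt0 mulr_gt0 // exprn_gt0.
pose eta : R := Num.min 1 (ep / (C0 * C2 + 1)).
have CC : 0 < C0 * C2 + 1 by rewrite ltr_wpDl // mulr_ge0.
have eta0 : 0 < eta by rewrite lt_min ltr01 divr_gt0.
have eta1 : eta <= 1 by rewrite ge_min lexx.
have eta2 : C0 * C2 * eta ^+ 2 <= ep.
  apply: (@le_trans _ _ ((C0 * C2 + 1) * eta)).
    apply: (ler_pM (mulr_ge0 C00 C20) (sqr_ge0 eta)); first by rewrite lerDl.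
    by rewrite expr2 ler_piMl // ltW.
  by rewrite mulrC -ler_pdivlMr // ge_min lexx orbT.
pose c := C0 * (eta^-1) ^+ Q * 64 ^+ 2.
have c0 : 0 <= c by rewrite !mulr_ge0 ?exprn_ge0 ?invr_ge0 // ltW.
exists (2 * c), K; split; first exact: mulr_ge0 (ler0n _ 2) c0.
move=> w dw b d X cw w0 hw caw b1 b2 d0 d1 cX X0 X1.
set J := I (fun x => X x * w x).
have cw2 : continuous (fun x => w x ^+ 2) by exact: contX.
pose A d := I (fun x => chi (b - d) (b - d / 2) x * w x ^+ 2).
have cXw : Cc (fun x => X x * w x) by exact: CcM.
have cchi (d' : R) : 0 < d' -> Cc (fun x => chi (b - d') (b - d' / 2) x * w x ^+ 2).
  by move=> d'0; apply: CcM => //; apply: Cc_chi; lra.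
have step (d' : R) : 0 < d' -> d' <= 1 -> A d' <= c * (d'^-1) ^+ K * J ^+ 2 + ep * A (d' / 4).
  move=> d'0 d'1.
  have ab : b - d' / 2 < b - d' / 4 by lra.
  have ab' : b - d' < b - d' / 2 by lra.
  have ab'' : b - d' / 4 < b - d' / 4 / 2 by lra.
  have bb0 : 0 <= b - d' / 4 by lra.
  have gap : b - d' / 4 - (b - d' / 2) = d' / 4 by field.
  pose phi := cutoff (b - d' / 2) (b - d' / 4); pose dphi := dcutoff dq (b - d' / 2) (b - d' / 4).
  have cp : Cc phi := Cc_cutoff ab.
  have hp i : hd i phi (dphi i) by exact: hd_cutoff.
  have cu : Cc (fun x => phi x * w x) by exact: CcM.
  pose du i x := dphi i x * w x + phi x * dw i x.
  have hu i : hd i (fun x => phi x * w x) (du i) := hdM (hp i) (hw i).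
  have r0 : 0 < eta * d' ^+ 2 by rewrite mulr_gt0 // exprn_gt0.
  have cgp : Cc (gsq dphi) := Cc_gsq hp cp.
  have cgw : continuous (gsq dw) := cont_gsq hw.
  have c1 : Cc (fun x => w x ^+ 2 * gsq dphi x) by exact: CcMl.
  have c2 : Cc (fun x => phi x ^+ 2 * gsq dw x) by apply: CcM => //; exact: (@CcX _ _ _ 1).
  have cgu : Cc (gsq du) := Cc_gsq hu cu.
  have AU : A d' <= I (fun x => (phi x * w x) ^+ 2).
    apply: I_le => [||x]; [exact: cchi|exact: (@CcX _ _ _ 1)|].
    rewrite exprMn ler_wpM2r ?sqr_ge0 //.
    have [xb|bx] := leP (qd x) (b - d' / 2).
      by rewrite (le_trans (chi_le1 _ _ _)) // exprn_ege1 // cutoff_ge1.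
    by rewrite (chi_eq0 ab') ?sqr_ge0 // ltW.
  have GU : I (gsq du) <= C2 * (d'^-1) ^+ 4 * A (d' / 4).
    apply: (@le_trans _ _ (34 * I (fun x => w x ^+ 2 * gsq dphi x))).
      apply: (@le_trans _ _ (2 * I (fun x => w x ^+ 2 * gsq dphi x) + 2 * I (fun x => phi x ^+ 2 * gsq dw x))).
        rewrite -!IZ // -ID; [|exact: CcZ|exact: CcZ].
        apply: I_le => // [|x]; first by apply: CcD; exact: CcZ.
        rewrite /gsq !mulr_sumr -big_split /=; apply: ler_sum => i _; rewrite /du -subr_ge0.
        have -> : 2 * (w x ^+ 2 * dphi i x ^+ 2) + 2 * (phi x ^+ 2 * dw i x ^+ 2) -
           (dphi i x * w x + phi x * dw i x) ^+ 2 = (dphi i x * w x - phi x * dw i x) ^+ 2 by ring.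
        exact: sqr_ge0.
      have := caw phi dphi cp hp; move: (I _) (I _) => p q; lra.
    rewrite -!IZ //; last by apply: cchi; lra.
    apply: I_le => [||x]; [exact: CcZ|by apply: CcZ; apply: cchi; lra|].
    have [bx|xb] := leP (b - d' / 4) (qd x).
      rewrite /dphi (gsq_dcutoff0 _ ab bx) !mulr0 !mulr_ge0 ?exprn_ge0 ?invr_ge0 ?(ltW d'0) ?chi_ge0 //.
    rewrite (chi_eq1 ab'' (ltW xb)) mul1r.
    have -> : C2 * d'^-1 ^+ 4 * w x ^+ 2 = w x ^+ 2 * (C2 * d'^-1 ^+ 4) by ring.
    rewrite mulrCA ler_wpM2l ?sqr_ge0 //.
    apply: le_trans (ler_wpM2l (ler0n _ 34) (gsq_dcutoff dq ab bb0 x)) _.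
    have xC : gsq dq x <= C1.
      apply: le_trans (ler_norm _) _; apply: C1P => /=.
      by apply: le_trans (norm_qd x) _; move: (qd x) xb => q; lra.
    rewrite gap.
    apply: (@le_trans _ _ (34 * (4 * (2 ^+ 2) / (d' / 4) ^+ 4 * C1))); last first.
      by rewrite le_eqVlt; apply/orP; left; apply/eqP; rewrite C2E; field; rewrite gt_eqF.
    rewrite ler_wpM2l // ler_pM ?gsq_ge0 //.
      by rewrite mulr_ge0 ?invr_ge0 ?exprn_ge0 ?mulr_ge0 ?exprn_ge0 ?invr_ge0 ?(ltW d'0).
    rewrite ler_wpM2r ?invr_ge0 ?exprn_ge0 ?divr_ge0 ?(ltW d'0) // ler_wpM2l //.
    by rewrite lerXn2r ?nnegrE //; lra.
  have LU : I (fun x => `|phi x * w x|) <= 64 * (d'^-1) ^+ 2 * J.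
    rewrite -IZ //; apply: I_le => [||x]; [exact: Cc_abs|exact: CcZ|].
    rewrite ger0_norm; last by rewrite mulr_ge0 ?cutoff_ge0.
    rewrite mulrA ler_wpM2r //.
    have [bx|xb] := leP (b - d' / 4) (qd x).
      by rewrite /phi (cutoff_eq0 ab bx) !mulr_ge0 ?exprn_ge0 ?invr_ge0 ?(ltW d'0).
    apply: (@le_trans _ _ (64 * d'^-1 ^+ 2)); last first.
      rewrite ler_peMr ?X1 //; first by rewrite mulr_ge0 ?exprn_ge0 ?invr_ge0 ?(ltW d'0).
      by move: (qd x) xb => q; lra.
    apply: le_trans (cutoff_le ab bb0 x) _; rewrite gap.
    have -> : 64 * d'^-1 ^+ 2 = (2 / (d' / 4)) ^+ 2 by field; rewrite gt_eqF.
    rewrite lerXn2r ?nnegrE ?divr_ge0 ?(ltW d'0) // ler_wpM2r ?invr_ge0 ?divr_ge0 ?(ltW d'0) //.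
    lra.
  apply: le_trans AU _; apply: le_trans (nashP _ _ _ hu cu r0) _.
  have LU0 : 0 <= I (fun x => `|phi x * w x|) by apply: I_ge0 => //; exact: Cc_abs.
  have A40 : 0 <= A (d' / 4).
    apply: I_ge0 => [|x]; first by apply: cchi; lra.
    by rewrite mulr_ge0 ?chi_ge0 ?sqr_ge0.
  apply: (@le_trans _ _ (C0 * ((jac sigma (eta * d' ^+ 2))^-1 * (64 * d'^-1 ^+ 2 * J) ^+ 2 +
     (eta * d' ^+ 2) ^+ 2 * (C2 * d'^-1 ^+ 4 * A (d' / 4))))).
    rewrite ler_wpM2l // lerD //; rewrite ler_wpM2l ?sqr_ge0 ?invr_ge0 ?(ltW (jac_gt0 _ r0)) //.
    by rewrite lerXn2r ?nnegrE // (le_trans LU0).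
  have -> : C0 * ((jac sigma (eta * d' ^+ 2))^-1 * (64 * d'^-1 ^+ 2 * J) ^+ 2 +
     (eta * d' ^+ 2) ^+ 2 * (C2 * d'^-1 ^+ 4 * A (d' / 4))) =
     c * d'^-1 ^+ K * J ^+ 2 + C0 * C2 * eta ^+ 2 * A (d' / 4).
    rewrite jacE -/Q exprMn invfM -!exprVn -exprM /c /K exprD; field; rewrite gt_eqF //.
  by rewrite lerD2l ler_wpM2r.
have main n : forall d' : R, 0 < d' -> d' <= 1 ->
    A d' <= 2 * c * (d'^-1) ^+ K * J ^+ 2 + 2^-1 ^+ n * I (fun x => X x * w x ^+ 2).
  have cXw2 : Cc (fun x => X x * w x ^+ 2) by exact: CcM.
  have B0 : 0 <= I (fun x => X x * w x ^+ 2) by apply: I_ge0 => // x; rewrite mulr_ge0 ?sqr_ge0.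
  have JK0 (d' : R) : 0 < d' -> 0 <= c * (d'^-1) ^+ K * J ^+ 2.
    by move=> d'0; rewrite (mulr_ge0 _ (sqr_ge0 J)) // mulr_ge0 // exprn_ge0 // invr_ge0 ltW.
  elim: n => [|n IH] d' d'0 d'1.
    apply: (@le_trans _ _ (I (fun x => X x * w x ^+ 2))).
      apply: I_le => // [|x]; first exact: cchi.
      rewrite ler_wpM2r ?sqr_ge0 //.
      have [xb|bx] := leP (qd x) b; first exact: le_trans (chi_le1 _ _ _) (X1 _ xb).
      by rewrite chi_eq0 //; [lra|move: (qd x) bx => q; lra].
    rewrite expr0 mul1r lerDr (_ : 2 * c * d'^-1 ^+ K * J ^+ 2 = 2 * (c * d'^-1 ^+ K * J ^+ 2)); last by ring.
    exact: mulr_ge0 (ler0n _ 2) (JK0 _ d'0).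
  have d40 : 0 < d' / 4 by lra.
  have d41 : d' / 4 <= 1 by lra.
  apply: le_trans (step d' d'0 d'1) _.
  apply: (@le_trans _ _ (c * d'^-1 ^+ K * J ^+ 2 + ep * (2 * c * (d' / 4)^-1 ^+ K * J ^+ 2) +
    ep * (2^-1 ^+ n * I (fun x => X x * w x ^+ 2)))).
    by rewrite -addrA lerD2l -mulrDr ler_wpM2l ?(ltW ep0) ?IH.
  have -> : ep * (2 * c * (d' / 4)^-1 ^+ K * J ^+ 2) = c * d'^-1 ^+ K * J ^+ 2.
    rewrite invfM invrK exprMn /ep; field.
    by rewrite expf_eq0 pnatr_eq0 andbF.
  have -> : 2 * c * d'^-1 ^+ K * J ^+ 2 = c * d'^-1 ^+ K * J ^+ 2 + c * d'^-1 ^+ K * J ^+ 2 by ring.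
  rewrite lerD2l exprS -mulrA ler_wpM2r ?mulr_ge0 ?exprn_ge0 ?invr_ge0 //.
  rewrite /ep lef_pV2 ?posrE ?mulr_gt0 ?exprn_gt0 //.
  by rewrite ler_peMr // exprn_ege1 // ler1n.
apply: (@le_geo _ _ _ (I (fun x => X x * w x ^+ 2))) => [|n]; last exact: main.
by apply: I_ge0 => [|x]; [exact: CcM|rewrite mulr_ge0 ?sqr_ge0].
Qed.

End Caccioppoli.

Section Moser.
Variables (R : realType) (N m : nat) (sigma : 'I_N -> nat) (S : flowsys R m sigma).
Hypothesis sigma_gt0 : forall j, (0 < sigma j)%N.
Local Notation V := 'rV[R]_N.
Local Notation I := (@I R N).
Local Notation hd := (hd S).
Local Notation sol := (sol S).
Local Notation cacc := (cacc S).
Implicit Types (f u phi psi w : V -> R) (g dphi dpsi dw : 'I_m -> V -> R) (x y : V) (i : 'I_m).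

Lemma moser : exists2 C, 0 < C & forall (v : V -> R) (dv : nat -> 'I_m -> V -> R), continuous v ->
  (forall x, 0 < v x) -> (forall n i, hd i (fun x => v x ^+ (2 ^ n)) (dv n i)) ->
  (forall n, cacc (fun x => v x ^+ (2 ^ n)) (dv n)) ->
  forall x, qd x < 1 -> v x <= C * I (fun x => tent 3 x * v x).
Proof.
have [c [K [c0 RH]]] := reverse_holder S sigma_gt0.
pose C := c * 2 ^+ K + 1; pose l : R := 2 ^+ K.
have l1 : 1 <= l by rewrite exprn_ege1 // ler1n.
have C1 : 1 <= C by rewrite lerDr mulr_ge0 // exprn_ge0.
have Cl0 : 0 < C * l by rewrite mulr_gt0 // (lt_le_trans ltr01).
exists (C * l) => // v dv cv v0 hv cav x x1.
pose ch n : V -> R := chi (1 + 2^-1 ^+ n) (1 + 3 / 2 * 2^-1 ^+ n).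
have g0 n : 0 < 2^-1 ^+ n :> R by rewrite exprn_gt0 // invr_gt0.
have g1 n : 2^-1 ^+ n <= 1 :> R by rewrite exprn_ile1 ?invr_ge0 // invf_le1 // ler1n.
have ab n : 1 + 2^-1 ^+ n < 1 + 3 / 2 * 2^-1 ^+ n :> R by move: (g0 n); move: (2^-1 ^+ n) => d d0; lra.
have cch n : Cc (ch n) := Cc_chi _ (ab n).
have cvn n : continuous (fun x => v x ^+ (2 ^ n)) by exact: contX.
pose a n := I (fun x => ch n x * v x ^+ (2 ^ n)).
have ca n : Cc (fun x => ch n x * v x ^+ (2 ^ n)) by exact: CcM.
have vn0 n x' : 0 <= v x' ^+ (2 ^ n) by rewrite exprn_ge0 // ltW.
have a0 n : 0 <= a n by apply: I_ge0 => // x'; rewrite mulr_ge0 ?chi_ge0.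
have rec n : a n.+1 <= C * l ^+ n * a n ^+ 2.
  pose d : R := 2^-1 ^+ n.+1.
  have dE : 2^-1 ^+ n = 2 * d by rewrite /d exprS mulrA divff // mul1r.
  have d0 : 0 < d := g0 n.+1.
  have d1 : d <= 1 := g1 n.+1.
  have dn1 := g1 n.
  have b1 : 1 <= 1 + 2^-1 ^+ n :> R by rewrite lerDl ltW.
  have b2 : 1 + 2^-1 ^+ n <= 2 :> R by rewrite -[leRHS]/(1 + 1) lerD2l.
  have X1 x' : qd x' <= 1 + 2^-1 ^+ n -> 1 <= ch n x' by move=> h; rewrite /ch (chi_eq1 (ab n)).
  have := RH _ (dv n) (1 + 2^-1 ^+ n) d (ch n) (cvn n) (vn0 n) (hv n) (cav n) b1 b2 d0 d1 (cch n)
    (chi_ge0 _ _) X1.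
  rewrite -/(a n) dE.
  have -> : 1 + 2 * d - d = 1 + d by ring.
  have -> : 1 + 2 * d - d / 2 = 1 + 3 / 2 * d by field.
  have -> : (fun x => chi (1 + d) (1 + 3 / 2 * d) x * (v x ^+ (2 ^ n)) ^+ 2) =
     fun x => ch n.+1 x * v x ^+ (2 ^ n.+1).
    by apply/funext => x'; rewrite /ch -/d -exprM expnS mulnC.
  move/le_trans; apply; rewrite ler_wpM2r ?sqr_ge0 //.
  have -> : d^-1 ^+ K = l * l ^+ n.
    have -> : d^-1 = 2 ^+ n.+1 by rewrite /d exprVn invrK.
    by rewrite /l -!exprM -exprD mulSn (mulnC K).
  have ln0 : 0 <= l ^+ n := exprn_ge0 n (le_trans ler01 l1).
  rewrite mulrA; apply: (ler_wpM2r ln0).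
  by rewrite /C lerDl.
have Y := quad_iter C1 l1 a0 rec.
have a0le : a 0%N <= I (fun x => tent 3 x * v x).
  apply: I_le => // [|x']; first by apply: CcM => //; exact: Cc_tent.
  rewrite expn0 expr1 ler_wpM2r ?(ltW (v0 _)) //.
  have [xb|bx] := leP (1 + 3 / 2 * 2^-1 ^+ 0) (qd x').
    by rewrite /ch (chi_eq0 (ab 0%N)) // tent_ge0.
  rewrite (le_trans (chi_le1 _ _ _)) // tent_eq1 //; apply: le_trans (norm_qd x') _.
  by move: (qd x') bx => q; rewrite expr0; lra.
apply: (@le_trans _ _ (C * l * a 0%N)); last by rewrite ler_wpM2l // ltW.
set y := C * l * a 0%N in Y *; have y0 : 0 <= y by apply: mulr_ge0 (a0 0%N); exact: ltW.
rewrite leNgt; apply/negP => yv; pose y' := (y + v x) / 2.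
have yy' : y < y' by rewrite /y'; lra.
have y'v : y' < v x by rewrite /y'; lra.
have y'0 : 0 < y' := le_lt_trans y0 yy'.
pose bump x' := pos2 (1 - qd x') * Num.max (v x' - y') 0.
have cpos : Cc (fun x' : V => pos2 (1 - qd x')).
  apply: (Cc_cont (L := 2)) => [|x' xb].
    apply: (@cont_comp _ _ _ (@pos2 R)); first by move=> z; exact: der_cont (pos2_der z).
    by apply: contB; [exact: contC|exact: cont_qd].
  rewrite /pos2 max_r ?expr0n //; have := lt_le_trans xb (norm_qd x').
  by move: (qd x') => q; lra.
have cb : Cc bump.
  by apply: CcM => //; apply: cont_max0; apply: contB => //; exact: contC.
have b0 x' : 0 <= bump x' by rewrite mulr_ge0 ?sqr_ge0 // le_max lexx orbT.
have bx : 0 < bump x.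
  by rewrite mulr_gt0 // ?exprn_gt0 // lt_max subr_gt0 ?x1 ?y'v.
have Ib := I_gt0 cb b0 bx.
have key n : I bump * y' ^+ (2 ^ n) <= y' * y ^+ (2 ^ n).
  apply: (@le_trans _ _ (y' * a n)); last by rewrite ler_wpM2l ?Y // ltW.
  rewrite mulrC -!IZ //; apply: I_le => [||x']; [exact: CcZ|exact: CcZ|].
  have [mm mE] : exists k, (2 ^ n = k.+1)%N by exists (2 ^ n).-1; rewrite prednK // expn_gt0.
  have R0 : 0 <= y' * (ch n x' * v x' ^+ (2 ^ n)) by exact: mulr_ge0 (ltW y'0) (mulr_ge0 (chi_ge0 _ _ _) (vn0 n x')).
  rewrite /bump; have [q1|q1] := leP 1 (qd x').
    by rewrite /pos2 max_r ?subr_le0 // expr0n mul0r mulr0.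
  have [vy|vy] := leP (v x') y'; first by rewrite max_r ?subr_le0 // !mulr0.
  rewrite /ch (chi_eq1 (ab n)) ?mul1r; last first.
    by rewrite (le_trans (ltW q1)) // lerDl ltW.
  rewrite mE !exprS -mulrA ler_wpM2l ?(ltW y'0) // mulrC ler_pM ?exprn_ge0 ?(ltW y'0) ?(mulr_ge0 (sqr_ge0 _)) //.
  - by rewrite le_max lexx orbT.
  - rewrite max_l ?subr_ge0 ?(ltW vy) //; apply: (@le_trans _ _ (1 * (v x' - y'))).
      rewrite ler_wpM2r ?subr_ge0 ?(ltW vy) // /pos2 expr_le1 // ?le_max ?lexx ?orbT //.
      by rewrite ge_max ler01 andbT gerBl qd_ge0.
    by rewrite mul1r gerBl ltW.
  - by rewrite lerXn2r ?nnegrE ?(ltW vy) // ltW.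
have t0 : 0 <= y / y' by rewrite divr_ge0 // ltW.
have t1 : y / y' < 1 by rewrite ltr_pdivrMr // mul1r.
have [n nP] := pow_lt t0 t1 (divr_gt0 Ib y'0).
have := nP (2 ^ n)%N (ltnW (ltn_expl n (ltnSn 1))).
rewrite expr_div_n ltr_pdivlMr // mulrAC ltr_pdivrMr ?exprn_gt0 //.
by rewrite mulrC ltNge key.
Qed.

(* The Caccioppoli estimate for [expR (t * f)] degenerates at [t = 1]; the exponents met by the Moser iteration must stay away from it. *)
Definition goodq (q : R) := forall n : nat, let t := 2 * q * 2 ^+ n in t != 0 /\ (t <= 2 / 3 \/ 4 / 3 <= t).

Lemma expM_der (t y : R) : is_derive y 1 (fun z => expR (t * z)) (t * expR (t * y)).
Proof.
rewrite mulrC; apply: (@is_derive1_comp _ expR (fun z => t * z)) (is_derive_expR _) _.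
by apply: is_derive_eq (derZ t (derI _)) _; rewrite mulr1.
Qed.

Lemma cont_expM (t : R) : continuous (fun z : R => expR (t * z)).
Proof. by move=> y; exact: der_cont (expM_der t y). Qed.

Lemma moser_exp : exists2 C, 0 < C & forall f g (q : R), sol f g -> goodq q ->
  forall x, qd x < 1 -> expR (q * f x) <= C * I (fun x => tent 3 x * expR (q * f x)).
Proof.
have [C C0 mos] := moser; exists C => // f g q sfg gq x x1.
have [cf hf _] := sfg.
have hexp (t : R) i : hd i (fun x => expR (t * f x)) (fun x => t * expR (t * f x) * g i x).
  apply: (hd_comp (b := fun z => expR (t * z)) (b' := fun z => t * expR (t * z))) (hf i).
    by apply: contM; [exact: contC|exact: cont_expM].
  exact: expM_der.
have E n : (fun x => expR (q * f x) ^+ (2 ^ n)) = (fun x => expR (q * 2 ^+ n * f x)).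
  by apply/funext => y; rewrite -expRM_natl natrX; congr expR; ring.
apply: (mos (fun x => expR (q * f x)) (fun n i x => q * 2 ^+ n * expR (q * 2 ^+ n * f x) * g i x)) => //.
- by apply: (@cont_comp _ _ _ (fun z : R => expR (q * z))) => //; exact: cont_expM.
- by move=> y; exact: expR_gt0.
- by move=> n i; rewrite E; exact: hexp.
move=> n; rewrite E => phi dphi cp hp.
have [t0 tq] := gq n; set t := 2 * q * 2 ^+ n in t0 tq.
have kt : 0 < `|t| / 4 by rewrite divr_gt0 ?normr_gt0.
have cbt : continuous (fun z : R => t * expR (t * z)) by apply: contM; [exact: contC|exact: cont_expM].
have e0 (y : R) : 0 < expR (t * y) by exact: expR_gt0.
have kb : (forall y : R, `|t| / 4 * expR (t * y) <= expR (t * y) - t * expR (t * y)) \/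
    (forall y : R, `|t| / 4 * expR (t * y) <= t * expR (t * y) - expR (t * y)).
  case: tq => tq; [left|right] => y.
    rewrite -[X in X - _]mul1r -mulrBl ler_wpM2r ?(ltW (e0 y)) //.
    have aux (s : R) : s <= 2 / 3 -> `|s| / 4 <= 1 - s.
      by move=> s1; have [s0|s0] := leP 0 s; [rewrite ger0_norm|rewrite ltr0_norm] => //; lra.
    exact: aux.
  rewrite -[X in _ - X]mul1r -mulrBl ler_wpM2r ?(ltW (e0 y)) //.
  have aux (s : R) : 4 / 3 <= s -> `|s| / 4 <= s - 1 by move=> s1; rewrite ger0_norm; lra.
  exact: aux.
have H := caccioppoli sfg (@cont_expM t) cbt (expM_der t) e0 kt kb cp hp.
have E1 y : expR (q * 2 ^+ n * f y) ^+ 2 = expR (t * f y).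
  by rewrite expr2 -expRD /t; congr expR; ring.
have -> : (fun x => phi x ^+ 2 * gsq (fun i x => q * 2 ^+ n * expR (q * 2 ^+ n * f x) * g i x) x) =
  (fun x => t ^+ 2 / 4 * (phi x ^+ 2 * (expR (t * f x) * gsq g x))).
  apply/funext => y; rewrite /gsq !mulr_sumr; apply: eq_bigr => i _.
  by rewrite -E1 /t; field.
have cA : Cc (fun x => phi x ^+ 2 * (expR (t * f x) * gsq g x)).
  apply: CcM; first exact: (@CcX _ _ _ 1).
  by apply: contM; [apply: (@cont_comp _ _ _ (fun z : R => expR (t * z))) => //; exact: cont_expM|exact: cont_gsq hf].
rewrite IZ //; under [in leRHS]eq_fun do rewrite E1.
have t2 : 0 <= t ^+ 2 / 4 by rewrite divr_ge0 ?sqr_ge0.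
apply: le_trans (ler_wpM2l t2 H) _; rewrite mulrA -[t ^+ 2]real_normK ?num_real //.
by rewrite le_eqVlt; apply/orP; left; apply/eqP; field; rewrite normr_eq0.
Qed.

End Moser.

(** * Harnack inequality *)

Section Harnack.
Variables (R : realType) (N m : nat) (sigma : 'I_N -> nat) (S : flowsys R m sigma).
Hypothesis sigma_gt0 : forall j, (0 < sigma j)%N.
Local Notation V := 'rV[R]_N.
Local Notation I := (@I R N).
Local Notation hd := (hd S).
Local Notation sol := (sol S).
Local Notation cacc := (cacc S).
Implicit Types (f h u phi psi w : V -> R) (g dphi dpsi dw : 'I_m -> V -> R) (x y : V) (i : 'I_m).

Lemma sol_dil f g (l : R) : 0 < l -> sol f g ->
  sol (fun x => f (dil sigma l x)) (fun i x => l * g i (dil sigma l x)).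
Proof.
move=> l0 [cf hf weak]; split.
- exact: (cont_comp cf (@cont_dilx R N sigma l)).
- by move=> i; exact: hd_dil.
move=> psi dpsi cp hp.
have lV0 : 0 < l^-1 by rewrite invr_gt0.
have K x : dil sigma l^-1 (dil sigma l x) = x by rewrite dilM mulVf ?dil1 ?gt_eqF.
have cp' := Cc_dil sigma lV0 cp.
have hp' i := hd_dil lV0 (hp i).
have c1 : Cc (fun x => psi (dil sigma l^-1 x) * gsq g x) by apply: CcM => //; exact: cont_gsq hf.
have c2 : Cc (fun x => \sum_i l^-1 * dpsi i (dil sigma l^-1 x) * g i x).
  apply: Cc_sum => i; apply: CcM; last exact: cont_hd' (hf i).
  by apply: CcZ; apply: (Cc_dil sigma lV0 (f := dpsi i)); exact: Cc_hd (hp i) cp.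
have -> : (fun x => psi x * gsq (fun i x => l * g i (dil sigma l x)) x) =
    (fun x => l ^+ 2 * (psi (dil sigma l^-1 (dil sigma l x)) * gsq g (dil sigma l x))).
  by apply/funext => x; rewrite K /gsq !mulr_sumr; apply: eq_bigr => i _; ring.
have -> : (fun x => \sum_i dpsi i x * (l * g i (dil sigma l x))) =
    (fun x => l ^+ 2 * \sum_i l^-1 * dpsi i (dil sigma l^-1 (dil sigma l x)) * g i (dil sigma l x)).
  apply/funext => x; rewrite K !mulr_sumr; apply: eq_bigr => i _; field.
  by rewrite gt_eqF.
rewrite !IZ; [|exact: (Cc_dil sigma l0 c2)|exact: (Cc_dil sigma l0 c1)].
by rewrite (I_dil sigma l0 c1) (I_dil sigma l0 c2) (weak _ _ cp' hp').
Qed.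

Lemma cutoff_tent L : 0 <= L -> exists phi dphi C M, [/\ Cc phi, forall i, hd i phi (dphi i),
  forall x, tent L x <= phi x ^+ 2, 0 <= C /\ 0 <= M & forall x, gsq dphi x <= C * tent M x].
Proof.
move=> L0; have [dq hq] := hd_qd S.
pose a : R := N%:R * (L + 2) ^+ 2; pose b := a + 1.
have a0 : 0 <= a by rewrite mulr_ge0 // sqr_ge0.
have ab : a < b by rewrite ltrDl.
have cg : continuous (gsq (dcutoff dq a b)) := cont_gsq (fun i => hd_cutoff a b hq i).
have [C C0 CP] := compact_bound (@compact_box R N (1 + b)) cg.
exists (cutoff a b), (dcutoff dq a b), C, (1 + b); split.
- exact: Cc_cutoff.
- by move=> i; exact: hd_cutoff.
- move=> x; have [xL|Lx] := leP `|x| (L + 2); last by rewrite tent_supp ?sqr_ge0 // ltW.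
  by rewrite (le_trans (tent_le1 _ _)) // exprn_ege1 // cutoff_ge1 // qd_norm.
- by split=> //; rewrite !addr_ge0.
move=> x; have [xb|bx] := leP b (qd x); first by rewrite gsq_dcutoff0 // mulr_ge0 ?tent_ge0.
have xB : `|x| <= 1 + b by rewrite (le_trans (norm_qd x)) // lerD2l ltW.
apply: (@le_trans _ _ C); first exact: le_trans (ler_norm _) (CP x xB).
by rewrite ler_peMr // tent_ge1.
Qed.

Lemma energy L : 0 <= L -> exists C M, [/\ 0 <= C, 0 <= M & forall f g (b b' : R -> R) k, sol f g ->
  continuous b -> continuous b' -> (forall y : R, is_derive y 1 b (b' y)) -> (forall y : R, 0 < b y) -> 0 < k ->
  (forall y : R, k * b y <= b y - b' y) \/ (forall y : R, k * b y <= b' y - b y) ->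
  I (fun x => tent L x * (b (f x) * gsq g x)) <= C / k ^+ 2 * I (fun x => tent M x * b (f x))].
Proof.
move=> L0; have [phi [dphi [C [M [cp hp pL [C0 M0] gM]]]]] := cutoff_tent L0.
exists (4 * C), M; split=> // [|f g b b' k sfg cb cb' db b0 k0 kb]; first by rewrite mulr_ge0.
have [cf hf _] := sfg.
have cbf : continuous (fun x => b (f x)) by exact: cont_comp.
have cg := cont_gsq hf.
have cgp : Cc (gsq dphi) := Cc_gsq hp cp.
apply: (@le_trans _ _ (I (fun x => phi x ^+ 2 * (b (f x) * gsq g x)))).
  apply: I_le => [||x].
  - by apply: CcM; [exact: Cc_tent|exact: contM].
  - by apply: CcM; [exact: (@CcX _ _ _ 1)|exact: contM].
  - by rewrite ler_wpM2r // mulr_ge0 ?gsq_ge0 // ltW.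
apply: le_trans (caccioppoli sfg cb cb' db b0 k0 kb cp hp) _.
have -> : 4 * C / k ^+ 2 = 4 / k ^+ 2 * C by ring.
rewrite -(mulrA (4 / k ^+ 2)) ler_wpM2l ?divr_ge0 ?sqr_ge0 // -IZ; last by apply: CcM => //; exact: Cc_tent.
apply: I_le => [||x]; [exact: CcMl|by apply: CcZ; apply: CcM => //; exact: Cc_tent|].
by rewrite mulrA mulrC ler_wpM2r // ltW.
Qed.

Lemma log_energy L : 0 <= L -> exists2 C, 0 <= C & forall f g, sol f g ->
  I (fun x => tent L x * gsq g x) <= C.
Proof.
move=> L0; have [C [M [C0 M0 H]]] := energy L0.
exists (C * I (tent M)); first by rewrite mulr_ge0 // ltW // I_tent_gt0.
move=> f g sfg.
have := H f g (fun=> 1) (fun=> 0) 1 sfg (@contC _ _ _) (@contC _ _ _) (derC 1) (fun=> ltr01) ltr01.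
rewrite expr1n divr1 mulr1 subr0 => /(_ (or_introl (fun=> lexx _))).
under eq_fun do rewrite mul1r.
by have -> : (fun x => tent M x * 1) = tent M by apply/funext => x; rewrite mulr1.
Qed.

Definition contraction (b b' : R -> R) := [/\ continuous b', forall y : R, is_derive y 1 b (b' y) &
  forall y : R, `|b' y| <= 1].

Lemma contraction_hd b b' f g : contraction b b' -> sol f g ->
  continuous (fun x => b (f x)) /\ forall i, hd i (fun x => b (f x)) (fun x => b' (f x) * g i x).
Proof.
move=> [cb' db _] [cf hf _]; split; last by move=> i; exact: hd_comp.
by apply: cont_comp cf => y; exact: der_cont (db y).
Qed.

Lemma contraction_gsq b b' f g x : contraction b b' ->
  gsq (fun i x => b' (f x) * g i x) x <= gsq g x.
Proof.
move=> [_ _ b1]; apply: ler_sum => i _; rewrite exprMn ler_piMl ?sqr_ge0 //.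
by rewrite -real_normK ?num_real // exprn_ile1.
Qed.

Lemma cauchy_schwarz phi h : Cc phi -> (forall x, 0 <= phi x) -> continuous h -> 0 < I phi ->
  I (fun x => phi x * h x) ^+ 2 <= I phi * I (fun x => phi x * h x ^+ 2).
Proof.
move=> cp p0 ch c0; set B := I (fun x => phi x * h x); set D := I (fun x => phi x * h x ^+ 2); set c := I phi in c0 *.
have c1 : Cc (fun x => phi x * h x) by exact: CcM.
have c2 : Cc (fun x => phi x * h x ^+ 2) by apply: CcM => //; exact: contX.
have : 0 <= I (fun x => c ^+ 2 * (phi x * h x ^+ 2) - 2 * c * B * (phi x * h x) + B ^+ 2 * phi x).
  apply: I_ge0 => [|x]; first by apply: CcD; [apply: CcB; exact: CcZ|exact: CcZ].
  have -> : c ^+ 2 * (phi x * h x ^+ 2) - 2 * c * B * (phi x * h x) + B ^+ 2 * phi x =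
    phi x * (c * h x - B) ^+ 2 by ring.
  by rewrite mulr_ge0 // sqr_ge0.
rewrite ID; [|by apply: CcB; exact: CcZ|exact: CcZ].
rewrite IB; [|exact: CcZ|exact: CcZ].
rewrite !IZ // -/B -/D -/c.
have -> : c ^+ 2 * D - 2 * c * B * B + B ^+ 2 * c = c * (c * D - B ^+ 2) by ring.
by rewrite pmulr_rge0 // subr_ge0.
Qed.

Lemma mean_oscillation L : 0 <= L -> exists2 C, 0 <= C & forall f g b b' phi1 phi2, sol f g ->
  contraction b b' -> Cc phi1 -> Cc phi2 ->
  (forall x, 0 <= phi1 x <= tent L x) -> (forall x, 0 <= phi2 x <= tent L x) ->
  I phi2 * I (fun x => phi1 x * b (f x) ^+ 2) -
    2 * (I (fun x => phi1 x * b (f x)) * I (fun x => phi2 x * b (f x))) +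
    I phi1 * I (fun x => phi2 x * b (f x) ^+ 2) <= C.
Proof.
move=> L0; have [Cp [M [Cp0 poin]]] := poincare S sigma_gt0 L.
have [C C0 le] := log_energy (addr_ge0 (normr_ge0 M) (ler0n _ 2)).
exists (Cp * C) => [|f g b b' phi1 phi2 sfg cb c1 c2 p1 p2]; first by rewrite mulr_ge0.
have [ch hh] := contraction_hd cb sfg; have [cf hf _] := sfg.
apply: le_trans (poin _ _ phi1 phi2 ch hh c1 c2 p1 p2) _.
rewrite ler_wpM2l //; apply: le_trans (le f g sfg).
apply: I_le => [||x]; [|by apply: CcM; [exact: Cc_tent|exact: cont_gsq hf]|].
  apply: CcM; [exact: Cc_tent|exact: cont_gsq hh].
apply: ler_pM; rewrite ?tent_ge0 ?gsq_ge0 //; last exact: contraction_gsq cb.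
by apply: tent_le => xM; rewrite (le_trans xM) // lerD2r ler_norm.
Qed.

Definition mean phi h := I (fun x => phi x * h x) / I phi.

Lemma mean_diff L phi1 phi2 : 0 <= L -> Cc phi1 -> Cc phi2 ->
  (forall x, 0 <= phi1 x <= tent L x) -> (forall x, 0 <= phi2 x <= tent L x) -> 0 < I phi1 -> 0 < I phi2 ->
  exists2 C, 0 <= C & forall f g b b', sol f g -> contraction b b' ->
    `|mean phi1 (fun x => b (f x)) - mean phi2 (fun x => b (f x))| <= C.
Proof.
move=> L0 c1 c2 p1 p2 i1 i2; have [C C0 osc] := mean_oscillation L0.
pose D := C / (I phi1 * I phi2); have D0 : 0 <= D by rewrite divr_ge0 // mulr_ge0 // ltW.
exists (D + 1) => [|f g b b' sfg cb]; first by rewrite addr_ge0.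
have := osc f g b b' phi1 phi2 sfg cb c1 c2 p1 p2.
have [ch _] := contraction_hd cb sfg.
have p10 x : 0 <= phi1 x by case/andP: (p1 x).
have p20 x : 0 <= phi2 x by case/andP: (p2 x).
have := cauchy_schwarz c1 p10 ch i1; have := cauchy_schwarz c2 p20 ch i2.
rewrite /mean /= /D; move: (I (fun x => phi1 x * b (f x))) (I (fun x => phi2 x * b (f x)))
  (I (fun x => phi1 x * b (f x) ^+ 2)) (I (fun x => phi2 x * b (f x) ^+ 2)) => B1 B2 D1 D2.
move: (I phi1) (I phi2) i1 i2 => a1 a2 i1 i2 cs2 cs1 H.
set z := B1 / a1 - B2 / a2.
have z2 : z ^+ 2 <= C / (a1 * a2).
  rewrite ler_pdivlMr ?mulr_gt0 //; apply: le_trans H.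
  have -> : z ^+ 2 * (a1 * a2) = a2 * (B1 ^+ 2 / a1) - 2 * (B1 * B2) + a1 * (B2 ^+ 2 / a2).
    by rewrite /z; field; rewrite !gt_eqF.
  by rewrite lerD ?lerD2r ?ler_pM2l // ler_pdivrMr // mulrC.
have : 0 <= (`|z| - 1) ^+ 2 by exact: sqr_ge0.
rewrite -[z ^+ 2]real_normK ?num_real // in z2.
have -> : (`|z| - 1) ^+ 2 = `|z| ^+ 2 - 2 * `|z| + 1 by ring.
by move: z2 (normr_ge0 z); move: (`|z| ^+ 2) `|z| (C / _) => q r s; lra.
Qed.

Lemma exp_mean (c0 C : R) : 0 < c0 -> 0 <= C -> exists2 D, 0 < D & forall phi h (p : R),
  Cc phi -> (forall x, 0 <= phi x) -> I phi = c0 -> continuous h -> 0 < p -> p <= 1 ->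
  I (fun x => phi x * (h x - mean phi h) ^+ 2) <= C ->
  c0 / 2 * I (fun x => phi x * expR (p * h x)) <= I (fun x => phi x * expR (p / 2 * h x)) ^+ 2 ->
  I (fun x => phi x * expR (p * h x)) <= D * expR (p * mean phi h).
Proof.
move=> c00 C0; pose k := Num.sqrt (c0 / 2).
have k0 : 0 < k by rewrite sqrtr_gt0 divr_gt0.
have k2 : k ^+ 2 = c0 / 2 by rewrite sqr_sqrtr // divr_ge0 // ltW.
pose T := (1 + C) / k; have T0 : 0 < T by rewrite divr_gt0 // ltr_wpDr.
have D0 : 0 < (2 * c0 / k) ^+ 2 * expR T by rewrite mulr_gt0 ?expR_gt0 // exprn_gt0 // divr_gt0 // mulr_gt0.
exists ((2 * c0 / k) ^+ 2 * expR T) => // phi h p cp p0 Ip ch pp p1 var big.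
set a := mean phi h in var *.
have ce (t : R) : continuous (fun x => expR (t * h x)).
  by apply: (@cont_comp _ _ _ (fun z : R => expR (t * z))) => //; exact: cont_expM.
have cpe (t : R) : Cc (fun x => phi x * expR (t * h x)) by exact: CcM.
have s2 x : expR (p * h x) = expR (p / 2 * h x) ^+ 2 by rewrite expr2 -expRD; congr expR; field.
have cv : Cc (fun x => phi x * (h x - a) ^+ 2).
  by apply: CcM => //; apply: contX; apply: contB => //; exact: contC.
set M0 := I (fun x => phi x * expR (p * h x)) in big *.
set B := I (fun x => phi x * expR (p / 2 * h x)) in big.
have B0 : 0 <= B by apply: I_ge0 => // x; rewrite mulr_ge0 ?expR_ge0.
have M00 : 0 <= M0 by apply: I_ge0 => // x; rewrite mulr_ge0 ?expR_ge0.
have [->|M0n] := eqVneq M0 0; first by rewrite mulr_ge0 ?expR_ge0 // ltW.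
pose n := Num.sqrt M0.
have n0 : 0 < n by rewrite sqrtr_gt0 lt_def M0n.
have n2 : n ^+ 2 = M0 by rewrite sqr_sqrtr.
have kB : k * n <= B.
  rewrite -(@ler_pXn2r _ 2) ?nnegrE ?(mulr_ge0 (ltW k0) (ltW n0)) //.
  by rewrite exprMn k2 n2.
pose K := expR (p / 2 * (a + T)).
have iT : 0 <= (2 * T)^-1 by rewrite invr_ge0 mulr_ge0 // ltW.
have BK : B <= K * c0 + (2 * T)^-1 * (n^-1 * M0 + n * C).
  apply: (@le_trans _ _ (I (fun x => K * phi x + (2 * T)^-1 * (n^-1 * (phi x * expR (p * h x)) + n * (phi x * (h x - a) ^+ 2))))).
    apply: I_le => [||x]; first exact: cpe.
      by apply: CcD; [exact: CcZ|apply: CcZ; apply: CcD; exact: CcZ].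
    rewrite s2; set s := expR (p / 2 * h x); have s0 : 0 <= s := expR_ge0 _.
    have -> : K * phi x + (2 * T)^-1 * (n^-1 * (phi x * s ^+ 2) + n * (phi x * (h x - a) ^+ 2)) =
      phi x * (K + (2 * T)^-1 * (n^-1 * s ^+ 2 + n * (h x - a) ^+ 2)) by ring.
    rewrite ler_wpM2l //.
    have [hT|hT] := leP (h x) (a + T).
      apply: (@le_trans _ _ K).
        by rewrite /s /K ler_expR ler_wpM2l // divr_ge0 // ltW.
      rewrite lerDl; apply: (mulr_ge0 iT).
      by apply: addr_ge0; apply: (mulr_ge0 _ (sqr_ge0 _)); rewrite ?invr_ge0 ltW.
    have H : 2 * T * s <= n^-1 * s ^+ 2 + n * (h x - a) ^+ 2.
      have d0 : T <= h x - a by move: hT; move: (h x) => hh; lra.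
      apply: (@le_trans _ _ (2 * (h x - a) * s)).
        by rewrite ler_wpM2r // ler_wpM2l.
      rewrite -subr_ge0.
      have -> : n^-1 * s ^+ 2 + n * (h x - a) ^+ 2 - 2 * (h x - a) * s = n^-1 * (s - n * (h x - a)) ^+ 2.
        by field; rewrite gt_eqF.
      by rewrite mulr_ge0 ?sqr_ge0 // invr_ge0 ltW.
    apply: (@le_trans _ _ ((2 * T)^-1 * (n^-1 * s ^+ 2 + n * (h x - a) ^+ 2))).
      by rewrite ler_pdivlMl // mulr_gt0.
    by rewrite lerDr expR_ge0.
  rewrite ID; [|exact: CcZ|by apply: CcZ; apply: CcD; exact: CcZ].
  rewrite !IZ ?ID ?IZ // ?Ip; [|exact: CcZ|exact: CcZ|by apply: CcD; exact: CcZ].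
  by rewrite lerD2l ler_wpM2l // lerD2l ler_wpM2l // ltW.
have kn : k * n <= 2 * (c0 * K).
  have E : (2 * T)^-1 * (n^-1 * M0 + n * C) = k * n / 2.
    rewrite -n2 /T; field; rewrite !gt_eqF //; lra.
  rewrite E in BK; have := le_trans kB BK; rewrite (mulrC K); move: (k * n) (c0 * K) => q r; lra.
have nK : n <= 2 * c0 / k * K.
  by rewrite mulrAC ler_pdivlMr // mulrC -mulrA.
rewrite -n2; apply: (@le_trans _ _ ((2 * c0 / k * K) ^+ 2)).
  have K0 : 0 <= K := expR_ge0 _.
  by rewrite lerXn2r ?nnegrE ?(ltW n0) // (le_trans (ltW n0)).
rewrite exprMn -(mulrA (_ ^+ 2)) ler_wpM2l ?sqr_ge0 // /K expr2 -!expRD ler_expR.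
have -> : p / 2 * (a + T) + p / 2 * (a + T) = p * T + p * a by field.
by rewrite lerD2r ler_piMl // ltW.
Qed.

(* Scale selection. If the average of [expR (p b(f))] grows by a factor less than [D] from one scale to the next, the Poincare inequality makes it comparable with [expR] of the mean of [p b(f)]. The mean itself changes by at most a constant per scale, so growth at every scale would contradict the upper bound on [b]. *)
Lemma john_nirenberg : exists2 p, [/\ 0 < p, p <= 1, goodq p & goodq (- p)] &
  exists2 C, 0 < C & forall f g b b' B, sol f g -> contraction b b' -> (forall y : R, b y <= B) ->
  I (fun x => tent 3 x * expR (p * b (f x))) <=
    C * expR (p * mean (tent 3) (fun x => b (f x))).
Proof.
pose phi : V -> R := tent 3.
have cphi : Cc phi := @Cc_tent R N 3.
have phi0 x : 0 <= phi x := tent_ge0 3 x.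
pose c0 := I phi; have c00 : 0 < c0 by apply: I_tent_gt0.
have phib x : 0 <= phi x <= tent 3 x by rewrite phi0 /=.
have [Cv Cv0 osc] := mean_oscillation (ler0n R 3).
have [C4 C40 expm] := exp_mean c00 (divr_ge0 Cv0 (ltW (mulr_gt0 (ltr0n R 2) c00))).
have [Cp [M1 [Cp0 poin]]] := poincare S sigma_gt0 3.
have [Ce [M2 [Ce0 M20 enrg]]] := energy (addr_ge0 (normr_ge0 M1) (ler0n _ 2)).
pose l := M2 + 3; have l1 : 1 <= l by rewrite /l; lra.
have l0 : 0 < l by exact: lt_le_trans l1.
have lV0 : 0 < l^-1 by rewrite invr_gt0.
pose phi1 x := phi (dil sigma l^-1 x).
have cphi1 : Cc phi1 := Cc_dil sigma lV0 cphi.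
have [L1 L10 sL1] := Cc_supp cphi1.
have LL : 0 <= Num.max 5 L1 by rewrite le_max ler0n.
have phi1b x : 0 <= phi1 x <= tent (Num.max 5 L1) x.
  rewrite /phi1 phi0 /=; have [xL|/sL1 H] := leP `|x| L1; last by rewrite -/(phi1 x) H tent_ge0.
  by rewrite (le_trans (tent_le1 _ _)) // tent_ge1 // le_max xL orbT.
have phib' x : 0 <= phi x <= tent (Num.max 5 L1) x.
  rewrite phi0 /=; apply: tent_le => H; rewrite le_max; apply/orP; left.
  by apply: le_trans H _; rewrite -natrD.
have j0 : 0 < jac sigma l := jac_gt0 _ l0.
have phi1K x : phi1 (dil sigma l x) = phi x by rewrite /phi1 dilM mulVf ?dil1 // gt_eqF.
have Iscale h : continuous h -> I (fun x => phi x * h (dil sigma l x)) = (jac sigma l)^-1 * I (fun x => phi1 x * h x).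
  move=> ch; rewrite -(I_dil sigma l0 (CcM cphi1 ch)); congr I; apply/funext => x.
  by rewrite phi1K.
have Iphi1 : I phi1 = jac sigma l * c0.
  by have := I_dil sigma l0 cphi1; under eq_fun do rewrite phi1K; rewrite -/c0 => ->; rewrite mulVKf ?gt_eqF.
have Iphi1_0 : 0 < I phi1 by rewrite Iphi1 mulr_gt0.
have [C3 C30 mdiff] := mean_diff LL cphi1 cphi phi1b phib' Iphi1_0 c00.
pose D := 2 * expR C3.
have D0 : 0 < D by rewrite mulr_gt0 ?expR_gt0.
pose E := Cp * Ce * jac sigma l * D.
have E0 : 0 <= E by rewrite /E !mulr_ge0 // ltW.
have E1 : 0 < E + 1 by rewrite ltr_wpDl.
have [J JP] : exists J, forall k, (J <= k)%N -> (2^-1 : R) ^+ k < c0 / (E + 1).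
  by apply: pow_lt; rewrite ?invr_ge0 ?divr_gt0 //; lra.
pose e : R := 2^-1 ^+ J.+1.
have e0 : 0 < e by rewrite exprn_gt0 // invr_gt0.
have e1 : e <= 2^-1 by rewrite /e exprS ler_piMr ?invr_ge0 // exprn_ile1 ?invr_ge0 //; lra.
pose p := 2 / 3 * e.
have p0 : 0 < p by rewrite mulr_gt0.
have p1 : p <= 1 / 2 by rewrite /p; lra.
have small : E * p ^+ 2 <= c0.
  have eE : e * (E + 1) <= c0 by rewrite -ler_pdivlMr // ltW // JP.
  have pe : p ^+ 2 <= e.
    by apply: (@le_trans _ _ p); [rewrite expr2 ler_piMl ?(ltW p0) //; lra|rewrite /p; lra].
  apply: le_trans eE; rewrite mulrC; apply: ler_pM => //; first exact: sqr_ge0.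
  by rewrite lerDl.
have eX n : exists2 t : R, 0 < t & (e * 2 ^+ n = t /\ (t <= 2^-1 \/ 1 <= t)).
  exists (e * 2 ^+ n); first by rewrite mulr_gt0 // exprn_gt0.
  split=> //; rewrite /e exprVn mulrC; have [nJ|Jn] := leqP n J.
    left; rewrite ler_pdivrMr ?exprn_gt0 // exprS mulrA mulVf // mul1r.
    by rewrite ler_weXn2l // ler1n.
  by right; rewrite ler_pdivlMr ?exprn_gt0 // mul1r ler_weXn2l // ler1n.
have gp : goodq p.
  move=> n /=; have [t t0 [te tt]] := eX n.
  have -> : 2 * p * 2 ^+ n = 4 / 3 * t by rewrite -te /p; field.
  by split; [rewrite gt_eqF // mulr_gt0|case: tt => tt; [left|right]; lra].
have gmp : goodq (- p).
  move=> n /=; have [t t0 [te tt]] := eX n.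
  have -> : 2 * - p * 2 ^+ n = - (4 / 3 * t) by rewrite -te /p; field.
  by split; [rewrite oppr_eq0 gt_eqF // mulr_gt0|left; lra].
have p1' : p <= 1 by lra.
exists p => //; exists C4 => // f g b b' B sfg cb bB.
pose M f := I (fun x => phi x * expR (p * b (f x))).
pose a f := mean phi (fun x => b (f x)).
have [cb' db b1] := cb.
have cbb : continuous b by move=> y; exact: der_cont (db y).
have ceb (t : R) : continuous (fun y : R => expR (t * b y)).
  by apply: (@cont_comp _ _ _ (fun z : R => expR (t * z))) => //; exact: cont_expM.
have deb (t : R) (y : R) : is_derive y 1 (fun y : R => expR (t * b y)) (t * b' y * expR (t * b y)).
  have -> : t * b' y * expR (t * b y) = t * expR (t * b y) * b' y by ring.
  by have D1 := expM_der t (b y); apply: (@is_derive1_comp _ (fun z => expR (t * z)) b).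
have cdeb (t : R) : continuous (fun y : R => t * b' y * expR (t * b y)).
  by apply: contM => //; apply: contM => //; exact: contC.
have cM f' : continuous f' -> Cc (fun x => phi x * expR (p * b (f' x))).
  by move=> cf'; apply: CcM => //; exact: (cont_comp (ceb p) cf').
have M0 f' : continuous f' -> 0 < M f'.
  move=> cf'; apply: (I_gt0 (x := 0)) => [|x|]; first exact: cM.
    by rewrite mulr_ge0 // expR_ge0.
  by rewrite mulr_gt0 ?expR_gt0 // /phi tent_eq1 // normr0.
have good f' g' : sol f' g' -> M (fun x => f' (dil sigma l x)) <= D * M f' -> M f' <= C4 * expR (p * a f').
  move=> sf' MD; have [cf' hf' _] := sf'.
  have [ch hh] := contraction_hd cb sf'.
  apply: (expm phi (fun x => b (f' x)) p cphi phi0 erefl ch p0 p1').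
    have := osc f' g' b b' phi phi sf' cb cphi cphi phib phib.
    rewrite -/(a f') /a /mean -/c0; set Y := I (fun x => phi x * b (f' x)); set X := I _ => H.
    have c1 : Cc (fun x => phi x * b (f' x)) by exact: CcM.
    have c2 : Cc (fun x => phi x * b (f' x) ^+ 2) by apply: CcM => //; exact: contX.
    have -> : (fun x => phi x * (b (f' x) - Y / c0) ^+ 2) =
      (fun x => phi x * b (f' x) ^+ 2 - 2 * (Y / c0) * (phi x * b (f' x)) + (Y / c0) ^+ 2 * phi x).
      by apply/funext => x; ring.
    rewrite ID; [|by apply: CcB => //; exact: CcZ|exact: CcZ].
    rewrite IB // ?IZ //; last exact: CcZ.
    rewrite -/X -/Y -/c0 ler_pdivlMr ?mulr_gt0 //; apply: le_trans H.
    by rewrite le_eqVlt; apply/orP; left; apply/eqP; field; rewrite gt_eqF.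
  rewrite -/(M f'); set Y := I _.
  have hs i := hd_comp (cdeb (p / 2)) (deb (p / 2)) (hf' i).
  have cs := cont_comp (ceb (p / 2)) cf'.
  have sq x : expR (p / 2 * b (f' x)) ^+ 2 = expR (p * b (f' x)).
    by rewrite expr2 -expRD; congr expR; field.
  have := poin _ _ phi phi cs hs cphi cphi phib phib; rewrite -/c0 -/Y.
  have -> : (fun x => phi x * expR (p / 2 * b (f' x)) ^+ 2) = (fun x => phi x * expR (p * b (f' x))).
    by apply/funext => x; rewrite sq.
  rewrite -/(M f') => H.
  suff K : Cp * I (fun x => tent M1 x * gsq (fun i x => p / 2 * b' (f' x) * expR (p / 2 * b (f' x)) * g' i x) x) <= c0 * M f'.
    have {H}K := le_trans H K; rewrite -subr_ge0.
    move: K; have -> : c0 * M f' - 2 * (Y * Y) + c0 * M f' = 2 * (c0 * M f' - Y ^+ 2) by ring.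
    have -> : Y ^+ 2 - c0 / 2 * M f' = (c0 * M f' - 2 * (c0 * M f' - Y ^+ 2)) / 2 by field.
    by move=> K; rewrite divr_ge0 // subr_ge0.
  have cgg : continuous (gsq g') := cont_gsq hf'.
  have cpb := cont_comp (ceb p) cf'.
  have half : 0 < 1 / 2 :> R by rewrite divr_gt0.
  have kb : forall y : R, 1 / 2 * expR (p * b y) <= expR (p * b y) - p * b' y * expR (p * b y).
    move=> y; rewrite -[X in X - _]mul1r -mulrBl ler_wpM2r ?expR_ge0 //.
    have : p * b' y <= p * 1.
      by rewrite ler_wpM2l ?(ltW p0) // (le_trans (ler_norm _)).
    by rewrite mulr1 => /le_trans /(_ p1); move: (p * b' y) => q; lra.
  have en := enrg f' g' _ _ _ sf' (ceb p) (cdeb p) (deb p) (fun y : R => expR_gt0 (p * b y)) half (or_introl kb).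
  have cE : Cc (fun x => tent (`|M1| + 2) x * (expR (p * b (f' x)) * gsq g' x)).
    by apply: CcM; [exact: Cc_tent|exact: contM].
  have en2 : I (fun x => tent M1 x * gsq (fun i x => p / 2 * b' (f' x) * expR (p / 2 * b (f' x)) * g' i x) x) <=
      p ^+ 2 / 4 * I (fun x => tent (`|M1| + 2) x * (expR (p * b (f' x)) * gsq g' x)).
    rewrite -IZ //; apply: I_le => [||x]; [by apply: CcM; [exact: Cc_tent|exact: cont_gsq hs]|exact: CcZ|].
    rewrite mulrCA; apply: ler_pM; rewrite ?tent_ge0 ?gsq_ge0 //.
      by apply: tent_le => xM; rewrite (le_trans xM) // lerD2r ler_norm.
    rewrite mulrA /gsq mulr_sumr; apply: ler_sum => i _.
    have -> : (p / 2 * b' (f' x) * expR (p / 2 * b (f' x)) * g' i x) ^+ 2 =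
       b' (f' x) ^+ 2 * (p ^+ 2 / 4 * expR (p * b (f' x)) * g' i x ^+ 2) by rewrite -sq; field.
    apply: ler_piMl.
      by apply: (mulr_ge0 _ (sqr_ge0 _)); rewrite mulr_ge0 ?expR_ge0 // divr_ge0 // sqr_ge0.
    by rewrite -real_normK ?num_real // exprn_ile1.
  have en3 : I (fun x => tent M2 x * expR (p * b (f' x))) <= jac sigma l * M (fun x => f' (dil sigma l x)).
    rewrite /M (Iscale (fun x => expR (p * b (f' x)))) // mulVKf ?gt_eqF //.
    apply: I_le => [||x]; [by apply: CcM => //; exact: Cc_tent|exact: CcM|].
    rewrite ler_wpM2r ?expR_ge0 // /phi1 /phi; apply: tent_le => xM.
    apply/rv_norm_le => // j; rewrite dilE normrM.
    have xj := le_trans (coord_le_norm x j) xM.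
    apply: (@le_trans _ _ (l^-1 * (M2 + 2))); last first.
      by rewrite ler_pdivrMl // /l; lra.
    apply: ler_pM => //; rewrite ger0_norm ?exprn_ge0 ?(ltW lV0) //.
    rewrite -[leRHS]expr1 ler_wiXn2l ?(ltW lV0) ?sigma_gt0 //.
    by rewrite invf_le1.
  apply: le_trans (ler_wpM2l Cp0 en2) _.
  apply: (@le_trans _ _ (Cp * (p ^+ 2 / 4 * (Ce / (1 / 2) ^+ 2 * (jac sigma l * (D * M f')))))).
    rewrite ler_wpM2l // ler_wpM2l ?divr_ge0 ?sqr_ge0 //; apply: le_trans en _.
    rewrite ler_wpM2l ?divr_ge0 ?sqr_ge0 //; apply: le_trans en3 _.
    by rewrite ler_wpM2l // ltW.
  have -> : Cp * (p ^+ 2 / 4 * (Ce / (1 / 2) ^+ 2 * (jac sigma l * (D * M f')))) = E * p ^+ 2 * M f'.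
    by rewrite /E; field.
  by rewrite ler_wpM2r // ltW // M0.
have shift f' g' : sol f' g' -> a (fun x => f' (dil sigma l x)) <= a f' + C3.
  move=> sf'; have [ch hh] := contraction_hd cb sf'.
  have -> : a (fun x => f' (dil sigma l x)) = mean phi1 (fun x => b (f' x)).
    rewrite /a /mean (Iscale (fun x => b (f' x))) // Iphi1 -/c0; field.
    by rewrite !gt_eqF.
  have := mdiff f' g' b b' sf' cb; rewrite -/(a f') ler_norml => /andP[_].
  by rewrite lerBlDl.
have Mb f' : continuous f' -> M f' <= c0 * expR (p * B).
  move=> cf'; rewrite mulrC -IZ //; apply: I_le => [||x]; [exact: cM|exact: CcZ|].
  by rewrite mulrC ler_wpM2r // ler_expR ler_wpM2l // ltW.
have ind n : forall f' g', sol f' g' -> M f' <= C4 * expR (p * a f') \/ M f' * 2 ^+ n <= c0 * expR (p * B).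
  elim: n => [|n IH] f' g' sf'; have [cf' _ _] := sf'; first by right; rewrite mulr1 Mb.
  have [MD|MD] := leP (M (fun x => f' (dil sigma l x))) (D * M f'); first by left; exact: good sf' MD.
  have sd := sol_dil l0 sf'.
  have eC : 1 <= expR C3 by rewrite -expR0 ler_expR.
  have [H|H] := IH _ _ sd; [left|right].
    rewrite -(ler_pM2l D0); apply: le_trans (ltW MD) _; apply: le_trans H _.
    rewrite [leRHS]mulrCA ler_wpM2l ?(ltW C40) //.
    apply: (@le_trans _ _ (expR C3 * expR (p * a f'))).
      rewrite -expRD ler_expR; apply: (@le_trans _ _ (p * (a f' + C3))).
        by rewrite ler_wpM2l ?(ltW p0) // (shift f' g').
      by rewrite mulrDr addrC lerD2r ler_piMl.
    by rewrite ler_wpM2r ?expR_ge0 // /D ler_peMl ?expR_ge0 // ler1n.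
  apply: le_trans H; rewrite exprS mulrA ler_wpM2r ?exprn_ge0 //.
  apply: le_trans (ltW MD); rewrite mulrC ler_wpM2r ?(ltW (M0 _ cf')) //.
  by rewrite /D ler_peMr.
have [//|bad] := leP (M f) (C4 * expR (p * a f)).
have [cf _ _] := sfg.
have bad' n : M f * 2 ^+ n <= c0 * expR (p * B).
  by have [H|//] := ind n f g sfg; move: bad; rewrite ltNge H.
have : M f <= 0.
  apply: (@le_geo _ _ _ (c0 * expR (p * B))) => [|n]; first by rewrite mulr_ge0 ?expR_ge0 // ltW.
  by rewrite add0r exprVn mulrC ler_pdivlMr ?exprn_gt0.
by rewrite leNgt M0.
Qed.

(* Bounded above, and increases to [s * y] as [d] tends to 0. *)
Definition softcap (s d : R) (y : R) : R := - ln (expR (- (s * y)) + d).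

Section Softcap.
Variables (s d : R).
Hypotheses (s1 : `|s| <= 1) (d0 : 0 < d).

Let w_gt0 (y : R) : 0 < expR (- (s * y)) + d. Proof. by rewrite addr_gt0 ?expR_gt0. Qed.

Lemma softcap_contraction :
  contraction (softcap s d) (fun y : R => s * (expR (- (s * y)) / (expR (- (s * y)) + d))).
Proof.
have E (y : R) : expR (- (s * y)) = expR (- s * y) by rewrite mulNr.
have ce : continuous (fun y : R => expR (- (s * y))) by under eq_fun do rewrite E; exact: cont_expM.
split.
- apply: contM; first exact: contC.
  apply: contM => // y; apply: cvgV; first by rewrite gt_eqF.
  by apply: cvgD; [exact: ce|exact: cvg_cst].
- move=> y; have dw : is_derive y 1 (fun y : R => expR (- (s * y)) + d) (- s * expR (- (s * y))).
    under eq_fun do rewrite E; rewrite E.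
    by apply: is_derive_eq (derD (expM_der (- s) y) (derC d y)) _; rewrite addr0.
  have dl := is_derive1_ln (w_gt0 y).
  have := derZ (-1) (@is_derive1_comp _ (@ln R) (fun y : R => expR (- (s * y)) + d) _ _ _ dl dw).
  rewrite (_ : (fun z : R => -1 * _) = softcap s d); last by apply/funext => z; rewrite mulN1r.
  by move=> D; apply: is_derive_eq D _; field; rewrite gt_eqF.
- move=> y; rewrite normrM -[1]mulr1 ler_pM //.
  rewrite ger0_norm ?divr_ge0 ?expR_ge0 ?(ltW (w_gt0 y)) //.
  by rewrite ler_pdivrMr // mul1r lerDl ltW.
Qed.

Lemma softcap_le (y : R) : softcap s d y <= s * y.
Proof. by rewrite /softcap lerNl -[X in X <= _]expRK ler_ln ?posrE ?expR_gt0 // lerDl ltW. Qed.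

Lemma softcap_ub (y : R) : softcap s d y <= - ln d.
Proof. by rewrite /softcap lerN2 ler_ln ?posrE // lerDr expR_ge0. Qed.

Lemma softcap_ge (y e : R) : 0 <= e -> d * expR (s * y) <= e -> s * y - ln (1 + e) <= softcap s d y.
Proof.
move=> e0 de; have e1 : 0 < 1 + e by rewrite ltr_wpDr.
rewrite /softcap lerNr opprB -[X in _ - X]opprK -[X in - - X](expRK (s * y)) opprK.
rewrite [X in _ <= X](_ : _ = ln ((1 + e) * expR (- (s * y)))); last first.
  by rewrite lnM ?posrE ?expR_gt0 // !expRK.
rewrite ler_ln ?posrE ?mulr_gt0 ?expR_gt0 // mulrDl mul1r lerD2l.
by rewrite expRN ler_pdivlMr ?expR_gt0.
Qed.

End Softcap.

(* [K] does not depend on the solution, so dilations bring arbitrary points near the origin. *)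
Lemma harnack : exists K, forall f g, sol f g -> forall x y, f x <= f y + K.
Proof.
have [p [p0 p1 gp gmp] [C C0 jn]] := john_nirenberg.
have [C' C'0 mos] := moser_exp S sigma_gt0.
have ct : Cc (tent 3 : V -> R) := @Cc_tent R N 3.
have c00 : 0 < I (tent 3) by apply: I_tent_gt0.
have one f g (s : R) : sol f g -> `|s| <= 1 -> I (fun x => tent 3 x * expR (p * (s * f x))) <=
    C * expR (p * mean (tent 3) (fun x => s * f x)).
  move=> sf s1; have [cf _ _] := sf.
  have [B B0 BP] := compact_bound (@compact_box R N 5) cf.
  apply: (le_epsM (M := C * expR (p * mean (tent 3) (fun x => s * f x)))) => e e0 e1.
  pose d := e / expR B; have d0 : 0 < d by rewrite divr_gt0 ?expR_gt0.
  have ctr := softcap_contraction s1 d0.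
  have H := jn f g _ _ _ sf ctr (softcap_ub s d0).
  have [cb _] := contraction_hd ctr sf.
  have ce h : continuous h -> Cc (fun x => tent 3 x * expR (p * h x)).
    move=> ch; apply: CcM => //; apply: (@cont_comp _ _ _ (fun z : R => expR (p * z))) => //.
    exact: cont_expM.
  have cs : continuous (fun x => s * f x) by apply: contM => //; exact: contC.
  apply: (@le_trans _ _ ((1 + e) * I (fun x => tent 3 x * expR (p * softcap s d (f x))))).
    rewrite -IZ; last exact: ce; apply: I_le => [||x]; [exact: ce|by apply: CcZ; exact: ce|].
    rewrite [leRHS]mulrCA; have [xL|Lx] := leP `|x| (3 + 2); last by rewrite tent_supp ?mul0r // ltW.
    rewrite ler_wpM2l ?tent_ge0 //.
    have fB : d * expR (s * f x) <= e.
      rewrite mulrAC ler_pdivrMr ?expR_gt0 // ler_wpM2l ?(ltW e0) // ler_expR.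
      apply: le_trans (ler_norm _) _; rewrite normrM -[leRHS]mul1r ler_pM // BP //=.
      by apply: le_trans xL _; rewrite -natrD.
    have := softcap_ge d0 (ltW e0) fB => K.
    apply: (@le_trans _ _ (expR (ln (1 + e) + p * softcap s d (f x)))); last first.
      by rewrite expRD lnK // posrE addr_gt0.
    rewrite ler_expR -lerBlDl; apply: le_trans (ler_wpM2l (ltW p0) K).
    by rewrite mulrBr lerD2l lerN2 ler_piMl // ln_ge0 // lerDl ltW.
  have zE (z : R) : z + e * z = (1 + e) * z by ring.
  rewrite zE ler_wpM2l ?addr_ge0 ?(ltW e0) //.
  apply: le_trans H _; rewrite ler_wpM2l ?(ltW C0) // ler_expR ler_wpM2l ?(ltW p0) //.
  rewrite /mean ler_wpM2r ?invr_ge0 ?(ltW c00) //; apply: I_le => [||x]; [exact: CcM|exact: CcM|].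
  by rewrite ler_wpM2l ?tent_ge0 // softcap_le.
pose K := ln ((C' * C) ^+ 2) / p.
have loc f g x y : sol f g -> qd x < 1 -> qd y < 1 -> f x <= f y + K.
  move=> sf x1 y1; have [cf _ _] := sf.
  have H1 : expR (p * f x) <= C' * (C * expR (p * mean (tent 3) f)).
    apply: le_trans (mos f g p sf gp x x1) _; rewrite ler_wpM2l ?(ltW C'0) //.
    have := one f g 1 sf; rewrite normr1 => /(_ (lexx _)).
    by rewrite (_ : (fun x => 1 * f x) = f) //; [under eq_fun do rewrite mul1r|apply/funext => z; rewrite mul1r].
  have H2 : expR (- p * f y) <= C' * (C * expR (- (p * mean (tent 3) f))).
    apply: le_trans (mos f g (- p) sf gmp y y1) _; rewrite ler_wpM2l ?(ltW C'0) //.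
    have := one f g (-1) sf; rewrite normrN1 => /(_ (lexx _)).
    have -> : mean (tent 3) (fun x => -1 * f x) = - mean (tent 3) f.
      rewrite /mean -mulNr; congr (_ / _); rewrite -IN; last exact: CcM.
      by congr I; apply/funext => z; ring.
    rewrite mulrN; under eq_fun do rewrite mulN1r mulrN -mulNr.
    by [].
  have C'C : 0 < C' * C by rewrite mulr_gt0.
  have : expR (p * (f x - f y)) <= (C' * C) ^+ 2.
    rewrite mulrBr -mulNr expRD.
    apply: le_trans (ler_pM (expR_ge0 _) (expR_ge0 _) H1 H2) _.
    rewrite le_eqVlt; apply/orP; left; apply/eqP.
    by rewrite expRN; field; rewrite gt_eqF ?expR_gt0.
  rewrite -[X in _ <= X](@lnK R) ?posrE ?exprn_gt0 // ler_expR mulrC -ler_pdivlMr //.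
  by rewrite -/K lerBlDl.
exists K => f g sf x y.
have near0 z : exists2 d : R, 0 < d & forall t : R, `|t| < d -> qd (dil sigma t z) < 1.
  have ch : continuous (fun t : R => qd (dil sigma t z)).
    by apply: (@cont_comp _ _ _ (@qd R N)); [exact: cont_qd|exact: cont_dill].
  have [d d0 dP] := (contP _).1 ch 0 1 ltr01; exists d => // t td.
  have := dP t; rewrite subr0 => /(_ td); rewrite dil0 // (_ : qd 0 = 0) ?subr0.
    exact: le_lt_trans (ler_norm _).
  by rewrite /qd big1 // => j _; rewrite mxE expr0n.
have [d1 d10 P1] := near0 x; have [d2 d20 P2] := near0 y.
pose t := Num.min d1 d2 / 2.
have m0 : 0 < Num.min d1 d2 by rewrite lt_min d10.
have t0 : 0 < t by rewrite divr_gt0.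
have td : t < Num.min d1 d2 by rewrite /t; lra.
have tV0 : 0 < t^-1 by rewrite invr_gt0.
have := loc _ _ (dil sigma t x) (dil sigma t y) (sol_dil tV0 sf).
rewrite !dilM mulVf ?gt_eqF // !dil1; apply; [apply: P1|apply: P2].
  by rewrite gtr0_norm // (lt_le_trans td) // ge_min lexx.
by rewrite gtr0_norm // (lt_le_trans td) // ge_min lexx orbT.
Qed.

End Harnack.

(** * Liouville property *)

Section Liouville.
Variables (R : realType) (N m : nat) (sigma : 'I_N -> nat) (S : flowsys R m sigma).
Hypothesis sigma_gt0 : forall j, (0 < sigma j)%N.
Local Notation V := 'rV[R]_N.
Local Notation I := (@I R N).
Local Notation hd := (hd S).
Implicit Types (f w psi : V -> R) (g dw dpsi : 'I_m -> V -> R) (x y : V) (i : 'I_m).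

Definition harmonic w dw := [/\ continuous w, forall i, hd i w (dw i) &
  forall psi dpsi, Cc psi -> (forall i, hd i psi (dpsi i)) ->
    I (fun x => \sum_i dpsi i x * dw i x) = 0].

Lemma harmonic_shift w dw (c : R) : harmonic w dw -> harmonic (fun x => w x + c) dw.
Proof.
move=> [cw hw weak]; split=> //; first by apply: contD => //; exact: contC.
by move=> i; have := hdD (hw i) (hdC S i c); under [fun x => dw i x + 0]eq_fun do rewrite addr0.
Qed.

Lemma harmonic_ln w dw : harmonic w dw -> (forall x, 0 < w x) ->
  sol S (fun x => ln (w x)) (fun i x => dw i x / w x).
Proof.
move=> [cw hw weak] w0.
have cl : continuous (fun x => ln (w x)).
  move=> x; apply: (@continuous_comp _ _ _ w (@ln R)); first exact: cw.
  exact: der_cont (is_derive1_ln (w0 x)).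
have cV : continuous (fun x => (w x)^-1).
  by move=> x; exact: (cvgV (lt0r_neq0 (w0 x)) (cw x)).
have hl i : hd i (fun x => ln (w x)) (fun x => dw i x / w x).
  split=> //; first by apply: contM => //; exact: cont_hd' (hw i).
  move=> x; have [_ _ dx] := hw i; rewrite mulrC.
  have D := dx x; have L : is_derive (w (fl S i 0 x)) 1 (@ln R) (w x)^-1.
    by rewrite fl0; exact: is_derive1_ln.
  exact: (@is_derive1_comp _ (@ln R) (fun c => w (fl S i c x))).
split=> // psi dpsi cp hp.
have hV i : hd i (fun x => (w x)^-1) (fun x => - (w x)^-1 * (dw i x / w x)).
  have := hd_comp (b := fun z => expR (-1 * z)) (b' := fun z => -1 * expR (-1 * z)) _ (expM_der (-1)) (hl i).
  have E x : expR (-1 * ln (w x)) = (w x)^-1 by rewrite mulN1r expRN lnK ?posrE.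
  have -> : (fun x => expR (-1 * ln (w x))) = (fun x => (w x)^-1) by apply/funext => x.
  have -> : (fun x => -1 * expR (-1 * ln (w x)) * (dw i x / w x)) = (fun x => - (w x)^-1 * (dw i x / w x)).
    by apply/funext => x; rewrite E mulN1r.
  by apply; apply: contM; [exact: contC|exact: cont_expM].
have cpV : Cc (fun x => psi x * (w x)^-1) by exact: CcM.
have := weak _ _ cpV (fun i => hdM (hp i) (hV i)).
have -> : (fun x => \sum_i (dpsi i x * (w x)^-1 + psi x * (- (w x)^-1 * (dw i x / w x))) * dw i x) =
    (fun x => (\sum_i dpsi i x * (dw i x / w x)) - psi x * gsq (fun i x => dw i x / w x) x).
  apply/funext => x; rewrite /gsq mulr_sumr -sumrB; apply: eq_bigr => i _.
  by field; rewrite gt_eqF.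
have c1 : Cc (fun x => \sum_i dpsi i x * (dw i x / w x)).
  by apply: Cc_sum => i; apply: CcM; [exact: Cc_hd (hp i) cp|exact: cont_hd' (hl i)].
have c2 : Cc (fun x => psi x * gsq (fun i x => dw i x / w x) x).
  by apply: CcM => //; exact: cont_gsq hl.
by rewrite IB // => /eqP; rewrite subr_eq0 => /eqP ->.
Qed.

Lemma liouville w dw : harmonic w dw -> (forall x, 0 < w x) -> forall x y, w x = w y.
Proof.
move=> hw w0; have [K KP] := harnack S sigma_gt0.
pose A := [set w x | x in [set: V]]%classic; pose c := inf A.
have A0 : has_inf A by split; [exists (w 0), 0|exists 0 => _ [x _ <-]; exact: ltW].
have cw x : c <= w x by apply: ge_inf; [exact: A0.2|exists x].
suff H x : w x = c by move=> x y; rewrite !H.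
apply/eqP; rewrite eq_le cw andbT.
apply: (le_epsM (M := 2 * expR K)) => e e0 _.
have [_ [y _ <-] yc] := inf_adherent e0 A0.
have ws0 z : 0 < w z + (e - c) by have := cw z; move: (w z) => a; lra.
have := KP _ _ (harmonic_ln (harmonic_shift (e - c) hw) ws0) x y.
rewrite -ler_expR expRD !lnK ?posrE // => H.
have : (w y + (e - c)) * expR K <= 2 * e * expR K.
  by rewrite ler_wpM2r ?expR_ge0 //; rewrite -/c in yc; lra.
rewrite mulrAC [2 * _ * _]mulrC; move: (_ * expR K) (e * _) H => p q; lra.
Qed.

End Liouville.

Section C1.
Variables (R : realType) (N : nat).
Local Notation V := 'rV[R]_N.
Implicit Types (f g : V -> R) (x : V) (j k : 'I_N).

Definition C1_fun f := (forall x, differentiable f x) /\ forall j, continuous (partial j f).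

Lemma C1_continuous f : C1_fun f -> continuous f.
Proof. by move=> [df _] x; exact: differentiable_continuous. Qed.

Lemma C1_smooth f : smooth_fun f -> C1_fun f.
Proof.
by move=> sf; split; [exact: smooth_diff|move=> j; apply: smooth_continuous; exact: smooth_partial].
Qed.

Lemma C1D f g : C1_fun f -> C1_fun g -> C1_fun (f \+ g).
Proof.
move=> [df cf] [dg cg]; split=> [x|j]; first exact: differentiableD.
by rewrite partialD //; exact: contD.
Qed.

Lemma C1M f g : C1_fun f -> C1_fun g -> C1_fun (f \* g).
Proof.
move=> hf hg; have [df cf] := hf; have [dg cg] := hg; split=> [x|j]; first exact: differentiableM.
by rewrite partialM //; apply: contD; apply: contM => //; exact: C1_continuous.
Qed.

Lemma C1_sum (T : Type) (r : seq T) (F : T -> V -> R) : (forall t, C1_fun (F t)) ->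
  C1_fun (fun x => \sum_(t <- r) F t x).
Proof.
move=> hF; elim: r => [|t r IH].
  by under eq_fun do rewrite big_nil; exact: C1_smooth (@smooth_cst R N 0).
by under eq_fun do rewrite big_cons; exact: C1D.
Qed.

Lemma C1_vf_act (X : V -> V) u : smooth_vf X -> C2_fun u -> C1_fun (vf_act X u).
Proof.
move=> sX [du cu]; apply: C1_sum => j; apply: C1M; first exact: C1_smooth.
by split=> [x|k]; [exact: (du [:: j])|exact: (cu [:: k; j])].
Qed.

End C1.

Section Concrete.
Variables (R : realType) (N m : nat) (sigma : 'I_N -> nat) (X : 'I_m -> 'rV[R]_N -> 'rV[R]_N).
Local Notation V := 'rV[R]_N.
Hypotheses (sigma_le : forall i j : 'I_N, (i <= j)%N -> (sigma i <= sigma j)%N)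
  (sigma_gt0 : forall i, (0 < sigma i)%N) (sX : forall i, smooth_vf (X i))
  (hX : forall i, hom_deg_one sigma (X i)).

Lemma weight_lt (k j : 'I_N) : (sigma k < sigma j)%N -> (k < j)%N.
Proof. by move=> kj; rewrite ltnNge; apply/negP => /sigma_le; rewrite leqNgt kj. Qed.

Lemma flowsys_exists : hormander X -> exists S : flowsys R m sigma, fl S = fun i => flow sigma (X i).
Proof.
move=> /(chow_param sigma_gt0 sX hX)[P [cP tP lP]].
have tri i s : triangular (flow sigma (X i) s).
  by move=> x y j xy; apply: flow_tri => // k /weight_lt; exact: xy.
have triP x : triangular (fun t => run sigma X (P t) x).
  by move=> t t' j tt; apply: tP => k /weight_lt; exact: tt.
have co i j : exists g : V -> R, continuous g /\
    forall x, is_derive (0 : R) 1 (fun s => flow sigma (X i) s x 0 j) (g x).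
  exists (fun x => X i x 0 j); split; first exact: smooth_continuous (sX i j).
  by move=> x; have := flow_der_coord sigma_gt0 (sX i) (hX i) j 0 x; rewrite flow0.
by exists (@FlowSys R N m sigma (fun i => flow sigma (X i)) (fun i => flow0 sigma (X i))
  (fun i => flowD sigma_gt0 (sX i) (hX i)) (fun i => cont_flow sigma_gt0 (sX i) (hX i)) tri
  (fun i l s x l0 => flow_dil sigma_gt0 (sX i) (hX i) s x l0) co P cP triP lP).
Qed.

Variable S : flowsys R m sigma.
Hypothesis SX : fl S = fun i => flow sigma (X i).

Lemma hd_vf_act i f : C1_fun f -> hd S i f (vf_act (X i) f).
Proof.
move=> hf; have [df cf] := hf; split; first exact: C1_continuous.
  by apply: cont_sum => j; apply: contM; [exact: smooth_continuous (sX i j)|exact: cf].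
move=> x; rewrite SX; have := @flow_der _ _ _ sigma_gt0 _ (sX i) (hX i) f 0 x (df _).
by rewrite flow0.
Qed.

Lemma harmonic_expN u : C2_fun u -> (forall x, - sublap X u x + hgrad_norm2 X u x = 0) ->
  harmonic S (fun x => expR (-1 * u x)) (fun i x => -1 * expR (-1 * u x) * vf_act (X i) u x).
Proof.
move=> hu pde.
have u1 : C1_fun u.
  split=> [x|j x]; first exact: (hu.1 [::]).
  by apply: differentiable_continuous; exact: (hu.1 [:: j]).
have cde : continuous (fun z : R => -1 * expR (-1 * z)) by apply: contM; [exact: contC|exact: cont_expM].
have hw i : hd S i (fun x => expR (-1 * u x)) (fun x => -1 * expR (-1 * u x) * vf_act (X i) u x).
  exact: (hd_comp (b := fun z => expR (-1 * z)) cde (expM_der (-1)) (hd_vf_act i u1)).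
split=> //.
  by apply: (@cont_comp _ _ _ (fun z : R => expR (-1 * z))); [exact: cont_expM|exact: C1_continuous].
move=> psi dpsi cp hp.
have hdw i := hdM (hdZ (-1) (hw i)) (hd_vf_act i (C1_vf_act (sX i) hu)).
have cpd i := CcM cp (cont_hd (hdw i)).
have Z i := I_hd0 (hdM (hp i) (hdw i)) (cpd i).
have cZ i := Cc_hd (hdM (hp i) (hdw i)) (cpd i).
have := I_sum (index_enum 'I_m) cZ; rewrite [X in _ = X -> _]big1 => [Z0|i _]; last exact: Z.
rewrite -[RHS]Z0; congr I; apply/funext => x.
rewrite big_split /= -[LHS]addr0; congr (_ + _).
rewrite -mulr_sumr; set s := \sum_i _.
suff -> : s = 0 by rewrite mulr0.
have -> : s = expR (-1 * u x) * (- sublap X u x + hgrad_norm2 X u x).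
  rewrite /s /sublap /hgrad_norm2 -sumrN -big_split mulr_sumr /=; apply: eq_bigr => i _.
  by rewrite mxE; ring.
by rewrite pde mulr0.
Qed.

End Concrete.

Theorem theorem6p2 (R : realType) (N m : nat) (sigma : 'I_N -> nat)
  (X : 'I_m -> 'rV[R]_N -> 'rV[R]_N) (u : 'rV[R]_N -> R) :
  (3 <= N)%N -> (m <= N)%N ->
  (forall i : 'I_N, nat_of_ord i = 0%N -> sigma i = 1%N) ->
  (forall i j : 'I_N, (i <= j)%N -> (sigma i <= sigma j)%N) ->
  (forall i : 'I_N, (0 < sigma i)%N) ->
  (forall i, smooth_vf (X i)) ->
  vf_lin_indep X ->
  (forall i, hom_deg_one sigma (X i)) ->
  hormander X ->
  C2_fun u ->
  (forall x, - sublap X u x + hgrad_norm2 X u x = 0) ->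
  exists c : R, forall x, u x = c.
Proof.
move=> _ _ _ sigma_le sigma_gt0 sX _ hX hor hu pde.
have [S SX] := flowsys_exists sigma_le sigma_gt0 sX hX hor.
exists (u 0) => x.
have hw := harmonic_expN sigma_gt0 sX hX SX hu pde.
have := liouville sigma_gt0 hw (fun x => expR_gt0 _) x 0.
by move=> /expR_inj; rewrite !mulN1r => /oppr_inj.
Qed.
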